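(* Let $\mathcal{C}$ be a class of finite groups closed under subgroups, quotients and extensions. Let $(\mathcal{G},\Gamma)$ be a finite injective commensurating graph of pro-$\mathcal{C}$ groups, with vertex set $V$ and fundamental pro-$\mathcal{C}$ group $\Pi$. If $(\mathcal{G},\Gamma)$ is tame over a closed normal subgroup $N$ of $\Pi$, then: (i) there is a closed normal subgroup $M$ of $\Pi$ which is free pro-$\mathcal{C}$ of finite rank such that $\mathcal{G}(v)\cap M=1$ and $\mathcal{G}(v)M$ is open in $\Pi$ for every $v\in V$; (ii) for such an $M$, the pro-$\mathcal{C}$ group $\Pi$ embeds as an open subgroup of $\Pi/M\times\Pi/N$.
   Context: A graph $\Gamma$ is a set that is a disjoint union of a vertex set $V$ and an edge set $E$, with maps $d_0,d_1:\Gamma\to V$ restricting to the identity on $V$. A finite graph of pro-$\mathcal{C}$ groups $(\mathcal{G},\Gamma)$ over a finite graph $\Gamma$ consists of pro-$\mathcal{C}$ groups (inverse limits of groups in $\mathcal{C}$) $\mathcal{G}(m)$ for each $m\in\Gamma$ and continuous monomorphisms $\partial_i:\mathcal{G}(e)\to\mathcal{G}(d_i(e))$ for $e\in E$, $i=0,1$. It is commensurating if $\Gamma$ is connected and $\partial_i(\mathcal{G}(e))$ is open in $\mathcal{G}(d_i(e))$ for all $e\in E$, $i=0,1$. Fix a maximal subtree $T$ of $\Gamma$. The fundamental pro-$\mathcal{C}$ group $\Pi=\Pi_1^{\mathcal{C}}(\mathcal{G},\Gamma)$ is the quotient of the free pro-$\mathcal{C}$ product $F_{\mathcal{C}}\amalg\coprod_{v\in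 V}\mathcal{G}(v)$, where $F_{\mathcal{C}}$ is the free pro-$\mathcal{C}$ group with basis $\{t_e: e\in E\}$, by the closed normal subgroup generated by $\{t_e: e\in E\cap T\}\cup\{\partial_0(g)^{-1}t_e\partial_1(g)t_e^{-1}: g\in\mathcal{G}(e), e\in E\}$; up to isomorphism it does not depend on $T$. There are natural homomorphisms $\varphi_v:\mathcal{G}(v)\to\Pi$; $(\mathcal{G},\Gamma)$ is injective if every $\varphi_v$ is injective, in which case each $\mathcal{G}(v)$ is identified with its image in $\Pi$, and each edge group $\mathcal{G}(e)$ with a subgroup of $\Pi$ via $\partial_0$ (or, up to conjugation by $t_e$, via $\partial_1$). A finite injective commensurating graph of pro-$\mathcal{C}$ groups is tame over a closed normal subgroup $N$ of $\Pi$ if $N$ is contained as an open subgroup in each vertex group and each edge group, and the image of $\Pi$ in $\operatorname{Out}N$ (continuous automorphisms modulo inner ones) induced by conjugation is finite. ''Embeds as an open subgroup'' means that there is a continuous monomorphism with open image. *)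

(* Defs.v *)
From HB Require Import structures.
From mathcomp Require Import all_boot all_order all_algebra all_fingroup.
From mathcomp Require Import all_classical topology function_spaces.

Set Implicit Arguments.
Unset Strict Implicit.
Unset Printing Implicit Defensive.

Import Order.TTheory.

Local Open Scope group_scope.
Local Open Scope classical_set_scope.
Local Open Scope quotient_scope.

(** * Topological groups *)

HB.mixin Record isTopologicalGroup G of monoid.Group G & Topological G := {
  mulg_continuous : continuous (fun x : G * G => x.1 * x.2);
  invg_continuous : continuous (fun x : G => x^-1)
}.

#[short(type="topologicalGroupType")]
HB.structure Definition TopologicalGroup :=
  {G of monoid.Group G & Topological G & isTopologicalGroup G}.

Fact pair_continuous (S T U : topologicalType) (f : S -> T) (g : S -> U) :
  continuous f -> continuous g -> continuous (fun x => (f x, g x)).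
Proof. by move=> cf cg x; apply: cvg_pair; [exact: cf | exact: cg]. Qed.

Fact comp_continuous (S T U : topologicalType) (f : S -> T) (g : T -> U) :
  continuous f -> continuous g -> continuous (fun x => g (f x)).
Proof. by move=> cf cg x; apply: continuous_comp; [exact: cf | exact: cg]. Qed.

Fact fst_continuous (S T : topologicalType) : continuous (@fst S T).
Proof. by move=> x; exact: cvg_fst. Qed.

Fact snd_continuous (S T : topologicalType) : continuous (@snd S T).
Proof. by move=> x; exact: cvg_snd. Qed.

Section ContinuousOperations.
Variables (S : topologicalType) (G : topologicalGroupType).
Implicit Types f g : S -> G.

Lemma continuousMg f g : continuous f -> continuous g ->
  continuous (fun x => f x * g x).
Proof.
move=> cf cg; apply: (comp_continuous (f := fun x => (f x, g x))
  (g := fun x : G * G => x.1 * x.2)); last exact: mulg_continuous.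
exact: pair_continuous.
Qed.

Lemma continuousVg f : continuous f -> continuous (fun x => (f x)^-1).
Proof. by move=> cf; apply: (comp_continuous cf); exact: invg_continuous. Qed.

Lemma continuous_cst (a : G) : continuous (fun _ : S => a).
Proof. by move=> x; exact: cvg_cst. Qed.

End ContinuousOperations.

Section ProductGroup.
Variables G H : topologicalGroupType.

Fact pair_mulg_continuous :
  continuous (fun x : (G * H) * (G * H) => x.1 * x.2).
Proof.
apply: (pair_continuous (f := fun x : (G * H) * (G * H) => x.1.1 * x.2.1)
  (g := fun x : (G * H) * (G * H) => x.1.2 * x.2.2)); apply: continuousMg.
- exact: comp_continuous (@fst_continuous _ _) (@fst_continuous _ _).
- exact: comp_continuous (@snd_continuous _ _) (@fst_continuous _ _).
- exact: comp_continuous (@fst_continuous _ _) (@snd_continuous _ _).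
- exact: comp_continuous (@snd_continuous _ _) (@snd_continuous _ _).
Qed.

Fact pair_invg_continuous : continuous (fun x : G * H => x^-1).
Proof.
apply: (pair_continuous (f := fun x : G * H => x.1^-1)
  (g := fun x : G * H => x.2^-1)); apply: continuousVg.
- exact: fst_continuous.
- exact: snd_continuous.
Qed.

HB.instance Definition _ := isTopologicalGroup.Build (G * H)%type
  pair_mulg_continuous pair_invg_continuous.

End ProductGroup.

Definition continuous_morphism (G H : topologicalGroupType) (f : G -> H) :=
  continuous f /\ {morph f : x y / x * y}.

Definition embeds_as_open (G H : topologicalGroupType) :=
  exists f : G -> H, [/\ continuous_morphism f, injective f & open (range f)].

(** * Closed normal subgroups *)

Record closedNormalSubgroup (G : topologicalGroupType) := ClosedNormalSubgroup {
  cns_set :> set G;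
  cns_closed : closed cns_set;
  cns1 : cns_set 1;
  cnsM : forall x y, cns_set x -> cns_set y -> cns_set (x * y);
  cnsV : forall x, cns_set x -> cns_set x^-1;
  cnsJ : forall g x, cns_set x -> cns_set (x ^ g)
}.

Section ClosedNormalClosure.
Variables (G : topologicalGroupType) (R : set G).

Definition ncl_set : set G :=
  [set x | forall K : closedNormalSubgroup G, R `<=` K -> cns_set K x].

Fact ncl_closed : closed ncl_set.
Proof.
move=> x clx K RK; apply: (cns_closed (c := K)) => U /clx [y [ny Uy]].
by exists y; split => //; exact: ny.
Qed.

Definition closed_normal_closure : closedNormalSubgroup G.
Proof.
exists ncl_set; first exact: ncl_closed.
- by move=> K _; exact: cns1.
- by move=> x y nx ny K RK; apply: cnsM; [exact: nx | exact: ny].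
- by move=> x nx K RK; apply: cnsV; exact: nx.
- by move=> g x nx K RK; apply: cnsJ; exact: nx.
Defined.

End ClosedNormalClosure.

Section SubgroupType.
Variables (G : topologicalGroupType) (N : closedNormalSubgroup G).

Fact cns_group_closed : group_closed (mem (cns_set N)).
Proof.
split=> [|x y]; first by apply/mem_set; exact: cns1.
by move=> /set_mem Nx /set_mem Ny; apply/mem_set/cnsM => //; exact: cnsV.
Qed.

(** [N] as a topological group in its own right, with the subspace topology. *)
Definition cns_type : Type := set_type N.

HB.instance Definition _ := Topological.copy cns_type (set_type N).
HB.instance Definition _ := SubChoice.copy cns_type (set_type N).
HB.instance Definition _ :=
  SubChoice_isSubGroup.Build G (mem (cns_set N)) cns_type cns_group_closed.

Definition cns_val : cns_type -> G := set_val.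

Fact cns_val_inj : injective cns_val.
Proof. exact: val_inj. Qed.

Fact cns_valM : {morph cns_val : x y / x * y}.
Proof. by []. Qed.

Fact cns_valV : {morph cns_val : x / x^-1}.
Proof. by []. Qed.

Fact cns_val_continuous : continuous cns_val.
Proof. exact: (@initial_continuous _ _ (set_val : set_type N -> G)). Qed.

Fact cns_continuous (T : topologicalType) (f : T -> cns_type) :
  continuous (cns_val \o f) -> continuous f.
Proof.
move=> /continuousP cf; apply/continuousP => _ [B oB <-].
by have := cf _ oB; rewrite comp_preimage.
Qed.

Fact cns_mulg_continuous : continuous (fun x : cns_type * cns_type => x.1 * x.2).
Proof.
apply: cns_continuous.
rewrite (_ : _ \o _ =
    (fun x : cns_type * cns_type => cns_val x.1 * cns_val x.2)) //.
by apply: continuousMg; apply: comp_continuous;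
  do ?[exact: fst_continuous | exact: snd_continuous | exact: cns_val_continuous].
Qed.

Fact cns_invg_continuous : continuous (fun x : cns_type => x^-1).
Proof.
apply: cns_continuous.
rewrite (_ : _ \o _ = (fun x : cns_type => (cns_val x)^-1)) //.
by apply: continuousVg; exact: cns_val_continuous.
Qed.

HB.instance Definition _ := isTopologicalGroup.Build cns_type
  cns_mulg_continuous cns_invg_continuous.

End SubgroupType.

(** * Quotients *)

Section Quotient.
Variables (G : topologicalGroupType) (N : closedNormalSubgroup G).

Definition coset_rel : rel G := fun x y => `[< cns_set N (x^-1 * y) >].

Fact coset_rel_equiv : equiv_class_of coset_rel.
Proof.
split=> [x|x y|y x z].
- by apply/asboolP; rewrite mulVg; exact: cns1.
- by apply/asboolP/asboolP => /cnsV; rewrite invgM invgK.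
- move=> /asboolP h /asboolP h'; apply/asboolP.
  by have := cnsM h h'; rewrite mulgA mulgK.
Qed.

Canonical coset_equiv := EquivRelPack coset_rel_equiv.

Definition quot : Type := quotient_topology {eq_quot coset_equiv}.

HB.instance Definition _ := Topological.copy quot
  (quotient_topology {eq_quot coset_equiv}).
HB.instance Definition _ := Quotient.copy quot
  (quotient_topology {eq_quot coset_equiv}).

Definition quot_map (x : G) : quot := \pi_quot x.

Lemma quot_mapP x y : quot_map x = quot_map y <-> cns_set N (x^-1 * y).
Proof.
split=> [/eqmodP/asboolP //|h].
by apply/eqmodP/asboolP.
Qed.

Lemma quot_map_surj q : exists x, quot_map x = q.
Proof. by exists (generic_quotient.repr q); rewrite /quot_map reprK. Qed.

Definition quot_mul (p q : quot) := quot_map (generic_quotient.repr p * generic_quotient.repr q).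
Definition quot_inv (p : quot) := quot_map (generic_quotient.repr p)^-1.

Lemma quot_repr x : cns_set N ((generic_quotient.repr (quot_map x))^-1 * x).
Proof. by apply/quot_mapP; rewrite /quot_map reprK. Qed.

Lemma quot_mulE x y : quot_mul (quot_map x) (quot_map y) = quot_map (x * y).
Proof.
apply/quot_mapP; set a := generic_quotient.repr _; set b := generic_quotient.repr _.
have -> : (a * b)^-1 * (x * y) = (a^-1 * x) ^ b * (b^-1 * y).
  by rewrite conjgE invgM !mulgA mulgK.
by apply: cnsM; [apply: cnsJ|]; exact: quot_repr.
Qed.

Lemma quot_invE x : quot_inv (quot_map x) = quot_map x^-1.
Proof.
apply/quot_mapP; set a := generic_quotient.repr _; rewrite invgK.
have -> : a * x^-1 = ((a^-1 * x)^-1) ^ a^-1.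
  by rewrite conjgE invgM !invgK !mulgA mulgK.
by apply/cnsJ/cnsV; exact: quot_repr.
Qed.

Fact quot_mulA : associative quot_mul.
Proof.
move=> p q r; have [x <-] := quot_map_surj p; have [y <-] := quot_map_surj q.
by have [z <-] := quot_map_surj r; rewrite !quot_mulE mulgA.
Qed.

Fact quot_mul1 : left_id (quot_map 1) quot_mul.
Proof. by move=> p; have [x <-] := quot_map_surj p; rewrite quot_mulE mul1g. Qed.

Fact quot_1mul : right_id (quot_map 1) quot_mul.
Proof. by move=> p; have [x <-] := quot_map_surj p; rewrite quot_mulE mulg1. Qed.

Fact quot_mulV : left_inverse (quot_map 1) quot_inv quot_mul.
Proof.
by move=> p; have [x <-] := quot_map_surj p; rewrite quot_invE quot_mulE mulVg.
Qed.

Fact quot_Vmul : right_inverse (quot_map 1) quot_inv quot_mul.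
Proof.
by move=> p; have [x <-] := quot_map_surj p; rewrite quot_invE quot_mulE mulgV.
Qed.

HB.instance Definition _ := isGroup.Build quot
  quot_mulA quot_mul1 quot_1mul quot_mulV quot_Vmul.

Lemma quot_mapM : {morph quot_map : x y / x * y}.
Proof. by move=> x y; rewrite -quot_mulE. Qed.

Lemma quot_mapV : {morph quot_map : x / x^-1}.
Proof. by move=> x; rewrite -quot_invE. Qed.

Lemma quot_map_continuous : continuous quot_map.
Proof. exact: (@pi_continuous G {eq_quot coset_equiv}). Qed.

Lemma quot_openE (A : set quot) : open A = open (quot_map @^-1` A).
Proof. by []. Qed.

Lemma quot_map_open (U : set G) : open U -> open (quot_map @` U).
Proof.
move=> oU; rewrite quot_openE.
rewrite (_ : _ @^-1` _ = \bigcup_(n in N) [set x | U (x * n)]).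
  apply: bigcup_open => n _.
  have /continuousP/(_ _ oU) // : continuous (fun x => x * n).
  by apply: continuousMg; [move=> x; exact: cvg_id | exact: continuous_cst].
apply/seteqP; split=> x /=.
- move=> [y Uy /esym/quot_mapP Nxy]; exists (x^-1 * y) => //=.
  by rewrite mulgA mulgV mul1g.
- move=> [n Nn Uxn]; exists (x * n) => //; apply/esym/quot_mapP.
  by rewrite mulgA mulVg mul1g.
Qed.

Fact quot_mulg_continuous : continuous (fun x : quot * quot => x.1 * x.2).
Proof.
move=> [p q] /=; have [x <-] := quot_map_surj p; have [y <-] := quot_map_surj q.
move=> A; rewrite /= -quot_mapM => nA.
have [[U V] /= [Ux Vy] UVA] :=
  comp_continuous (@mulg_continuous G) quot_map_continuous (x := (x, y)) nA.
exists (quot_map @` U, quot_map @` V) => /=.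
  move: Ux Vy; rewrite !(nbhsE x, nbhsE y) => -[U' [oU' U'x] UU] [V' [oV' V'y] VV].
  split.
    exists (quot_map @` U'); split; [exact: quot_map_open | by exists x |].
    by move=> _ [z /UU Uz <-]; exists z.
  exists (quot_map @` V'); split; [exact: quot_map_open | by exists y |].
  by move=> _ [z /VV Vz <-]; exists z.
move=> [_ _] /= [[a Ua <-] [b Vb <-]].
by rewrite -quot_mapM; exact: (UVA (a, b)).
Qed.

Fact quot_invg_continuous : continuous (fun x : quot => x^-1).
Proof.
apply/continuousP => A oA; rewrite quot_openE.
have /continuousP/(_ _ oA) : continuous (quot_map \o (fun x : G => x^-1)).
  exact: comp_continuous (@invg_continuous G) quot_map_continuous.
by congr open; apply/seteqP; split=> x /=; rewrite quot_mapV.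
Qed.

HB.instance Definition _ := isTopologicalGroup.Build quot
  quot_mulg_continuous quot_invg_continuous.

End Quotient.

(** * Outer automorphisms *)

Section Outer.
Variables (G : topologicalGroupType).

Definition continuous_automorphisms : set (G -> G) :=
  [set f | continuous_morphism f /\
     exists g : G -> G, [/\ cancel f g, cancel g f & continuous_morphism g]].

(** An element of [Out G] is a coset of the inner automorphisms. *)
Definition outer_class (f : G -> G) : set (G -> G) :=
  [set (fun x => f x ^ m) | m in setT].

Definition Out : set (set (G -> G)) :=
  [set outer_class f | f in continuous_automorphisms].

End Outer.

Section ConjugationAction.
Variables (G : topologicalGroupType) (N : closedNormalSubgroup G).

Definition conj_aut (g : G) (x : cns_type N) : cns_type N :=
  SigSub (mem_set (cnsJ g^-1 (set_valP x))).

Lemma conj_autE g x : cns_val (conj_aut g x) = cns_val x ^ g^-1.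
Proof. by []. Qed.

Definition image_in_Out : set (set (cns_type N -> cns_type N)) :=
  [set outer_class (conj_aut g) | g in setT].

Fact conj_aut_morphism g : continuous_morphism (conj_aut g).
Proof.
split; last by move=> x y; apply: cns_val_inj; rewrite cns_valM; exact: conjMg.
apply: cns_continuous; apply: continuousMg; first exact: continuous_cst.
apply: continuousMg; [exact: cns_val_continuous | exact: continuous_cst].
Qed.

Lemma image_in_OutS : image_in_Out `<=` @Out (cns_type N).
Proof.
move=> _ [g _ <-]; exists (conj_aut g) => //; split.
  exact: conj_aut_morphism.
exists (conj_aut g^-1); split; last exact: conj_aut_morphism.
- by move=> x; apply: cns_val_inj; rewrite !conj_autE -conjgM invgK mulVg conjg1.
- by move=> x; apply: cns_val_inj; rewrite !conj_autE -conjgM invgK mulgV conjg1.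
Qed.

End ConjugationAction.
Arguments image_in_Out {G} N.

(** * Pro-C groups *)

(** [C gT G] says that the finite group [G] belongs to the class. *)
Definition groupClass := forall gT : finGroupType, {group gT} -> Prop.

Record closed_class (C : groupClass) : Prop := ClosedClass {
  class_isog : forall (gT rT : finGroupType) (G : {group gT}) (H : {group rT}),
    G \isog H -> C gT G -> C rT H;
  class_subgroup : forall (gT : finGroupType) (G H : {group gT}),
    H \subset G -> C gT G -> C gT H;
  class_quotient : forall (gT : finGroupType) (G H : {group gT}),
    H <| G -> C gT G -> C (coset_of H) (G / H)%G;
  class_extension : forall (gT : finGroupType) (G H : {group gT}),
    H <| G -> C gT H -> C (coset_of H) (G / H)%G -> C gT G
}.

Record inverseSystem := InverseSystem {
  sys_disp : Order.disp_t;
  sys_index : porderType sys_disp;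
  sys_inhabited : inhabited sys_index;
  sys_directed : forall i j : sys_index, exists k, (i <= k)%O && (j <= k)%O;
  sys_obj : sys_index -> finGroupType;
  sys_map : forall i j : sys_index, (i <= j)%O -> sys_obj j -> sys_obj i;
  sys_mapM : forall i j (ij : (i <= j)%O), {morph sys_map ij : x y / x * y};
  sys_map_id : forall i (ii : (i <= i)%O) x, sys_map ii x = x;
  sys_map_comp : forall i j k
      (ij : (i <= j)%O) (jk : (j <= k)%O) (ik : (i <= k)%O) x,
    sys_map ij (sys_map jk x) = sys_map ik x
}.

Arguments sys_obj : clear implicits.

Definition threads (S : inverseSystem) : set (forall i, sys_obj S i) :=
  [set x | forall i j (ij : (i <= j)%O), sys_map ij (x j) = x i].
Arguments threads : clear implicits.

(** [G] is isomorphic, as a topological group, to the subgroup of threads of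
    the product of the discrete groups of [S]. *)
Definition inverse_limit (S : inverseSystem) (G : topologicalGroupType) :=
  exists p : G -> forall i, sys_obj S i,
  [/\ forall i, {morph p^~ i : x y / x * y},
      injective p,
      range p = threads S
    & forall U : set G, open U <->
        exists2 V : set (prod_topology
                      (fun i => discrete_topology (sys_obj S i))),
          open V & p @^-1` V = U].

Section ProC.
Variable C : groupClass.

Definition pro_C (G : topologicalGroupType) :=
  exists2 S : inverseSystem,
    forall i, C [set: sys_obj S i]%G & inverse_limit S G.

Definition free_pro_C (X : finType) (F : topologicalGroupType) (t : X -> F) :=
  pro_C F /\
  forall K : topologicalGroupType, pro_C K -> forall f : X -> K,
    exists! h : F -> K, continuous_morphism h /\ forall x, h (t x) = f x.

Definition free_pro_C_of_finite_rank (F : topologicalGroupType) :=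
  exists (n : nat) (t : 'I_n -> F), free_pro_C t.

Definition free_pro_C_product (I : Type) (H : I -> topologicalGroupType)
    (P : topologicalGroupType) (inj : forall i, H i -> P) :=
  [/\ pro_C P,
      forall i, continuous_morphism (inj i)
    & forall K : topologicalGroupType, pro_C K ->
      forall f : forall i, H i -> K, (forall i, continuous_morphism (f i)) ->
      exists! h : P -> K,
        continuous_morphism h /\ forall i x, h (inj i x) = f i x].

End ProC.

(** * Graphs *)

(** [endpt false] is [d_0] and [endpt true] is [d_1], restricted to edges;
    [endpt_ext] below extends them by the identity on vertices. *)
Record graph := Graph {
  vertex : finType;
  edge : finType;
  endpt : bool -> edge -> vertex
}.

Section Graph.
Variable Gamma : graph.

(** The underlying set of the graph: vertices are [inl v], edges [inr e]. *)
Definition graph_elt : finType := (vertex Gamma + edge Gamma)%type.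

Definition endpt_ext (b : bool) (m : graph_elt) : vertex Gamma :=
  match m with inl v => v | inr e => endpt b e end.

Definition subgraph (D : {set graph_elt}) :=
  forall m b, m \in D -> inl (endpt_ext b m) \in D.

Definition adjacent (D : {set graph_elt}) : rel (vertex Gamma) := fun u v =>
  [exists e, exists b,
    [&& inr e \in D, endpt b e == u & endpt (~~ b) e == v]].

Definition connected_subgraph (D : {set graph_elt}) :=
  [/\ subgraph D,
      exists v, inl v \in D
    & forall u v, inl u \in D -> inl v \in D -> connect (adjacent D) u v].

(** [(e, b)] is the edge [e] traversed from [endpt b e] to [endpt (~~ b) e]. *)
Definition circuit (s : seq (edge Gamma * bool)) :=
  [&& s != [::],
      path.cycle (fun x y => endpt (~~ x.2) x.1 == endpt y.2 y.1) s,
      uniq [seq x.1 | x <- s]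
    & uniq [seq endpt x.2 x.1 | x <- s]].

Definition tree (D : {set graph_elt}) :=
  connected_subgraph D /\
  forall s, circuit s -> ~ (forall x, x \in s -> inr x.1 \in D).

Definition maximal_subtree (D : {set graph_elt}) :=
  tree D /\ forall D' : {set graph_elt}, tree D' -> D \subset D' -> D' = D.

End Graph.

Definition connected_graph (Gamma : graph) :=
  connected_subgraph (finset.setT : {set graph_elt Gamma}).

(** * Graphs of pro-C groups *)

Record graphOfGroups (C : groupClass) (Gamma : graph) := GraphOfGroups {
  vgroup : vertex Gamma -> topologicalGroupType;
  egroup : edge Gamma -> topologicalGroupType;
  vgroup_pro_C : forall v, pro_C C (vgroup v);
  egroup_pro_C : forall e, pro_C C (egroup e);
  boundary : forall (b : bool) (e : edge Gamma), egroup e -> vgroup (endpt b e);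
  boundary_morphism : forall b e, continuous_morphism (boundary b (e := e));
  boundary_inj : forall b e, injective (boundary b (e := e))
}.

Arguments boundary {C Gamma} g b {e}.

Section FundamentalGroup.
Variables (C : groupClass) (Gamma : graph) (GG : graphOfGroups C Gamma).

Definition commensurating :=
  connected_graph Gamma /\ forall b e, open (range (boundary GG b (e := e))).

Definition factors (F : topologicalGroupType) (o : option (vertex Gamma)) :
    topologicalGroupType :=
  match o with None => F | Some v => vgroup GG v end.

(** A realisation of the free pro-C group on the edges and of its free pro-C
    product with the vertex groups; both are unique up to isomorphism. *)
Record freeData := FreeData {
  fgroup : topologicalGroupType;
  fgen : edge Gamma -> fgroup;
  fgroup_free : free_pro_C C fgen;
  coprod : topologicalGroupType;
  coprod_in : forall o, factors fgroup o -> coprod;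
  coprod_free : free_pro_C_product C coprod_in
}.

Variables (D : freeData) (T : {set graph_elt Gamma}).

Definition stable (e : edge Gamma) : coprod D :=
  coprod_in (o := None) (fgen D e).

Definition coprod_vertex (v : vertex Gamma) : vgroup GG v -> coprod D :=
  coprod_in (o := Some v).

Definition relators : set (coprod D) :=
  [set stable e | e in [set e | inr e \in T]] `|`
  [set r | exists (e : edge Gamma) (g : egroup GG e),
     r = (coprod_vertex (boundary GG false g))^-1 * stable e *
         coprod_vertex (boundary GG true g) * (stable e)^-1].

Definition Pi1 : topologicalGroupType := quot (closed_normal_closure relators).

Definition vertex_map (v : vertex Gamma) : vgroup GG v -> Pi1 :=
  fun g => quot_map (closed_normal_closure relators) (coprod_vertex g).

(** The edge groups are viewed in the fundamental group through [d_0]. *)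
Definition edge_map (e : edge Gamma) : egroup GG e -> Pi1 :=
  fun g => vertex_map (boundary GG false g).

Definition injective_graph := forall v, injective (@vertex_map v).

Definition open_subgroup_via (H : topologicalGroupType) (i : H -> Pi1)
    (N : set Pi1) :=
  N `<=` range i /\ open (i @^-1` N).

Definition tame (N : closedNormalSubgroup Pi1) :=
  [/\ forall v, open_subgroup_via (@vertex_map v) N,
      forall e, open_subgroup_via (@edge_map e) N
    & finite_set (image_in_Out N)].

Definition free_complement (M : closedNormalSubgroup Pi1) :=
  free_pro_C_of_finite_rank C (cns_type M) /\
  forall v, range (@vertex_map v) `&` M = [set 1] /\
    open [set x * y | x in range (@vertex_map v) & y in cns_set M].

End FundamentalGroup.

(* Main.v *)
Require Import Defs.
From HB Require Import structures.
From mathcomp Require Import all_boot all_order all_algebra all_fingroup.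
From mathcomp Require Import all_classical topology function_spaces.
From mathcomp Require Import cyclic pgroup.

(** Since the image of [Pi] in [Out N] is finite, some open normal subgroup [U]
    acts on [N] by inner automorphisms and meets every vertex group exactly in
    [N].  The group [U/N] is free pro-C of finite rank: homomorphisms from [U/N]
    to [L] are obtained from homomorphisms of [Pi] to the wreath product of [L]
    by [Q = Pi/U], that is, from labellings in [L] of the edges of the finite
    graph covering [Gamma] with group [Q], and the edges outside a spanning tree
    of this covering graph yield a basis.

    Let [K] be the centralizer of [N] in [U] and [Z] the centre of [N].  As
    [U/N] is free, [K] retracts onto [Z].  The product of the [n = #|Q|]
    conjugates of the retraction is a [Pi]-equivariant homomorphism [K -> Z]
    which is [z ^+ n] on [Z]; it must be divided by [n].  This is done in the
    wreath product of [Z] by [(Z/n)^X], with [X] a basis of [U/N], where the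
    values of this homomorphism on [X] have commuting [n]-th roots.  The core of
    the kernel of the resulting map on [K] is the required [M].  It is
    isomorphic to [MN/N], hence free by the first step applied to [MN]. *)

Set Implicit Arguments.
Unset Strict Implicit.
Unset Printing Implicit Defensive.
Local Open Scope group_scope.
Local Open Scope classical_set_scope.

(** * Compactness and continuity *)

(** The kernel of the equivariant homomorphism itself will not do: on [Z] this map is [z ^+ n], so
    its kernel meets [N] in the [n]-torsion of [Z]. Division by [n] gives
    [k |-> diag (retr k) * tau k], which is [diag] on [Z] and whose [n]-th power is the diagonal of
    the norm of [k]. The quotient depends on the basis and loses equivariance, whence the core. The
    core is still large: the norm being equivariant, [y ^+ n] times the inverse of the norm of [y]
    lies in it for every [y] in [K], and so do the commutators of [K], because the values of the
    divided map commute. Hence [U/NM] is a finitely generated abelian group of exponent dividing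
    [n], and [NM] is open.

    Elements of [Z] need not have roots in [Z], and adjoining them must not leave the class. The
    choice of [n] takes care of this: [Q] belongs to [C], so [C] contains a group of order [p] for
    each prime [p] dividing [n], hence also [(Z/n)^X].

    Freeness is always expressed by existence of homomorphisms together with generation by closed
    subgroups, so that no structure theorem for subgroups of free products enters. *)

Section Topology.

Lemma continuous_id (T : topologicalType) : continuous (fun x : T => x).
Proof. by move=> x; exact: cvg_id. Qed.

Lemma continuous_prod_topology (S : topologicalType) (I : eqType)
    (T : I -> topologicalType) (f : S -> prod_topology T) :
  (forall i, continuous (fun s => f s i)) -> continuous f.
Proof.
move=> cf s; apply/cvg_sup => i A /= [B [[C oC <-] Cfs] sub].
have /continuousP/(_ _ oC) oP := cf i.
apply: filterS (open_nbhs_nbhs (conj oP Cfs)) => x Cx.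
exact: sub.
Qed.

Lemma prod_topology_proj (I : eqType) (T : I -> topologicalType) i :
  continuous (fun f : prod_topology T => f i).
Proof. exact: (@proj_continuous I T i). Qed.

(** The family generates a proper filter, and a cluster point of it lies in every closed member. *)
Lemma compact_directed (T : topologicalType) (I : Type) (D : set I)
    (F : I -> set T) :
  compact [set: T] -> (exists i, D i) ->
  (forall i j, D i -> D j -> exists2 k, D k & F k `<=` F i `&` F j) ->
  (forall i, D i -> closed (F i)) -> (forall i, D i -> F i !=set0) ->
  exists x, forall i, D i -> F i x.
Proof.
move=> cT D0 dir cF F0.
have FF := filter_from_filter D0 dir.
have PF := filter_from_proper FF F0.
have [//|x [_ clx]] := cT _ PF; first by exact: filterT.
exists x => i Di; apply: cF => // B nB.
by apply: clx => //; exists i.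
Qed.

Lemma locally_constant_clopen (T : topologicalType) (A : Type)
    (f : T -> A) :
  (forall a, open (f @^-1` [set a])) ->
  forall B, open (f @^-1` B) /\ closed (f @^-1` B).
Proof.
move=> of1 B; have oB C : open (f @^-1` C).
  rewrite (_ : f @^-1` C = \bigcup_(a in C) (f @^-1` [set a])).
    by apply: bigcup_open.
  apply/seteqP; split=> x /=; first by move=> Cf; exists (f x).
  by move=> [a Ca ->].
by split => //; rewrite -openC; exact: (oB (~` B)).
Qed.

(** A locally constant parameter can be frozen near each point. In a wreath product the coordinate
    read in the second factor is such a parameter: it depends on the discrete part of the first. *)
Lemma continuous_locally_constant (T S : topologicalType) (A : Type)
    (f : T -> A) (g : T -> A -> S) :
  (forall a, open (f @^-1` [set a])) -> (forall a, continuous (g^~ a)) ->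
  continuous (fun x => g x (f x)).
Proof.
move=> of1 cg x U nU.
have := cg (f x) x U nU => nU'.
have nA : nbhs x (f @^-1` [set f x]) by apply: open_nbhs_nbhs; split.
apply: (filterS (P := (g^~ (f x)) @^-1` U `&` f @^-1` [set f x])).
  by move=> y [/= Uy fy]; rewrite fy.
exact: filterI.
Qed.

Lemma continuous_discrete (T : topologicalType) (A : choiceType)
    (f : T -> discrete_topology A) :
  (forall a, open (f @^-1` [set a])) -> continuous f.
Proof.
move=> of1; apply/continuousP => B _.
by have [] := locally_constant_clopen of1 B.
Qed.

End Topology.

(** * Closed subsets of compact groups *)

Section Groups.

Lemma morphism1 (G H : groupType) (f : G -> H) :
  {morph f : x y / x * y} -> f 1 = 1.
Proof. by move=> fM; apply: (mulgI (f 1)); rewrite -fM !mulg1. Qed.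

Lemma morphismV (G H : groupType) (f : G -> H) :
  {morph f : x y / x * y} -> {morph f : x / x^-1}.
Proof.
move=> fM x; apply: (mulgI (f x)).
by rewrite -fM !mulgV (morphism1 fM).
Qed.

Definition subgroup_set (G : groupType) (S : set G) :=
  [/\ S 1, forall x y, S x -> S y -> S (x * y) & forall x, S x -> S x^-1].

Lemma subgroup_cns (G : topologicalGroupType) (N : closedNormalSubgroup G) :
  subgroup_set N.
Proof. by split; [exact: cns1 | exact: cnsM | exact: cnsV]. Qed.

Variable G : topologicalGroupType.

Lemma continuous_mull (a : G) : continuous (fun x : G => a * x).
Proof. apply: continuousMg; [exact: continuous_cst | exact: continuous_id]. Qed.

Lemma continuous_mulr (a : G) : continuous (fun x : G => x * a).
Proof. apply: continuousMg; [exact: continuous_id | exact: continuous_cst]. Qed.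

Lemma continuous_conj (a : G) : continuous (fun x : G => x ^ a).
Proof.
apply: (continuousMg (f := fun=> a^-1)); first exact: continuous_cst.
exact: continuous_mulr.
Qed.

Lemma open_mull (a : G) (U : set G) : open U -> open [set a * x | x in U].
Proof.
move=> oU; have /continuousP/(_ _ oU) := continuous_mull (a := a^-1).
congr open; apply/seteqP; split=> x /=.
  by move=> Ux; exists (a^-1 * x) => //; rewrite mulVKg.
by move=> [y Uy <-]; rewrite mulKg.
Qed.

Lemma closed_mulr (a : G) (F : set G) : closed F -> closed [set x * a | x in F].
Proof.
move=> cF; have := continuous_mulr (a := a^-1).
move=> /continuous_closedP/(_ _ cF); congr closed; apply/seteqP; split=> x /=.
  by move=> Ux; exists (x * a^-1) => //; rewrite mulgVK.
by move=> [y Uy <-]; rewrite mulgK.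
Qed.

Lemma open_subgroup (S : set G) (U : set G) :
  subgroup_set S -> open U -> U !=set0 -> U `<=` S -> open S.
Proof.
move=> [S1 SM SV] oU [u Uu] US.
rewrite (_ : S = \bigcup_(s in S) [set s * x | x in [set u^-1 * x | x in U]]).
  by apply: bigcup_open => s _; apply/open_mull/open_mull.
apply/seteqP; split=> x.
  by move=> Sx; exists x => //; exists 1; [exists u; rewrite ?mulVg | rewrite mulg1].
move=> [s Ss [_ [y Uy <-] <-]].
by apply/SM => //; apply: SM; [apply/SV/US | apply/US].
Qed.

Hypothesis cG : compact [set: G].
Hypothesis hG : hausdorff_space G.

Lemma closed_compact (F : set G) : closed F -> compact F.
Proof. by move=> cF; apply: subclosed_compact cF cG _. Qed.

Lemma closed_mulset (A B : set G) : closed A -> closed B ->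
  closed [set x * y | x in A & y in B].
Proof.
move=> /closed_compact cA /closed_compact cB; apply: compact_closed => //.
rewrite (_ : [set _ | _ in _ & _ in _] = (fun p : G * G => p.1 * p.2) @` (A `*` B)).
  apply: continuous_compact; last exact: compact_setX.
  by apply: continuous_subspaceT; exact: mulg_continuous.
apply/seteqP; split=> x.
  by move=> [a Aa [b Bb <-]]; exists (a, b).
by move=> [[a b] /= [Aa Bb] <-]; exists a => //; exists b.
Qed.

Lemma closed_finite_cosets (S : set G) (l : seq G) :
  closed S -> closed [set g | exists2 a, a \in l & exists2 s, S s & g = s * a].
Proof.
move=> cS; elim: l => [|a l IH].
  rewrite (_ : [set g | _] = set0); first exact: closed0.
  by apply/seteqP; split=> // x [a].
rewrite (_ : [set g | _] = [set x * a | x in S] `|`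
   [set g | exists2 a, a \in l & exists2 s, S s & g = s * a]).
  by apply: closedU => //; exact: closed_mulr.
apply/seteqP; split=> x.
  move=> [b]; rewrite inE => /predU1P[->|bl] [s Ss ->]; first by left; exists s.
  by right; exists b => //; exists s.
case=> [[s Ss <-]|[b bl [s Ss ->]]].
  by exists a; [rewrite mem_head | exists s].
by exists b; [rewrite inE bl orbT | exists s].
Qed.

(** The complement of [S] in [W] lies in finitely many closed cosets. The openness of [NM] and of
    the subgroup acting by inner automorphisms both come from here. *)
Lemma finite_index_open (S W : set G) (l : seq G) :
  closed S -> open W -> subgroup_set S -> S `<=` W ->
  (forall g, W g -> exists2 a, a \in l & exists2 s, S s & g = s * a) ->
  open S.
Proof.
move=> cS oW [S1 SM SV] SW Wl.
(* Without the representatives lying in [S], the remaining cosets are disjoint from [S]. *)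
pose l' := [seq a <- l | ~~ `[< S a >]].
have cl := closed_finite_cosets (l := l') cS.
rewrite (_ : S = W `&` ~` [set g | exists2 a, a \in l' & exists2 s, S s & g = s * a]).
  by apply: openI => //; exact: closed_openC.
apply/seteqP; split=> x.
  move=> Sx; split; first exact: SW.
  move=> [a]; rewrite mem_filter => /andP[/asboolPn nS _] [s Ss E]; apply: nS.
  by rewrite -(mulKg s a) -E; apply: SM => //; exact: SV.
move=> [/Wl[a al [s Ss ->]] nx]; apply: SM => //.
have [//|nSa] := pselect (S a); exfalso; apply: nx; exists a; last by exists s.
by rewrite mem_filter al andbT; apply/asboolPn.
Qed.

End Groups.

Lemma closed_eqfun (T S : topologicalType) (f g : T -> S) :
  hausdorff_space S -> continuous f -> continuous g ->
  closed [set x | f x = g x].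
Proof.
move=> hS cf cg x clx; apply: hS => A B nA nB.
have nfA : nbhs x (f @^-1` A) by exact: cf.
have ngB : nbhs x (g @^-1` B) by exact: cg.
have [y [/= E [fA gB]]] := clx _ (filterI nfA ngB).
by exists (f y); split => //; rewrite E.
Qed.

(** * Classes of finite groups *)

Section FiniteGroups.
Variable C : groupClass.
Hypothesis CC : closed_class C.
Hypothesis C0 : exists (gT : finGroupType) (G : {group gT}), C G.

Lemma class_one (gT : finGroupType) : C (1%G : {group gT}).
Proof.
have [rT [G CG]] := C0.
apply: (class_isog CC (G := (1%G : {group rT}))); first exact: trivial_isog.
exact: class_subgroup CC _ _ _ (sub1G G) CG.
Qed.

Lemma class_subgT (gT : finGroupType) (H : {group gT}) :
  C [set: subg_of H]%G <-> C H.
Proof.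
have iso : H \isog [set: subg_of H]%G := isog_subg H.
split; last exact: class_isog.
by apply: class_isog => //; rewrite isog_sym.
Qed.

Section Morphism.
Variables (A B : finGroupType) (f : A -> B).
Hypothesis fM : {morph f : x y / x * y}.

Definition mor : {morphism [set: A] >-> B} := Morphism (in2W fM).

Lemma class_inj : C [set: B]%G -> injective f -> C [set: A]%G.
Proof.
move=> CB fI; have iso : (mor @* [set: A])%G \isog [set: A]%G.
  rewrite isog_sym; apply: sub_isog => //.
  by apply/injmP => x y _ _; exact: fI.
by apply: class_isog iso _ => //; apply: class_subgroup CB => //; exact: finset.subsetT.
Qed.

Lemma class_kernel_ext : C [set: B]%G -> C ('ker mor)%G -> C [set: A]%G.
Proof.
move=> CB Ck; apply: (class_extension CC _ Ck).
  exact: ker_normal.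
have iso := first_isog mor.
apply: (class_isog CC (G := (mor @* [set: A])%G)); first by rewrite isog_sym.
by apply: class_subgroup CB => //; exact: finset.subsetT.
Qed.

End Morphism.

Lemma class_prod (A B : finGroupType) :
  C [set: A]%G -> C [set: B]%G -> C [set: (A * B)%type : finGroupType]%G.
Proof.
move=> CA CB.
pose prodAB : finGroupType := (A * B)%type.
have fM : {morph (@fst A B : prodAB -> A) : x y / x * y} by [].
apply: (@class_kernel_ext prodAB A (fun p => p.1) fM CA).
apply/class_subgT.
pose K : finGroupType := subg_of ('ker (mor fM)).
pose g (u : K) : B := (sgval u).2.
have gM : {morph g : x y / x * y} by [].
apply: (@class_inj K B g gM CB) => x y; rewrite /g => gxy.
apply: val_inj; have kf (u : K) : (sgval u).1 = 1 :> A.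
  by have /mker := subgP u.
by rewrite /= [sgval x]surjective_pairing gxy kf -(kf y) -surjective_pairing.
Qed.

(** Homomorphisms to groups in [C] are paired until the kernel is trivial. Each new one shrinks a
    nontrivial kernel, so [#|A|] of them are enough. *)
Lemma class_residual (A : finGroupType) :
  (forall a : A, a <> 1 -> exists (B : finGroupType) (f : A -> B),
     [/\ {morph f : x y / x * y}, C [set: B]%G & f a <> 1]) ->
  C [set: A]%G.
Proof.
move=> res.
suff [B [f [fM CB fI]]] : exists (B : finGroupType) (f : A -> B),
    [/\ {morph f : x y / x * y}, C [set: B]%G & forall a, f a = 1 -> a = 1].
  apply: (class_inj fM CB) => x y E; apply/eqP.
  rewrite -divg_eq1; apply/eqP/fI.
  by rewrite fM (morphismV fM) E mulgV.
suff : forall n, exists (B : finGroupType) (f : A -> B),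
    [/\ {morph f : x y / x * y}, C [set: B]%G &
      (#|[pred a | f a == 1%g]| <= 1)%N \/ (#|[pred a | f a == 1%g]| + n <= #|A|)%N].
  move=> /(_ #|A|)[B [f [fM CB [h|h]]]]; exists B, f; split=> // a fa.
    by apply: (card_le1_eqP h); rewrite inE ?fa ?(morphism1 fM).
  suff : (0 < #|[pred a | f a == 1%g]|)%N by move: h; case: #|_| => // k; rewrite addSn ltnNge leq_addl.
  by apply/card_gt0P; exists 1; rewrite inE (morphism1 fM).
elim=> [|n [B [f [fM CB fk]]]].
  exists (subg_of (1%G : {group A}) : finGroupType), (fun=> 1); split.
  - by move=> x y; rewrite mulg1.
  - exact/class_subgT/class_one.
  - by right; rewrite addn0; exact: max_card.
have [/card_le1_eqP k1|/card_gt1P] := leqP #|[pred a | f a == 1%g]| 1.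
  by exists B, f; split=> //; left; apply/card_le1_eqP.
move=> [a [b [ka kb nab]]]; have [c kc nc] : exists2 c, f c = 1 & c <> 1.
  move: ka kb; rewrite !inE => /eqP ka /eqP kb.
  have [a1|/eqP na] := eqVneq a 1; last by exists a.
  by exists b => // b1; rewrite a1 b1 eqxx in nab.
have [B' [f' [f'M CB' f'c]]] := res c nc.
exists ((B * B')%type : finGroupType), (fun a => (f a, f' a)).
split; [by move=> x y; rewrite fM f'M | exact: class_prod |].
have sub : (#|[pred a | (f a, f' a) == 1%g]| < #|[pred a | f a == 1%g]|)%N.
  apply: proper_card; apply/properP; split.
    by apply/fintype.subsetP => x; rewrite !inE => /eqP[-> _].
  by exists c; rewrite inE ?kc //; apply/eqP => /(congr1 snd)/f'c.
case: fk => fk; [left|right]; first by apply: leq_trans fk; exact: ltnW.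
by rewrite addnS; apply: leq_trans fk; rewrite ltn_add2r.
Qed.

(** The separating maps are multiplicative on the kernel of [f] only, which is what the coordinates
    of a wreath product satisfy. *)
Lemma class_extension_residual (A Q : finGroupType) (f : A -> Q) :
  {morph f : x y / x * y} -> C [set: Q]%G ->
  (forall a, a <> 1 -> f a = 1 -> exists (B : finGroupType) (g : A -> B),
    [/\ forall x y, f x = 1 -> f y = 1 -> g (x * y) = g x * g y,
        C [set: B]%G & g a <> 1]) ->
  C [set: A]%G.
Proof.
move=> fM CQ res; apply: (@class_kernel_ext A Q f fM CQ); apply/class_subgT.
have kf (u : subg_of ('ker (mor fM))) : f (sgval u) = 1.
  by have /mker := subgP u.
apply: class_residual => a na.
have [|B [g [gM CB ga]]] := res (sgval a) _ (kf a).
  by move=> a1; apply: na; exact: val_inj.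
by exists B, (g \o sgval); split=> // x y /=; rewrite gM.
Qed.

Lemma class_quotient_hom (A : finGroupType) (H : {group A}) :
  C [set: A]%G -> (H <| [set: A]%G)%g ->
  exists (B : finGroupType) (f : A -> B),
    [/\ {morph f : x y / x * y}, C [set: B]%G,
        forall b, exists a, f a = b & forall a, f a = 1 <-> a \in H].
Proof.
move=> CA nH.
exists (coset_of H : finGroupType), (coset H).
have nT (a : A) : a \in 'N(H)%g by have /andP[_ /fintype.subsetP] := nH; apply.
split.
- by move=> x y; rewrite morphM.
- have -> : [set: coset_of H]%G = ([set: A] / H)%G; last exact: class_quotient.
  apply/val_inj/setP => b; rewrite inE; apply/esym.
  by case: (cosetP b) => a na ->; exact: mem_quotient.
- by move=> b; case: (cosetP b) => a na ->; exists a.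
- move=> a; split=> [/coset_idr|]; first exact.
  exact: coset_id.
Qed.

End FiniteGroups.

(** * Pro-C groups *)

Definition fin_hom (G : topologicalGroupType) (A : finGroupType) (f : G -> A) :=
  {morph f : x y / x * y} /\ forall a, open (f @^-1` [set a]).

Section ProC.
Variable C : groupClass.
Hypothesis CC : closed_class C.
Hypothesis C0 : exists (gT : finGroupType) (G : {group gT}), C G.

(** Together with compactness this characterises pro-C groups ([pro_C_intro]), so that no inverse
    system has to be built by hand afterwards. *)
Definition residually_C (G : topologicalGroupType) := forall x : G, x <> 1 ->
  exists (A : finGroupType) (f : G -> A), [/\ C [set: A]%G, fin_hom f & f x <> 1].

(** The threads are closed in a product of finite discrete spaces. A filter on [G] is pushed to that
    product; its cluster point is a thread, and comes back to [G] because the topology of [G] is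
    induced. *)
Lemma pro_C_compact (G : topologicalGroupType) : pro_C C G -> compact [set: G].
Proof.
move=> [S CS [p [pM pI pT pO]]].
pose P := prod_topology (fun i => discrete_topology (sys_obj S i)).
have cP : compact [set: P].
  have := @tychonoff (sys_index S) (fun i => discrete_topology (sys_obj S i)) (fun=> setT).
  rewrite (_ : [set f | _] = setT); last by apply/seteqP; split.
  by apply=> i; apply/finite_compact/finite_finset.
have clT : closed (threads S : set P).
  rewrite (_ : threads S = \bigcap_(x in [set x : sys_index S * sys_index S | (x.1 <= x.2)%O])
      [set y : P | forall h : (x.1 <= x.2)%O, sys_map h (y x.2) = y x.1]).
    apply: closed_bigI => -[i j] /= ij.
    rewrite (_ : [set y : P | _] = [set y : P | sys_map ij (y j) = y i]); last first.
      apply/seteqP; split=> y /= ; first exact.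
      by move=> E h; rewrite (bool_irrelevance h ij).
    apply: (@closed_eqfun P (discrete_topology (sys_obj S i))
      (fun y => sys_map ij (y j)) (fun y => y i)).
    - exact: discrete_hausdorff.
    - apply/continuousP => B _.
      have /continuousP/(_ (sys_map ij @^-1` B)) := @prod_topology_proj (sys_index S) (fun i => discrete_topology (sys_obj S i)) j.
      by apply; exact: discrete_open.
    - exact: (@prod_topology_proj (sys_index S) (fun i => discrete_topology (sys_obj S i)) i).
  apply/seteqP; split=> y /=; first by move=> h [i j] _ /= ij; exact: h.
  by move=> h i j ij; exact: (h (i, j) ij).
move=> F PF _.
pose F' := (p : G -> P) @ F.
have PF' : ProperFilter F' by exact: fmap_proper_filter.
have [//|y [_ cly]] := cP F' PF'; first exact: filterT.
have : threads S y.
  apply: clT => B nB; rewrite setIC.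
  have /(_ (threads S) B) := cly; rewrite setIC; apply=> //.
  rewrite /F' /= -pT; apply: filterS (filterT : F setT) => x _.
  by exists x.
rewrite -pT => -[x _ E]; exists x; split=> // A B FA nB.
move: nB; rewrite nbhsE => -[U [/pO[V oV VU] Ux] UB].
have F'A : F' (p @` A).
  by change (F (p @^-1` (p @` A))); apply: filterS FA => z Az; exists z.
have nV : nbhs y V.
  by apply: open_nbhs_nbhs; split => //; rewrite -E; move: Ux; rewrite -VU.
have [_ [[z Az <-] Vz]] := cly _ _ F'A nV.
by exists z; split=> //; apply: UB; rewrite -VU.
Qed.

Lemma pro_C_residual (G : topologicalGroupType) : pro_C C G -> residually_C G.
Proof.
move=> [S CS [p [pM pI pT pO]]] x nx.
have p1 i : p 1 i = 1 by exact: morphism1 (pM i).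
have [i ni] : exists i, p x i <> 1.
  apply: contrapT => /forallNP h; apply/nx/pI/functional_extensionality_dep => i.
  by rewrite p1; have /contrapT := h i.
exists (sys_obj S i), (p^~ i); split=> //; split; first exact: pM.
move=> a; apply/pO.
pose T i := discrete_topology (sys_obj S i).
exists ((fun f : prod_topology T => f i) @^-1` [set a]) => //.
have /continuousP := @prod_topology_proj (sys_index S) T i.
by apply; exact: discrete_open.
Qed.

Lemma residually_C_hausdorff (G : topologicalGroupType) :
  residually_C G -> hausdorff_space G.
Proof.
move=> res; rewrite open_hausdorff => x y nxy.
have [|A [f [_ [fM fO] nf]]] := res (x^-1 * y).
  by move=> E; move/eqP: nxy; apply; rewrite -[y](mulVKg x) E mulg1.
have nfxy : f x <> f y.
  by move=> E; apply: nf; rewrite fM (morphismV fM) E mulVg.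
exists (f @^-1` [set f x], f @^-1` [set f y]); first by rewrite !inE.
split=> //=; apply/eqP/seteqP; split=> // z [/= E1 E2].
by apply: nfxy; rewrite -E1 -E2.
Qed.

Definition fin_quotient (G : topologicalGroupType) (V : set G)
    (A : finGroupType) (f : G -> A) :=
  [/\ C [set: A]%G, fin_hom f, forall a, exists x, f x = a &
      forall x, f x = 1 <-> V x].

Lemma fin_hom_quotient (G : topologicalGroupType) (A : finGroupType) (f : G -> A) :
  C [set: A]%G -> fin_hom f ->
  exists (B : finGroupType) (g : G -> B), fin_quotient [set x | f x = 1] g.
Proof.
move=> CA [fM fO].
pose H : {set A} := [set a | `[< exists x, f x = a >]]%SET.
have HP a : a \in H <-> exists x, f x = a by rewrite inE; split=> /asboolP.
have gH : group_set H.
  apply/group_setP; split; first by apply/HP; exists 1; exact: morphism1.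
  by move=> a b /HP[x <-] /HP[y <-]; apply/HP; exists (x * y).
have fH x : f x \in Group gH by apply/HP; exists x.
exists (subg_of (Group gH) : finGroupType), (fun x => subg (Group gH) (f x)).
have gM : {morph (fun x => subg (Group gH) (f x)) : x y / x * y}.
  by move=> x y; rewrite fM subgM.
split.
- by apply/class_subgT => //; apply: class_subgroup CA => //; exact: finset.subsetT.
- split=> // a.
  rewrite (_ : _ @^-1` _ = f @^-1` [set sgval a]) //.
  apply/seteqP; split=> x /=; first by move=> <-; rewrite subgK.
  by move=> ->; rewrite sgvalK.
- move=> a; have /HP[x fx] := subgP a.
  by exists x; rewrite fx sgvalK.
- move=> x /=; split; last by move=> ->; rewrite -[RHS](sgvalK (G := Group gH)).
  by move=> /(congr1 sgval); rewrite subgK.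
Qed.

Lemma fin_quotient_meet (G : topologicalGroupType) (V W : set G)
    (A B : finGroupType) (f : G -> A) (g : G -> B) :
  fin_quotient V f -> fin_quotient W g ->
  exists (D : finGroupType) (h : G -> D), fin_quotient (V `&` W) h.
Proof.
move=> [CA [fM fO] _ fV] [CB [gM gO] _ gW].
pose AB : finGroupType := (A * B)%type.
have [|/=|D [h [CD hf hs hk]]] := @fin_hom_quotient G AB (fun x => (f x, g x)).
- exact: class_prod.
- split; first by move=> x y; rewrite fM gM.
  move=> [a b]; rewrite (_ : _ @^-1` _ = f @^-1` [set a] `&` g @^-1` [set b]).
    exact: openI.
  by apply/seteqP; split=> x /= [-> ->].
exists D, h; split=> // x; rewrite hk /= -fV -gW; split=> [[-> ->] //|[-> ->] //].
Qed.

Lemma fin_quotient_trivial (G : topologicalGroupType) :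
  exists (A : finGroupType) (f : G -> A), fin_quotient setT f.
Proof.
have [gT _] := C0.
pose A : finGroupType := subg_of (1%G : {group gT}).
have [||D [h [CD hf hs hk]]] := @fin_hom_quotient G A (fun=> 1).
- by apply/class_subgT => //; exact: class_one.
- split; first by move=> x y; rewrite mulg1.
  move=> a; have [->|na] := eqVneq a 1.
    by rewrite (_ : _ @^-1` _ = setT); [exact: openT | apply/seteqP; split].
  rewrite (_ : _ @^-1` _ = set0); first exact: open0.
  by apply/seteqP; split=> // x /= E; rewrite -E eqxx in na.
by exists D, h; split=> // x; rewrite hk.
Qed.

Section Residual.
Variable G : topologicalGroupType.
Hypothesis cG : compact [set: G].
Hypothesis rG : residually_C G.

Definition fin_kernel (V : set G) :=
  exists (A : finGroupType) (f : G -> A), fin_quotient V f.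

Lemma fin_kernelT : exists V, fin_kernel V.
Proof. by exists setT; exact: fin_quotient_trivial. Qed.

Lemma fin_kernelI V W : fin_kernel V -> fin_kernel W -> fin_kernel (V `&` W).
Proof. by move=> [A [f fV]] [B [g gW]]; exact: fin_quotient_meet fV gW. Qed.

Lemma fin_kernel_clopen V : fin_kernel V -> open V /\ closed V.
Proof.
move=> [A [f [_ [_ fO] _ fV]]].
rewrite (_ : V = f @^-1` [set 1]); first exact: locally_constant_clopen.
by apply/seteqP; split=> x /= /fV.
Qed.

(** Otherwise the sets [V] minus [U] form a directed family of nonempty closed sets, and a common
    point would be different from 1 and yet killed by every finite quotient in [C]. *)
Lemma fin_kernel_basis (U : set G) : open U -> U 1 ->
  exists2 V, fin_kernel V & V `<=` U.
Proof.
move=> oU U1; apply: contrapT => nex.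
have [||||x xV] := compact_directed (D := fin_kernel) (F := fun V => V `&` ~` U) cG.
- exact: fin_kernelT.
- move=> V W kV kW; exists (V `&` W); first exact: fin_kernelI.
  by move=> x [[Vx Wx] nUx].
- by move=> V /fin_kernel_clopen[_ cV]; apply: closedI => //; exact: open_closedC.
- move=> V kV; apply/set0P/eqP => V0; apply: nex; exists V => // x Vx.
  by apply: contrapT => nUx; have : (V `&` ~` U) x by []; rewrite V0.
have [V0 kV0] := fin_kernelT; have [_ nUx] := xV _ kV0.
have [|A [f [CA hf nfx]]] := rG (x := x); first by move=> x1; apply: nUx; rewrite x1.
by have [/nfx] := xV _ (fin_hom_quotient CA hf).
Qed.

(** [V] is [N] times a kernel contained in [U]: as [f] is onto, the image of [N] is normal in the
    finite quotient and can be divided out. *)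
Lemma fin_kernel_above (N : closedNormalSubgroup G) (U : set G) : open U -> U 1 ->
  exists V, [/\ fin_kernel V, N `<=` V &
    forall x, V x -> exists n u, [/\ cns_set N n, U u & x = n * u]].
Proof.
move=> oU U1; have [V [A [f [CA [fM fO] fs fV]]] VU] := fin_kernel_basis oU U1.
pose H : {set A} := [set a | `[< exists2 x, cns_set N x & f x = a >]]%SET.
have HP a : a \in H <-> exists2 x, cns_set N x & f x = a by rewrite inE; split=> /asboolP.
have gH : group_set H.
  apply/group_setP; split.
    by apply/HP; exists 1; [exact: cns1 | exact: morphism1].
  move=> a b /HP[x Nx <-] /HP[y Ny <-]; apply/HP.
  by exists (x * y); [exact: cnsM|].
have nH : (Group gH <| [set: A]%G)%g.
  rewrite /normal finset.subsetT; apply/fintype.subsetP => a _.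
  have [g <-] := fs a; rewrite inE; apply/fintype.subsetP => b /imsetP[c].
  move=> /HP[x Nx <-] ->; apply/HP; exists (x ^ g).
    exact: cnsJ.
  by rewrite !fM (morphismV fM).
have [B [h [hM CB hs hk]]] := class_quotient_hom CC CA nH.
exists [set x | h (f x) = 1]; split.
- exists B, (h \o f); split=> //.
  + split; first by move=> x y /=; rewrite fM hM.
    by move=> b; have [] := locally_constant_clopen fO (h @^-1` [set b]).
  + by move=> b; have [a <-] := hs b; have [x <-] := fs a; exists x.
- by move=> x Nx; apply/hk/HP; exists x.
move=> x /= /hk/HP[n Nn E].
exists n, (n^-1 * x); split=> //; last by rewrite mulVKg.
by apply/VU/fV; rewrite fM (morphismV fM) E mulVg.
Qed.

End Residual.
End ProC.

(** * Compact residually C groups are inverse limits *)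

Section InverseSystem.
Variable C : groupClass.
Hypothesis CC : closed_class C.
Hypothesis C0 : exists (gT : finGroupType) (G : {group gT}), C G.
Variable G : topologicalGroupType.
Hypothesis cG : compact [set: G].
Hypothesis rG : residually_C C G.

(** Indexing by kernels, and not by homomorphisms, makes reverse inclusion antisymmetric; a quotient
    map with the given kernel is then chosen by [cid]. *)
Definition kernels : Type := set_type [set V : set G | fin_kernel C V].

HB.instance Definition _ := Choice.copy kernels (set_type [set V : set G | fin_kernel C V]).

Definition ker_set (i : kernels) : set G := set_val i.

Lemma ker_setP (i : kernels) : fin_kernel C (ker_set i).
Proof. exact: set_valP. Qed.

Lemma ker_set_inj : injective ker_set.
Proof. exact: val_inj. Qed.

Definition kernel_le (i j : kernels) : bool := `[< ker_set j `<=` ker_set i >].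

Lemma kernel_le_refl : reflexive kernel_le.
Proof. by move=> i; apply/asboolP. Qed.

Lemma kernel_le_anti : antisymmetric kernel_le.
Proof.
move=> i j /andP[/asboolP ij /asboolP ji]; apply: ker_set_inj.
by apply/seteqP; split.
Qed.

Lemma kernel_le_trans : transitive kernel_le.
Proof.
move=> j i k /asboolP ij /asboolP jk; apply/asboolP.
exact: subset_trans jk ij.
Qed.

Fact kernel_display : Order.disp_t.
Proof. exact: Order.Disp tt tt. Qed.

HB.instance Definition _ := Order.Le_isPOrder.Build kernel_display kernels
  kernel_le_refl kernel_le_anti kernel_le_trans.

Lemma kernel_leP (i j : kernels) : (i <= j)%O -> ker_set j `<=` ker_set i.
Proof. by move=> /asboolP. Qed.

Definition ker_obj (i : kernels) : finGroupType := projT1 (cid (ker_setP i)).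

Definition ker_map (i : kernels) : G -> ker_obj i :=
  projT1 (cid (projT2 (cid (ker_setP i)))).

Lemma ker_mapP (i : kernels) : fin_quotient C (ker_set i) (@ker_map i).
Proof. exact: projT2 (cid (projT2 (cid (ker_setP i)))). Qed.

Lemma ker_mapM i : {morph @ker_map i : x y / x * y}.
Proof. by have [_ []] := ker_mapP i. Qed.

Lemma ker_map_eq i x y : ker_map i x = ker_map i y <-> ker_set i (x^-1 * y).
Proof.
have [_ [fM _] _ fV] := ker_mapP i; rewrite -fV fM (morphismV fM).
split=> [->|E]; first by rewrite mulVg.
by rewrite -[RHS](mulVKg (ker_map i x)) E mulg1.
Qed.

Definition ker_lift i (a : ker_obj i) : G :=
  projT1 (cid (let: And4 _ _ h _ := ker_mapP i in h a)).

Lemma ker_liftK i (a : ker_obj i) : ker_map i (ker_lift a) = a.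
Proof. exact: projT2 (cid (let: And4 _ _ h _ := ker_mapP i in h a)). Qed.

Definition ker_trans (i j : kernels) (ij : (i <= j)%O) (a : ker_obj j) :
  ker_obj i := ker_map i (ker_lift a).

Lemma ker_transE i j (ij : (i <= j)%O) x :
  ker_trans ij (ker_map j x) = ker_map i x.
Proof.
by apply/ker_map_eq/(kernel_leP ij)/ker_map_eq; rewrite ker_liftK.
Qed.

Lemma ker_transM i j (ij : (i <= j)%O) : {morph ker_trans ij : x y / x * y}.
Proof.
move=> a b; rewrite -(ker_liftK a) -(ker_liftK b) -ker_mapM !ker_transE.
exact: ker_mapM.
Qed.

Lemma ker_trans_id i (ii : (i <= i)%O) a : ker_trans ii a = a.
Proof. by rewrite -(ker_liftK a) ker_transE. Qed.

Lemma ker_trans_comp i j k (ij : (i <= j)%O) (jk : (j <= k)%O) (ik : (i <= k)%O) a :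
  ker_trans ij (ker_trans jk a) = ker_trans ik a.
Proof. by rewrite -(ker_liftK a) !ker_transE. Qed.

Lemma kernels_inhabited : inhabited kernels.
Proof.
have [V kV] := fin_kernelT CC C0 G.
by constructor; exact: SigSub (mem_set kV).
Qed.

Lemma kernels_directed (i j : kernels) : exists k : kernels, (i <= k)%O && (j <= k)%O.
Proof.
exists (SigSub (mem_set (fin_kernelI CC (ker_setP i) (ker_setP j)))).
by apply/andP; split; apply/asboolP => x [].
Qed.

Definition kernel_system : inverseSystem :=
  @InverseSystem kernel_display kernels kernels_inhabited kernels_directed ker_obj
    ker_trans ker_transM ker_trans_id ker_trans_comp.

Lemma pro_C_intro : pro_C C G.
Proof.
exists kernel_system; first by move=> i; have [] := ker_mapP i.
exists (fun x i => ker_map i x); split.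
- exact: ker_mapM.
- move=> x y E; apply/eqP; apply: contraT => /eqP nxy.
  have [|A [f [CA hf nf]]] := rG (x := x^-1 * y).
    by move=> h; apply: nxy; rewrite -[y](mulVKg x) h mulg1.
  pose i : kernels := SigSub (mem_set (fin_hom_quotient CC CA hf)).
  have /ker_map_eq := congr1 (fun h => h i) E.
  by move=> /nf.
- apply/seteqP; split=> [_ [x _ <-] i j ij|a aT]; first exact: ker_transE.
  have fib (i : kernels) x : ker_map i x = a i <-> (ker_map i @^-1` [set a i]) x by [].
  (* A preimage of a thread is a common point of the fibres over its coordinates. *)
  have [||||x xF] := compact_directed (D := [set: kernels])
    (F := fun i => ker_map i @^-1` [set a i]) cG.
  + by have [i] := kernels_inhabited; exists i.
  + move=> i j _ _; have [k /andP[ik jk]] := kernels_directed i j.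
    exists k => // x /= xk; have ai := aT _ _ ik; have aj := aT _ _ jk.
    by rewrite -ai -aj -xk /= !ker_transE.
  + move=> i _; have [_ [_ fO] _ _] := ker_mapP i.
    by have [] := locally_constant_clopen fO [set a i].
  + by move=> i _; exists (ker_lift (a i)); exact: ker_liftK.
  + by exists x => //; apply: functional_extensionality_dep => i; exact: xF.
move=> U; pose T i := discrete_topology (sys_obj kernel_system i).
split=> [oU|[V oV <-]]; last first.
  have cp : continuous (fun x => (fun i => ker_map i x) : prod_topology T).
    apply: continuous_prod_topology => i.
    by apply: continuous_discrete; have [_ []] := ker_mapP i.
  by move/continuousP: cp; apply.
(* Each coset of a kernel contained in [U] is the preimage of a cylinder; these cosets cover [U]. *)
exists (\bigcup_(x in [set xi : G * kernels |
    (fun y => xi.1 * y) @` ker_set xi.2 `<=` U])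
  [set y : prod_topology T | y x.2 = ker_map x.2 x.1]).
  apply: bigcup_open => -[x i] _ /=.
  have /continuousP := @prod_topology_proj kernels T i.
  move=> /(_ [set ker_map i x]); apply; exact: discrete_open.
apply/seteqP; split=> x /=.
  move=> [[y i] /= sub /esym/ker_map_eq E]; apply: sub.
  by exists (y^-1 * x) => //; rewrite mulVKg.
move=> Ux; have [||V kV VU] := fin_kernel_basis CC C0 cG rG
    (U := (fun y => x * y) @^-1` U).
- by move/continuousP: (continuous_mull (a := x)); exact.
- by rewrite /= mulg1.
exists (x, SigSub (mem_set kV)) => //= _ [y Vy <-].
exact: VU.
Qed.

End InverseSystem.

(** * Closed subgroups and quotients *)

Section Permanence.
Variable C : groupClass.
Hypothesis CC : closed_class C.
Hypothesis C0 : exists (gT : finGroupType) (G : {group gT}), C G.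

Lemma pro_C_hausdorff (G : topologicalGroupType) : pro_C C G -> hausdorff_space G.
Proof. by move=> /pro_C_residual/residually_C_hausdorff. Qed.

Lemma pro_C_embedded (G H : topologicalGroupType) (f : H -> G) :
  pro_C C G -> compact [set: H] -> continuous_morphism f -> injective f ->
  pro_C C H.
Proof.
move=> /pro_C_residual rG cH [fc fM] fI; apply: pro_C_intro => // x nx.
have [|A [g [CA [gM gO] ng]]] := rG (f x).
  by rewrite -(morphism1 fM) => /fI.
exists A, (g \o f); split=> //; split; first by move=> y z /=; rewrite fM gM.
by move=> a; rewrite comp_preimage; move/continuousP: fc; exact.
Qed.

Lemma compact_embedded (G : topologicalType) (T : topologicalType) (f : T -> G) :
  compact [set: G] -> closed (range f) ->
  (forall U, open U -> exists2 V, open V & f @^-1` V = U) -> compact [set: T].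
Proof.
move=> cG cl ini F PF _.
have PF' : ProperFilter (f @ F) by exact: fmap_proper_filter.
have [//|y [_ cly]] := cG _ PF'; first exact: filterT.
have [x _ E] : range f y.
  apply: cl => B nB; rewrite setIC.
  have /(_ (range f) B) := cly; rewrite setIC; apply=> //.
  change (F (f @^-1` range f)).
  by apply: (filterS (P := setT)); [move=> x _; exists x | exact: filterT].
exists x; split=> // A B FA; rewrite nbhsE => -[U [/ini[V oV VU] Ux] UB].
have nV : nbhs y V.
  by apply: open_nbhs_nbhs; split => //; rewrite -E; move: Ux; rewrite -VU.
have FA' : (f @ F) (f @` A).
  by change (F (f @^-1` (f @` A))); apply: filterS FA => z Az; exists z.
have [_ [[z Az <-] Vz]] := cly _ _ FA' nV.
by exists z; split=> //; apply: UB; rewrite -VU.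
Qed.

Lemma cns_val_range (G : topologicalGroupType) (N : closedNormalSubgroup G) :
  range (@cns_val G N) = N.
Proof.
apply/seteqP; split=> x; first by move=> [y _ <-]; exact: set_valP.
by move=> Nx; exists (SigSub (mem_set Nx)).
Qed.

Lemma cns_valP (G : topologicalGroupType) (N : closedNormalSubgroup G) (x : cns_type N) :
  cns_set N (cns_val x).
Proof. exact: set_valP. Qed.

Lemma cns_type_compact (G : topologicalGroupType) (N : closedNormalSubgroup G) :
  compact [set: G] -> compact [set: cns_type N].
Proof.
move=> cG; apply: (compact_embedded (f := @cns_val G N)) => //.
by rewrite cns_val_range; exact: cns_closed.
Qed.

Lemma cns_type_pro_C (G : topologicalGroupType) (N : closedNormalSubgroup G) :
  pro_C C G -> pro_C C (cns_type N).
Proof.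
move=> pG; apply: (pro_C_embedded (f := @cns_val G N) pG).
- exact/cns_type_compact/(pro_C_compact pG).
- split; [exact: cns_val_continuous | exact: cns_valM].
- exact: cns_val_inj.
Qed.

Lemma quot_compact (G : topologicalGroupType) (N : closedNormalSubgroup G) :
  compact [set: G] -> compact [set: quot N].
Proof.
move=> cG; rewrite (_ : setT = quot_map N @` setT).
  apply: continuous_compact => //.
  exact/continuous_subspaceT/quot_map_continuous.
by apply/seteqP; split=> // q _; have [x <-] := quot_map_surj q; exists x.
Qed.

Lemma quot_map1 (G : topologicalGroupType) (N : closedNormalSubgroup G) x :
  quot_map N x = 1 <-> cns_set N x.
Proof.
rewrite -(morphism1 (@quot_mapM G N)); split=> [/esym/quot_mapP|Nx].
  by rewrite invg1 mul1g.
by apply/esym/quot_mapP; rewrite invg1 mul1g.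
Qed.

(** Preimages are given as images under the open map [quot_map], from which continuity of [g] and
    openness of its fibres follow. *)
Lemma quot_factor (G : topologicalGroupType) (N : closedNormalSubgroup G)
    (S : Type) (f : G -> S) :
  (forall x y, cns_set N (x^-1 * y) -> f x = f y) ->
  exists2 g : quot N -> S, forall x, g (quot_map N x) = f x &
    forall B, g @^-1` B = quot_map N @` (f @^-1` B).
Proof.
move=> fN; pose g (q : quot N) := f (generic_quotient.repr q).
have gE x : g (quot_map N x) = f x by apply/fN/quot_repr.
exists g => // B; apply/seteqP; split=> q /=.
  by have [x <-] := quot_map_surj q; rewrite gE => Bx; exists x.
by move=> [x Bx <-]; rewrite gE.
Qed.

Lemma quot_pro_C (G : topologicalGroupType) (N : closedNormalSubgroup G) :
  pro_C C G -> pro_C C (quot N).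
Proof.
move=> pG; have cG := pro_C_compact pG; have rG := pro_C_residual pG.
apply: pro_C_intro => //; first exact: quot_compact.
move=> q; have [x <-] := quot_map_surj q => nx.
(* If [x = n * u] with [n] in [N], then [x * u^-1] is in [N]. Hence [x] is not in [N] times this
   open set, and the finite quotient obtained from it separates [x] from [N]. *)
have oU : open [set y | ~ cns_set N (x * y^-1)].
  have : open (~` cns_set N) by exact/closed_openC/cns_closed.
  have cU : continuous (fun y : G => x * y^-1).
    by apply: continuousMg; [exact: continuous_cst | exact: invg_continuous].
  by move/continuousP: cU; apply.
have [|V [[A [f [CA [fM fO] fs fV]]] NV VU]] := fin_kernel_above CC C0 cG rG N oU.
  by rewrite /= invg1 mulg1 => /quot_map1.
have [|g gE gB] := @quot_factor G N _ f.
  move=> a b /NV/fV; rewrite fM (morphismV fM) => E.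
  by rewrite -[RHS](mulVKg (f a)) E mulg1.
exists A, g; split=> //.
- split; last by move=> a; rewrite gB; exact: quot_map_open.
  move=> p r; have [a <-] := quot_map_surj p; have [b <-] := quot_map_surj r.
  by rewrite -quot_mapM !gE.
- rewrite gE => /fV/VU[n [u [Nn Uu E]]]; apply: Uu.
  by rewrite E mulgK.
Qed.

End Permanence.

(** * Subgroups and wreath products *)

Section SubgroupType.
Variables (G : topologicalGroupType) (S : set G) (SS : subgroup_set S).

Fact sg_group_closed : group_closed (mem S).
Proof.
case: SS => S1 SM SV; split=> [|x y]; first exact/mem_set.
by move=> /set_mem Sx /set_mem Sy; apply/mem_set/SM => //; exact: SV.
Qed.

(** The [let] makes [SS] a parameter of the type, where the group structure finds it. *)
Definition sg_type : Type := let _ := SS in set_type S.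

HB.instance Definition _ := Topological.copy sg_type (set_type S).
HB.instance Definition _ := SubChoice.copy sg_type (set_type S).
HB.instance Definition _ :=
  SubChoice_isSubGroup.Build G (mem S) sg_type sg_group_closed.

Definition sg_val : sg_type -> G := set_val.

Lemma sg_val_continuous : continuous sg_val.
Proof. exact: (@initial_continuous _ _ (set_val : set_type S -> G)). Qed.

Lemma sg_continuous (T : topologicalType) (f : T -> sg_type) :
  continuous (sg_val \o f) -> continuous f.
Proof.
move=> /continuousP cf; apply/continuousP => _ [B oB <-].
by have := cf _ oB; rewrite comp_preimage.
Qed.

Fact sg_mulg_continuous : continuous (fun x : sg_type * sg_type => x.1 * x.2).
Proof.
apply: sg_continuous.
rewrite (_ : _ \o _ = (fun x : sg_type * sg_type => sg_val x.1 * sg_val x.2)) //.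
by apply: continuousMg; apply: comp_continuous;
  do ?[exact: fst_continuous | exact: snd_continuous | exact: sg_val_continuous].
Qed.

Fact sg_invg_continuous : continuous (fun x : sg_type => x^-1).
Proof.
apply: sg_continuous.
rewrite (_ : _ \o _ = (fun x : sg_type => (sg_val x)^-1)) //.
by apply: continuousVg; exact: sg_val_continuous.
Qed.

HB.instance Definition _ := isTopologicalGroup.Build sg_type
  sg_mulg_continuous sg_invg_continuous.

Lemma sg_pro_C (C : groupClass) : closed_class C ->
  (exists (gT : finGroupType) (H : {group gT}), C gT H) ->
  pro_C C G -> closed S -> pro_C C sg_type.
Proof.
move=> CC C0 pG cS; apply: (pro_C_embedded CC C0 (f := sg_val) pG).
- apply: (compact_embedded (f := sg_val)) => //; first exact: pro_C_compact pG.
  rewrite (_ : range _ = S) //; apply/seteqP; split=> x.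
    by move=> [y _ <-]; exact: set_valP.
  by move=> Sx; exists (SigSub (mem_set Sx)).
- by split; [exact: sg_val_continuous|].
- exact: val_inj.
Qed.

End SubgroupType.

Section FiniteWreath.
Variables (A Q : finGroupType).

Definition fin_wreath : Type := ({ffun Q -> A} * Q)%type.
HB.instance Definition _ := Finite.on fin_wreath.

Definition fin_wreath_mul (x y : fin_wreath) : fin_wreath :=
  ([ffun a => x.1 a * y.1 (a * x.2)], x.2 * y.2).
Definition fin_wreath_inv (x : fin_wreath) : fin_wreath :=
  ([ffun a => (x.1 (a * x.2^-1))^-1], x.2^-1).

Fact fin_wreath_mulA : associative fin_wreath_mul.
Proof.
move=> x y z; congr (_, _); last exact: mulgA.
by apply/ffunP => a; rewrite !ffunE /= !mulgA.
Qed.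

Fact fin_wreath_mul1 : left_id ([ffun=> 1], 1) fin_wreath_mul.
Proof.
move=> [f q]; congr (_, _); last exact: mul1g.
by apply/ffunP => a; rewrite !ffunE /= mulg1 mul1g.
Qed.

Fact fin_wreath_mulV : left_inverse ([ffun=> 1], 1) fin_wreath_inv fin_wreath_mul.
Proof.
move=> [f q]; congr (_, _); last exact: mulVg.
by apply/ffunP => a; rewrite !ffunE /= mulVg.
Qed.

HB.instance Definition _ := Finite_isGroup.Build fin_wreath
  fin_wreath_mulA fin_wreath_mul1 fin_wreath_mulV.

Lemma class_fin_wreath (C : groupClass) : closed_class C ->
  (exists (gT : finGroupType) (H : {group gT}), C gT H) ->
  C A [set: A]%G -> C Q [set: Q]%G -> C fin_wreath [set: fin_wreath]%G.
Proof.
move=> CC C0 CA CQ.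
apply: (class_extension_residual CC C0 (f := fun x : fin_wreath => x.2)) => //.
move=> [f q] n1 /= q1; have [a na] : exists a, f a <> 1.
  apply: contrapT => /forallNP h; apply: n1; congr (_, _) => //.
  by apply/ffunP => a; rewrite ffunE; have /contrapT := h a.
exists A, (fun x : fin_wreath => x.1 a); split=> //.
by move=> x y x1 _; rewrite /= ffunE x1 mulg1.
Qed.

End FiniteWreath.

Lemma open_forall (T : topologicalType) (I : finType) (P : I -> set T) :
  (forall i, open (P i)) -> open [set x | forall i, P i x].
Proof.
move=> oP; rewrite openE => x Px; apply: filter_forall => i.
by apply: open_nbhs_nbhs; split; [exact: oP | exact: Px].
Qed.

Section Wreath.
Variables (K : topologicalGroupType) (Q : finGroupType).

(** For a homomorphism [h] of [Pi] lying over [f], coordinate [a] of [h x] is the label of the path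
    [x] lifted to start at sheet [a]. The lift ends at sheet [a * f x], where the next factor is
    read. On the kernel of [f], coordinate [1] is therefore a homomorphism. *)
Definition wreath : Type :=
  (prod_topology (fun _ : Q => K) * discrete_topology Q)%type.

HB.instance Definition _ := Topological.on wreath.

Definition wfun (x : wreath) : Q -> K := x.1.
Definition wtop (x : wreath) : Q := x.2.
Definition Wreath (f : Q -> K) (q : Q) : wreath := (f, q).

Lemma wreath_eq (x y : wreath) : wfun x =1 wfun y -> wtop x = wtop y -> x = y.
Proof. by case: x y => [f q] [g r] /= /funext; rewrite /wfun /wtop /= => -> ->. Qed.

Definition wreath_mul (x y : wreath) : wreath :=
  Wreath (fun a => wfun x a * wfun y (a * wtop x)) (wtop x * wtop y).
Definition wreath_inv (x : wreath) : wreath :=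
  Wreath (fun a => (wfun x (a * (wtop x)^-1))^-1) (wtop x)^-1.

Fact wreath_mulA : associative wreath_mul.
Proof.
by move=> x y z; apply: wreath_eq => [a|]; rewrite /wfun /wtop /= !mulgA.
Qed.

Fact wreath_mul1 : left_id (Wreath (fun=> 1) 1) wreath_mul.
Proof.
by move=> x; apply: wreath_eq => [a|]; rewrite /wfun /wtop /= ?mulg1 mul1g.
Qed.

Fact wreath_1mul : right_id (Wreath (fun=> 1) 1) wreath_mul.
Proof. by move=> x; apply: wreath_eq => [a|]; rewrite /wfun /wtop /= mulg1. Qed.

Fact wreath_mulV : left_inverse (Wreath (fun=> 1) 1) wreath_inv wreath_mul.
Proof. by move=> x; apply: wreath_eq => [a|]; rewrite /wfun /wtop /= mulVg. Qed.

Fact wreath_Vmul : right_inverse (Wreath (fun=> 1) 1) wreath_inv wreath_mul.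
Proof.
by move=> x; apply: wreath_eq => [a|]; rewrite /wfun /wtop /= ?mulgK mulgV.
Qed.

HB.instance Definition _ := isGroup.Build wreath
  wreath_mulA wreath_mul1 wreath_1mul wreath_mulV wreath_Vmul.

Lemma wfunM (x y : wreath) a : wfun (x * y) a = wfun x a * wfun y (a * wtop x).
Proof. by []. Qed.

Lemma wtopM : {morph wtop : x y / x * y}.
Proof. by []. Qed.

Lemma wfun_continuous a : continuous (fun x => wfun x a).
Proof.
have c1 := @fst_continuous (prod_topology (fun _ : Q => K)) (discrete_topology Q).
exact: (comp_continuous c1 (@prod_topology_proj Q (fun=> K) a)).
Qed.

Lemma wtop_open q : open (wtop @^-1` [set q]).
Proof.
have /continuousP := @snd_continuous (prod_topology (fun _ : Q => K)) (discrete_topology Q).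
by move=> /(_ [set q]); apply; exact: discrete_open.
Qed.

Lemma wreath_continuous (S : topologicalType) (f : S -> wreath) :
  (forall a, continuous (fun s => wfun (f s) a)) ->
  (forall q, open [set s | wtop (f s) = q]) -> continuous f.
Proof.
move=> cf co; rewrite (_ : f = fun s => ((f s).1, (f s).2)); last first.
  by apply/funext => s; rewrite -surjective_pairing.
have c1 : continuous (fun s => (f s).1 : prod_topology (fun _ : Q => K)).
  exact: continuous_prod_topology.
have c2 : continuous (fun s => (f s).2 : discrete_topology Q).
  exact: continuous_discrete.
exact: (pair_continuous c1 c2).
Qed.

Fact wreath_mulg_continuous : continuous (fun x : wreath * wreath => x.1 * x.2).
Proof.
have o1 q : open [set s : wreath * wreath | wtop s.1 = q].
  by move/continuousP: (@fst_continuous wreath wreath) => /(_ _ (wtop_open (q := q))).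
have o2 q : open [set s : wreath * wreath | wtop s.2 = q].
  by move/continuousP: (@snd_continuous wreath wreath) => /(_ _ (wtop_open (q := q))).
apply: wreath_continuous => [a|q].
  apply: (continuous_locally_constant (f := fun s : wreath * wreath => wtop s.1)
    (g := fun s q => wfun s.1 a * wfun s.2 (a * q))) => // q.
  apply: continuousMg.
    exact: comp_continuous (@fst_continuous _ _) (wfun_continuous (a := a)).
  exact: comp_continuous (@snd_continuous _ _) (wfun_continuous (a := a * q)).
rewrite (_ : [set s | _] = \bigcup_(r in setT)
    ([set s : wreath * wreath | wtop s.1 = r] `&`
     [set s : wreath * wreath | wtop s.2 = r^-1 * q])).
  by apply: bigcup_open => r _; exact: openI.
apply/seteqP; split=> s.
  by move=> <-; exists (wtop s.1) => //; split=> //; exact/esym/mulKg.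
move=> [r _ [/= s1 s2]].
by rewrite -[LHS]/(wtop s.1 * wtop s.2) s1 s2 mulVKg.
Qed.

Fact wreath_invg_continuous : continuous (fun x : wreath => x^-1).
Proof.
apply: wreath_continuous => [a|q].
  apply: (continuous_locally_constant (f := wtop)
    (g := fun s q => (wfun s (a * q^-1))^-1)) => [q|q].
    exact: wtop_open.
  by apply: continuousVg; exact: wfun_continuous.
rewrite (_ : [set s | _] = wtop @^-1` [set q^-1]); first exact: wtop_open.
apply/seteqP; split=> s /=; first by move=> <-; rewrite /wtop /= invgK.
by rewrite /wtop /= => ->; rewrite invgK.
Qed.

HB.instance Definition _ := isTopologicalGroup.Build wreath
  wreath_mulg_continuous wreath_invg_continuous.

Lemma wreath_pro_C (C : groupClass) : closed_class C ->
  (exists (gT : finGroupType) (H : {group gT}), C gT H) ->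
  pro_C C K -> C Q [set: Q]%G -> pro_C C wreath.
Proof.
move=> CC C0 pK CQ; apply: pro_C_intro => //.
  rewrite (_ : setT = [set f : prod_topology (fun _ : Q => K) | forall i, setT (f i)] `*` setT).
    apply: compact_setX; last exact/finite_compact/finite_finset.
    apply: (@tychonoff Q (fun=> K) (fun=> setT)) => i.
    exact: pro_C_compact pK.
  by apply/seteqP; split.
(* An element is seen either in [Q] or in one coordinate. In the second case a finite quotient of
   [K] is applied to all coordinates at once. *)
move=> x nx; have [q1|/eqP nq] := eqVneq (wtop x) 1; last first.
  by exists Q, wtop; split=> //; split=> // q; exact: wtop_open.
have [a na] : exists a, wfun x a <> 1.
  apply: contrapT => /forallNP h; apply: nx; apply: wreath_eq => // a.
  by have /contrapT := h a.
have [A [f [CA [fM fO] nf]]] := pro_C_residual pK na.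
exists (fin_wreath A Q : finGroupType),
  (fun y => ([ffun a => f (wfun y a)], wtop y) : fin_wreath A Q).
split; first exact: class_fin_wreath.
- split.
    by move=> y z; congr (_, _); apply/ffunP => b; rewrite !ffunE /= fM.
  move=> [F q]; rewrite (_ : _ @^-1` _ = wtop @^-1` [set q] `&`
      [set y | forall b, f (wfun y b) = F b]).
    apply: openI; first exact: wtop_open.
    apply: (open_forall (P := fun b => [set y | f (wfun y b) = F b])) => b.
    by move/continuousP: (wfun_continuous (a := b)) => /(_ _ (fO (F b))).
  apply/seteqP; split=> y /=.
    by move=> [<- <-]; split=> // b; rewrite ffunE.
  by move=> [-> E]; congr (_, _); apply/ffunP => b; rewrite ffunE.
by move=> /(congr1 (fun y : fin_wreath A Q => y.1 a)); rewrite !ffunE.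
Qed.

End Wreath.

(** * The fundamental group *)

Lemma continuous_quot_lift (G : topologicalGroupType) (N : closedNormalSubgroup G)
    (H : topologicalGroupType) (k : G -> H) :
  continuous_morphism k -> (forall x, cns_set N x -> k x = 1) ->
  exists2 h : quot N -> H, continuous_morphism h & forall x, h (quot_map N x) = k x.
Proof.
move=> [kc kM] kN; have [|h hE hB] := @quot_factor G N _ k.
  move=> x y /kN; rewrite kM (morphismV kM) => E.
  by rewrite -[RHS](mulVKg (k x)) E mulg1.
exists h => //; split.
  apply/continuousP => B oB; rewrite hB; apply: quot_map_open.
  by move/continuousP: kc; exact.
move=> p q; have [x <-] := quot_map_surj p; have [y <-] := quot_map_surj q.
by rewrite -quot_mapM !hE kM.
Qed.

Section KernelSubgroup.
Variables (G H : topologicalGroupType) (k : G -> H).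
Hypothesis hH : hausdorff_space H.
Hypothesis km : continuous_morphism k.

Definition kernel_cns : closedNormalSubgroup G.
Proof.
exists [set x | k x = 1]; have [kc kM] := km.
- exact: (closed_eqfun hH kc (@continuous_cst _ _ 1)).
- exact: morphism1.
- by move=> x y /= kx ky; rewrite kM kx ky mulg1.
- by move=> x /= kx; rewrite (morphismV kM) kx invg1.
- by move=> g x /= kx; rewrite !kM (morphismV kM) kx mul1g mulVg.
Defined.

Lemma kernel_cnsE x : cns_set kernel_cns x = (k x = 1).
Proof. by []. Qed.

End KernelSubgroup.

Section FundamentalGroup.
Variables (C : groupClass) (Gamma : graph) (GG : graphOfGroups C Gamma).
Variables (T : {set graph_elt Gamma}) (D : freeData GG).
Hypothesis CC : closed_class C.
Hypothesis C0 : exists (gT : finGroupType) (G : {group gT}), C G.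

Local Notation Pi := (Pi1 D T).
Local Notation vm v := (@vertex_map C Gamma GG D T v).
Local Notation rels := (@relators C Gamma GG D T).

Definition stable_letter (e : edge Gamma) : Pi :=
  quot_map (closed_normal_closure rels) (stable D e).

Local Notation st := stable_letter.

Lemma Pi1_pro_C : pro_C C Pi.
Proof. by apply: quot_pro_C => //; have [] := coprod_free D. Qed.

Lemma vertex_mapM v : {morph vm v : x y / x * y}.
Proof.
move=> x y; rewrite /vertex_map /coprod_vertex.
have [_ /(_ (Some v)) [_ cM] _] := coprod_free D.
by rewrite cM quot_mapM.
Qed.

Lemma vertex_map_continuous v : continuous (vm v).
Proof.
have [_ /(_ (Some v)) [cc _] _] := coprod_free D.
exact: (comp_continuous cc (@quot_map_continuous _ _)).
Qed.

Lemma relator_trivial x : rels x ->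
  quot_map (closed_normal_closure rels) x = 1.
Proof. by move=> Rx; apply/quot_map1 => K; exact. Qed.

Lemma stable_letter_tree e : inr e \in T -> st e = 1.
Proof. by move=> eT; apply: relator_trivial; left; exists e. Qed.

Lemma stable_letter_rel e (g : egroup GG e) :
  vm (endpt false e) (boundary GG false g) * st e = st e * vm (endpt true e) (boundary GG true g).
Proof.
have : quot_map (closed_normal_closure rels)
   ((coprod_vertex D (boundary GG false g))^-1 * stable D e *
     coprod_vertex D (boundary GG true g) * (stable D e)^-1) = 1.
  by apply: relator_trivial; right; exists e, g.
rewrite !quot_mapM !quot_mapV => E.
rewrite /vertex_map /stable_letter.
apply: (mulgI (quot_map (closed_normal_closure rels)
  (coprod_vertex D (boundary GG false g)))^-1).
rewrite mulKg; apply/eqP; rewrite eq_sym mulgA.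
rewrite -divg_eq1; exact/eqP.
Qed.

Lemma Pi1_exist (H : topologicalGroupType) (f : forall v, vgroup GG v -> H)
    (b : edge Gamma -> H) :
  pro_C C H -> (forall v, continuous_morphism (f v)) ->
  (forall e, inr e \in T -> b e = 1) ->
  (forall e (g : egroup GG e),
     f _ (boundary GG false g) * b e = b e * f _ (boundary GG true g)) ->
  exists h : Pi -> H, [/\ continuous_morphism h,
    forall v g, h (vm v g) = f v g & forall e, h (st e) = b e].
Proof.
move=> pH fm bT bE.
have [_ /(_ H pH b)[h0 [[h0m h0E] _]]] := fgroup_free D.
pose f' (o : option (vertex Gamma)) : factors GG (fgroup D) o -> H :=
  match o with None => h0 | Some v => f v end.
have f'm o : continuous_morphism (f' o) by case: o => [v|]; [exact: fm | exact: h0m].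
have [_ _ /(_ H pH f' f'm)[h1 [[h1m h1E] _]]] := coprod_free D.
have [h1c h1M] := h1m.
have hs e : h1 (stable D e) = b e by rewrite /stable (h1E None) /= h0E.
have hv v g : h1 (coprod_vertex D (v := v) g) = f v g by exact: (h1E (Some v)).
have hH := pro_C_hausdorff pH.
have [|h hm hE] := @continuous_quot_lift _ (closed_normal_closure rels) _ h1 h1m.
  (* The kernel of [h1] is a closed normal subgroup, so it contains the closed normal closure as
     soon as it contains the relators. *)
  move=> x /(_ (kernel_cns hH h1m)); rewrite kernel_cnsE; apply=> y.
  case=> [[e eT <-]|[e [g ->]]]; rewrite kernel_cnsE.
    by rewrite hs bT.
  rewrite !h1M !(morphismV h1M) !hv hs; apply/eqP.
  by rewrite divg_eq1 -mulgA -bE mulKg.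
by exists h; split=> // [v g|e]; rewrite hE.
Qed.

Lemma Pi1_unique (H : topologicalGroupType) (h h' : Pi -> H) :
  pro_C C H -> continuous_morphism h -> continuous_morphism h' ->
  (forall v g, h (vm v g) = h' (vm v g)) -> (forall e, h (st e) = h' (st e)) ->
  h =1 h'.
Proof.
move=> pH [hc hM] [h'c h'M] hv hs p.
pose N := closed_normal_closure rels.
have qc := @quot_map_continuous _ N.
have [x <-] := quot_map_surj p.
have [pK inm cof] := coprod_free D.
pose f o (y : factors GG (fgroup D) o) := h (quot_map N (coprod_in (o := o) y)).
have fm o : continuous_morphism (f o).
  have [ic iM] := inm o; split; first exact: comp_continuous (comp_continuous ic qc) hc.
  by move=> a b; rewrite /f iM quot_mapM hM.
have [k [_ kU]] := cof H pH f fm.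
have k1 : k = h \o quot_map N.
  apply: kU; split=> //; split; first exact: comp_continuous qc hc.
  by move=> a b /=; rewrite quot_mapM hM.
have k2 : k = h' \o quot_map N.
  apply: kU; split.
    split; first exact: comp_continuous qc h'c.
    by move=> a b /=; rewrite quot_mapM h'M.
  move=> [v|] y; first by rewrite /f /= [RHS]hv.
  have [_ /(_ H pH (fun e => h (st e)))[l [_ lU]]] := fgroup_free D.
  have [ic iM] := inm None.
  have l1 : l = f None.
    by apply: lU; split; first exact: (fm None).
  have l2 : l = (fun y => h' (quot_map N (coprod_in (o := None) y))).
    apply: lU; split; last by move=> e; rewrite hs.
    split; first exact: comp_continuous (comp_continuous ic qc) h'c.
    by move=> a b; rewrite iM quot_mapM h'M.
  by move/(congr1 (fun k => k y)): l2; rewrite l1 => ->.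
by have := congr1 (fun k => k x) k2; rewrite k1.
Qed.

(** [S] is itself pro-C, so the universal property gives a homomorphism from [Pi] to [S] fixing the
    generators. Followed by the inclusion it is the identity, by uniqueness. *)
Lemma Pi1_generated (S : set Pi) : subgroup_set S -> closed S ->
  (forall v g, S (vm v g)) -> (forall e, S (st e)) -> forall x, S x.
Proof.
move=> SS cS Sv Se x; pose L : topologicalGroupType := sg_type SS.
have pL : pro_C C L := sg_pro_C SS CC C0 Pi1_pro_C cS.
pose f v (g : vgroup GG v) : L := SigSub (mem_set (Sv v g)).
pose b e : L := SigSub (mem_set (Se e)).
have vI : injective (@sg_val _ _ SS) by exact: val_inj.
have [|||h [[hc hM] hv he]] := @Pi1_exist L f b pL.
- move=> v; split.
    by apply: sg_continuous; exact: vertex_map_continuous.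
  by move=> y z; apply: vI; exact: vertex_mapM.
- by move=> e eT; apply: vI; exact: stable_letter_tree.
- by move=> e g; apply: vI; exact: stable_letter_rel.
suff E : @sg_val _ _ SS \o h =1 id by rewrite -[x]E; exact: set_valP.
apply: (Pi1_unique Pi1_pro_C).
- split; first exact: comp_continuous hc (@sg_val_continuous _ _ SS).
  by move=> y z /=; rewrite hM.
- by split; first exact: continuous_id.
- by move=> v g /=; rewrite hv.
- by move=> e /=; rewrite he.
Qed.

End FundamentalGroup.

(** * Maximal subtrees *)

Lemma connect_boundary (V : finType) (r : rel V) (P : pred V) u v :
  connect r u v -> P u -> ~~ P v -> exists x y, [/\ r x y, P x & ~~ P y].
Proof.
move=> /connectP[p]; elim: p u => [|x p IH] u /=; first by move=> _ -> ->.
move=> /andP[ux px] E Pu nPv; have [Px|nPx] := boolP (P x); first exact: IH px E Px nPv.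
by exists u, x.
Qed.

Section Trees.
Variable Gamma : graph.
Local Notation V := (vertex Gamma).
Local Notation E := (edge Gamma).

Local Notation src x := (endpt x.2 x.1).
Local Notation tgt x := (endpt (~~ x.2) x.1).

Fixpoint chain (u : V) (s : seq (E * bool)) (v : V) : bool :=
  if s is x :: s' then (src x == u) && chain (tgt x) s' v else u == v.

Lemma chain_cat u s w s' v : chain u s w -> chain w s' v -> chain u (s ++ s') v.
Proof.
elim: s u => [|x s IH] u /=; first by move=> /eqP->.
by move=> /andP[-> cs] cs'; exact: IH cs cs'.
Qed.

Lemma chain_cycle u s : chain u s u ->
  path.cycle (fun x y : E * bool => tgt x == src y) s.
Proof.
case: s => [//|x s] /= /andP[/eqP xu].
have loop z : chain (tgt z) s u ->
    path (fun x y : E * bool => tgt x == src y) z (rcons s x).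
  elim: s z => [|y s IH] z /=; first by rewrite xu => ->.
  by move=> /andP[/eqP-> /IH->]; rewrite eqxx.
exact: loop.
Qed.

Variable T : {set graph_elt Gamma}.

(** If a vertex is missing, some edge [e] leads from [x] in [T] to [y] outside [T]. Adding [e] and
    [y] keeps a tree: a circuit through [e] would need a second edge at [y], but the other edges lie
    in [T] and do not touch [y]. *)
Lemma maximal_subtree_spanning :
  connected_graph Gamma -> maximal_subtree T -> forall v, inl v \in T.
Proof.
move=> [_ _ cG] [[[subT [u0 u0T] cT] ncT] maxT] v; apply: contraT => nvT.
have := cG u0 v (finset.in_setT _) (finset.in_setT _).
move=> /(connect_boundary (P := fun v => inl v \in T))/(_ u0T nvT)[x [y]].
move=> [/existsP[e /existsP[b /and3P[_ /eqP eqx /eqP eqy]]] xT nyT].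
have neT : inr e \notin T.
  by apply: contra nyT => eT; rewrite -eqy; exact: (subT (inr e)).
pose T' := (inl y |: (inr e |: T)).
have TT' : T \subset T' by apply/fintype.subsetP => m mT; rewrite !inE mT !orbT.
have T'v w : (inl w \in T') = (w == y) || (inl w \in T) by rewrite !inE.
have T'e f : (inr f \in T') = (f == e) || (inr f \in T) by rewrite !inE.
have end_e c : (endpt c e == y) || (inl (endpt c e) \in T).
  have [->|] := eqVneq c b; first by rewrite eqx xT orbT.
  by case: c b eqx eqy => [] [] // eqx eqy _; rewrite ?eqx ?eqy eqxx.
suff /maxT/(_ TT') ET : tree T' by rewrite -ET T'v eqxx in nyT.
split; last first.
  move=> s; rewrite /circuit => /and4P[s0 cyc us uv] sT'.
  have [/mapP[[e' c] es /= ee]|nes] := boolP (e \in [seq x.1 | x <- s]); last first.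
    apply: (ncT s); first by apply/and4P.
    move=> z zs; have := sT' z zs; rewrite T'e => /predU1P[ze|//].
    by case/negP: nes; apply/mapP; exists z.
  (* The circuit is rotated to start with [e]; all its other edges then lie in [T]. *)
  subst e'; have [i s' rs] := rot_to es.
  have us' : uniq [seq x.1 | x <- (e, c) :: s'] by rewrite -rs map_rot rot_uniq.
  have cyc' := cyc; rewrite -(rot_cycle i) rs /= in cyc'.
  have sT's z : z \in s' -> inr z.1 \in T.
    move=> zs; have : inr z.1 \in T'.
      by apply: sT'; rewrite -(mem_rot i) rs inE zs orbT.
    rewrite T'e => /predU1P[ze|//]; move: us' => /= /andP[/mapP[]].
    by exists z.
  have yT z d : z \in s' -> endpt d z.1 != y.
    move=> /sT's zT; apply: contra nyT => /eqP <-.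
    exact: (subT (inr z.1)).
  case: s' rs us' cyc' sT's yT => [|z s'] rs us' /= cyc' sT's yT.
    move: cyc'; rewrite andbT => /eqP loop.
    have xy : x = y.
      by rewrite -eqx -eqy; case: b c loop {eqx eqy es rs us'} => [] [] /= ->.
    by rewrite -xy xT in nyT.
  move: cyc'; rewrite rcons_path /= => /andP[/eqP ez /andP[_ /eqP eze]].
  (* Depending on the direction in which [e] is traversed, [y] is the source of the next edge or the
     target of the last one. *)
  have [cb|cb] := eqVneq c b.
    by have := yT z z.2 (mem_head _ _); rewrite -ez cb eqy eqxx.
  have lz : last z s' \in z :: s' by exact: mem_last.
  have := yT _ (~~ (last z s').2) lz; rewrite eze.
  by rewrite (_ : c = ~~ b) ?eqy ?eqxx //; case: c b cb {eqx eqy ez eze es rs us' yT} => [] [].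
have symT' : connect_sym (adjacent T').
  apply: sym_connect_sym => p q; apply/existsP/existsP=> -[f /existsP[c /and3P[fT h1 h2]]];
    by exists f; apply/existsP; exists (~~ c); apply/and3P; split; rewrite ?negbK.
have TT'c p q : inl p \in T -> inl q \in T -> connect (adjacent T') p q.
  move=> pT qT; apply: connect_sub (cT p q pT qT) => p' q'.
  move=> /existsP[f /existsP[c /and3P[fT h1 h2]]]; apply: connect1.
  by apply/existsP; exists f; apply/existsP; exists c; rewrite T'e fT orbT h1 h2.
have xyc : connect (adjacent T') x y.
  apply: connect1; apply/existsP; exists e; apply/existsP; exists b.
  by rewrite T'e eqxx eqx eqy !eqxx.
have xc p : inl p \in T' -> connect (adjacent T') x p.
  by rewrite T'v => /predU1P[-> //|pT]; exact: TT'c.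
split.
- move=> [w|f] c /=; first by [].
  rewrite T'e T'v => /predU1P[->|fT]; first exact: end_e.
  by rewrite (subT (inr f) c fT) orbT.
- by exists y; rewrite T'v eqxx.
- by move=> p q /xc pc /xc; apply: connect_trans; rewrite symT'.
Qed.

(** A subtree of [T] under construction, with two facts that survive growth: every labelling of its
    edges is a coboundary, and any two vertices are joined by a simple path. The paths are kept in
    order to produce a circuit in [T] if an edge of [T] is left out at the end. *)
Record tree_state (root : V) (S : {set V}) (Y : {set E}) : Prop := TreeState {
  ts_root : root \in S;
  ts_end : forall e b, e \in Y -> endpt b e \in S;
  ts_edge : forall e, e \in Y -> inr e \in T;
  ts_potential : forall (K : groupType) (lam : E -> K), exists a : V -> K,
    a root = 1 /\ forall e, e \in Y ->
      a (endpt false e) = lam e * a (endpt true e);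
  ts_chain : forall u v, u \in S -> v \in S -> exists s,
    [/\ chain u s v, all (fun x => x.1 \in Y) s, uniq [seq x.1 | x <- s],
        uniq [seq src x | x <- s] & v \notin [seq src x | x <- s]]
}.

Lemma tree_state1 root : tree_state root [set root]%SET finset.set0.
Proof.
split.
- by rewrite inE.
- by move=> e b; rewrite finset.in_set0.
- by move=> e; rewrite finset.in_set0.
- by move=> K lam; exists (fun=> 1); split=> // e; rewrite inE.
- by move=> u v; rewrite !inE => /eqP-> /eqP->; exists [::]; split=> //=.
Qed.

Lemma tree_state_grow root S Y e b : tree_state root S Y ->
  inr e \in T -> endpt b e \in S -> endpt (~~ b) e \notin S ->
  tree_state root (endpt (~~ b) e |: S) (e |: Y).
Proof.
move=> [rS eS eT pot ch] eT' xS; set y := endpt (~~ b) e => nyS.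
have neY : e \notin Y by apply: contra nyS => /(eS e (~~ b)).
have srcS s : all (fun x => x.1 \in Y) s -> forall w, w \in [seq src x | x <- s] -> w \in S.
  by move=> /allP aY w /mapP[z /aY zY ->]; exact: eS.
have edgY (s : seq (E * bool)) : all (fun x => x.1 \in Y) s -> e \notin [seq x.1 | x <- s].
  by move=> /allP aY; apply: contra neY => /mapP[z /aY zY ->].
have wide (s : seq (E * bool)) : all (fun x => x.1 \in Y) s -> all (fun x => x.1 \in e |: Y) s.
  by apply: sub_all => z; rewrite !inE => ->; rewrite orbT.
split.
- by rewrite !inE rS orbT.
- move=> f c; rewrite !inE => /predU1P[->|/(eS f c) ->]; last by rewrite orbT.
  have [->|] := eqVneq c b; first by rewrite xS orbT.
  by rewrite /y; move: (b) => b'; case: c b' => [] []; rewrite ?eqxx.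
- by move=> f; rewrite !inE => /predU1P[->//|]; exact: eT.
- move=> K lam; have [a [ar aE]] := pot K lam.
  (* The equation of [e] solved for its new end, which is [d_0] if [b] holds and [d_1] otherwise. *)
  pose ay := if b then lam e * a (endpt b e) else (lam e)^-1 * a (endpt b e).
  exists (fun v => if v == y then ay else a v); split.
    by rewrite (negPf (_ : root != y)) //; apply: contraNneq nyS => <-.
  move=> f; have nY c g : endpt c g \in S -> (endpt c g == y) = false.
    by move=> gS; apply/negP => /eqP gy; rewrite -gy gS in nyS.
  rewrite !inE => /predU1P[->|fY]; last by rewrite !nY ?eS //; exact: aE.
  move: (nY b e xS); rewrite {}/ay {nY}; move: nyS; rewrite {}/y.
  by case: (b) => /= _ ->; rewrite eqxx ?mulVKg.
- move=> u v; rewrite !inE => /predU1P[->|uS] /predU1P[->|vS].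
  + by exists [::]; split=> //=.
  + have [s [cs aY us uv nv]] := ch _ _ xS vS; exists ((e, ~~ b) :: s).
    split=> /=; rewrite ?negbK ?eqxx //=.
    * by rewrite !inE eqxx wide.
    * by rewrite edgY.
    * by rewrite uv andbT; apply: contra nyS; exact: srcS.
    * by rewrite inE negb_or nv andbT; apply: contraNneq nyS; rewrite /y => <-.
  + have [s [cs aY us uv nv]] := ch _ _ uS xS; exists (rcons s (e, b)).
    rewrite -cats1 !map_cat !cat_uniq all_cat /= !orbF !andbT; split.
    * by apply: chain_cat cs _; rewrite /= !eqxx.
    * by rewrite wide //= !inE eqxx.
    * by rewrite us edgY.
    * by rewrite uv nv.
    * rewrite mem_cat inE negb_or; apply/andP; split.
        by apply: contra nyS; exact: srcS.
      by apply: contraNneq nyS; rewrite /y => ->.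
  + by have [s [cs aY us uv nv]] := ch _ _ uS vS; exists s; split=> //; exact: wide.
Qed.

(** A subtree is grown inside [T] until it has all vertices. It then has all edges of [T], since
    another edge of [T] would close a circuit with the simple path between its ends. *)
Lemma tree_potential root : connected_graph Gamma -> maximal_subtree T ->
  forall (K : groupType) (lam : E -> K), exists a : V -> K,
    a root = 1 /\ forall e, inr e \in T ->
      a (endpt false e) = lam e * a (endpt true e).
Proof.
move=> cG mT; have span := maximal_subtree_spanning cG mT.
have [[[_ _ cT] ncT] _] := mT.
have [S [Y [st full]]] : exists S Y, tree_state root S Y /\ S = [set: V]%SET.
  suff grow n : exists S Y, tree_state root S Y /\ (S = [set: V]%SET \/ n <= #|S|)%N.
    have [S [Y [st [?|h]]]] := grow #|V|; exists S, Y; split=> //.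
    by apply/eqP; rewrite eqEcard finset.subsetT cardsT h.
  elim: n => [|n [S [Y [st [full|h]]]]].
  - by exists [set root]%SET, finset.set0; split; [exact: tree_state1 | right].
  - by exists S, Y; split; [|left].
  - have [full|] := eqVneq S [set: V]%SET; first by exists S, Y; split; [|left].
    rewrite -finset.subTset => /subsetPn[v _ nvS].
    have := cT root v (span _) (span _) => /(connect_boundary (P := fun v => v \in S)).
    move=> /(_ (ts_root st) nvS)[x [y [/existsP[e /existsP[b /and3P[eT /eqP ex /eqP ey]]] xS nyS]]].
    exists (endpt (~~ b) e |: S), (e |: Y); split.
      by apply: tree_state_grow; rewrite ?ex ?ey.
    by right; rewrite cardsU1 ey nyS add1n ltnS.
move=> K lam; have [a [ar aE]] := ts_potential st lam.
exists a; split=> // e eT; apply: aE; apply: contraT => neY.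
have SV v : v \in S by rewrite full inE.
have [s [cs aY us uv nv]] := ts_chain st (SV (endpt true e)) (SV (endpt false e)).
(* The path [s] runs from [d_1] to [d_0] of [e]; traversing [e] from [d_0] to [d_1] closes it. *)
exfalso; apply: (ncT (rcons s (e, false))).
  apply/and4P; split.
  - by case: (s).
  - apply: (chain_cycle (u := endpt true e)); rewrite -cats1.
    by apply: chain_cat cs _; rewrite /= !eqxx.
  - rewrite map_rcons rcons_uniq us andbT /=; apply: contra neY => /mapP[z zs ->].
    exact: (allP aY).
  - by rewrite map_rcons rcons_uniq uv andbT.
move=> z; rewrite mem_rcons inE => /predU1P[-> //|zs].
by apply: (ts_edge st); exact: (allP aY).
Qed.

Lemma tree_connected (P : V -> Prop) : connected_graph Gamma -> maximal_subtree T ->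
  (forall e b, inr e \in T -> P (endpt b e) -> P (endpt (~~ b) e)) ->
  forall u v, P u -> P v.
Proof.
move=> cG mT PE u v Pu; have span := maximal_subtree_spanning cG mT.
have [[[_ _ cT] _] _] := mT; apply: contrapT => nPv.
have /(connect_boundary (P := fun v => `[< P v >])) := cT u v (span u) (span v).
have Pu' : `[< P u >] by apply/asboolP.
have nPv' : ~~ `[< P v >] by apply/asboolPn.
move=> /(_ Pu' nPv')[x [y [/existsP[e /existsP[b /and3P[eT /eqP ex /eqP ey]]]]]].
by move=> /asboolP Px /asboolPn; apply; rewrite -ey; apply: PE => //; rewrite ex.
Qed.

End Trees.

(** * Open normal subgroups meeting the vertex groups in [N] *)

Section Cover.
Variables (C : groupClass) (Gamma : graph) (GG : graphOfGroups C Gamma).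
Variables (T : {set graph_elt Gamma}) (D : freeData GG).
Hypothesis CC : closed_class C.
Hypothesis C0 : exists (gT : finGroupType) (G : {group gT}), C G.
Hypothesis cG : connected_graph Gamma.
Hypothesis mT : maximal_subtree T.

Local Notation Pi := (Pi1 D T).
Local Notation vm v := (@vertex_map C Gamma GG D T v).
Local Notation st := (@stable_letter C Gamma GG T D).
Local Notation V := (vertex Gamma).
Local Notation E := (edge Gamma).
Local Notation d0 e := (endpt false e).
Local Notation d1 e := (endpt true e).
Local Notation vm0 e h := (vm (d0 e) (boundary GG false h)).
Local Notation vm1 e h := (vm (d1 e) (boundary GG true h)).

Variable N : closedNormalSubgroup Pi.
Variables (Q : finGroupType) (f : Pi -> Q).
Hypothesis fh : fin_hom f.
Hypothesis fs : forall q, exists x, f x = q.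
Hypothesis fN : forall x, cns_set N x -> f x = 1.
Hypothesis fV : forall v h, f (vm v h) = 1 -> cns_set N (vm v h).
Variable root : V.
Hypothesis Nroot : N `<=` range (vm root).

Local Notation pi := (quot_map N).

Let fM : {morph f : x y / x * y} := fh.1.

Definition dst e q := q * f (st e).

Lemma vm_pi v h k : f (vm v h) = f (vm v k) -> pi (vm v h) = pi (vm v k).
Proof.
move=> hk; apply/quot_mapP.
rewrite -(morphismV (@vertex_mapM _ _ _ T D v)) -vertex_mapM; apply: fV.
by rewrite vertex_mapM (morphismV (@vertex_mapM _ _ _ T D v)) fM (morphismV fM) hk mulVg.
Qed.

(** Makes the end [d_1] of an edge of the covering graph well defined: moving [q] within its edge
    coset moves [dst e q] within one vertex coset. *)
Lemma dst_coset e q (h : egroup GG e) :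
  dst e (q * f (vm0 e h)) = dst e q * f (vm1 e h).
Proof. by rewrite /dst -!mulgA -!fM stable_letter_rel. Qed.

Definition sel v q : Pi :=
  if pselect (exists h, f (vm v h) = q) is left p then vm v (projT1 (cid p)) else 1.

Lemma selP v h : exists2 k, sel v (f (vm v h)) = vm v k & f (vm v k) = f (vm v h).
Proof.
rewrite /sel; case: pselect => [p|]; last by case; exists h.
by exists (projT1 (cid p)) => //; exact: projT2 (cid p).
Qed.

(** The vertices (resp. edges) of the covering graph of [f] are the cosets of
    the images of the vertex (resp. edge) groups in [V * Q] (resp. [E * Q]);
    a state is a subtree [Y] with vertices [S], together with lifts [g v q] of
    the paths from the base point. *)
Record cover_state (S : {set V * Q}) (Y : {set E * Q}) (g : V -> Q -> Pi) : Prop := CoverState {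
  cs_root : (root, 1) \in S;
  cs_base : pi (g root 1) = 1;
  cs_satS : forall v q h, (v, q) \in S -> (v, q * f (vm v h)) \in S;
  cs_satY : forall e q (h : egroup GG e), (e, q) \in Y -> (e, q * f (vm0 e h)) \in Y;
  cs_f : forall v q, (v, q) \in S -> f (g v q) = q;
  cs_g : forall v q h, (v, q) \in S -> pi (g v (q * f (vm v h))) = pi (g v q * vm v h);
  cs_e : forall e q, (e, q) \in Y ->
    [/\ (d0 e, q) \in S, (d1 e, dst e q) \in S &
        pi (g (d1 e) (dst e q)) = pi (g (d0 e) q * st e)];
  cs_ind : forall P : V -> Pi -> Prop, P root 1 ->
    (forall v x h, P v x -> P v (x * vm v h)) ->
    (forall e x, (e, f x) \in Y -> P (d0 e) x <-> P (d1 e) (x * st e)) ->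
    forall v q, (v, q) \in S -> P v (g v q)
}.

Definition vcoset v q : {set V * Q} :=
  [set x : V * Q | (x.1 == v) && `[< exists h, x.2 = q * f (vm v h) >]]%SET.

Definition ecoset e q : {set E * Q} :=
  [set x : E * Q | (x.1 == e) && `[< exists h : egroup GG e, x.2 = q * f (vm0 e h) >]]%SET.

Lemma vcosetP v q u p :
  (u, p) \in vcoset v q <-> u = v /\ exists h, p = q * f (vm v h).
Proof.
rewrite inE /=; split=> [/andP[/eqP-> /asboolP]|[-> h]]; first by [].
by rewrite eqxx; apply/asboolP.
Qed.

Lemma ecosetP e q u p :
  (u, p) \in ecoset e q <-> u = e /\ exists h : egroup GG e, p = q * f (vm0 e h).
Proof.
rewrite inE /=; split=> [/andP[/eqP-> /asboolP]|[-> h]]; first by [].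
by rewrite eqxx; apply/asboolP.
Qed.

Lemma vm_1 v : vm v 1 = 1. Proof. exact: morphism1 (@vertex_mapM _ _ _ T D v). Qed.

Lemma vm_V v h : vm v h^-1 = (vm v h)^-1.
Proof. exact: morphismV (@vertex_mapM _ _ _ T D v) h. Qed.

Lemma f1 : f 1 = 1. Proof. exact: morphism1 fM. Qed.

Lemma fVg x : f x^-1 = (f x)^-1. Proof. exact: morphismV fM x. Qed.

(** Spreads one lift [x0] over the coset of [f x0] by means of chosen elements of the vertex
    group. *)
Definition vlift v (x0 : Pi) (q : Q) : Pi := x0 * sel v ((f x0)^-1 * q).

Lemma vliftP v x0 h : exists2 k, vlift v x0 (f x0 * f (vm v h)) = x0 * vm v k &
  f (vm v k) = f (vm v h).
Proof.
have [k sk fk] := selP h; exists k => //.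
by rewrite /vlift mulKg sk.
Qed.

Lemma vlift_pi v x0 h : pi (vlift v x0 (f x0 * f (vm v h))) = pi (x0 * vm v h).
Proof. by have [k -> fk] := vliftP x0 h; rewrite !quot_mapM (vm_pi fk). Qed.

Lemma cover_state1 : cover_state (vcoset root 1) finset.set0 (fun _ => vlift root 1).
Proof.
split.
- by apply/vcosetP; split=> //; exists 1; rewrite vm_1 f1 mulg1.
- have := vlift_pi (v := root) 1 1.
  by rewrite vm_1 f1 !mulg1 => ->; apply/quot_map1/cns1.
- move=> v q h /vcosetP[ev [k ->]]; subst v; apply/vcosetP; split=> //.
  by exists (k * h); rewrite vertex_mapM fM mulgA.
- by move=> e q h; rewrite finset.in_set0.
- move=> v q /vcosetP[_ [h ->]]; have := vliftP 1 h; rewrite f1 => -[k -> fk].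
  by rewrite fM f1 fk.
- move=> v q h /vcosetP[ev [k ->]]; subst v.
  have := vlift_pi (v := root) 1 (k * h); have := vlift_pi (v := root) 1 k.
  rewrite f1 vertex_mapM fM !mulgA !mul1g => E1 ->.
  by rewrite [RHS]quot_mapM E1 -quot_mapM.
- by move=> e q; rewrite finset.in_set0.
- move=> P P1 PV _ v q /vcosetP[-> [h ->]].
  have := vliftP 1 h; rewrite f1 => -[k -> _].
  exact: PV.
Qed.

Definition epos (b : bool) e q := if b then dst e q else q.
Definition estep (b : bool) e : Pi := if b then (st e)^-1 else st e.

(** A whole vertex coset and a whole edge coset are added at once, which keeps [S] and [Y]
    saturated. The direction [b] tells which end of the edge is already reached. *)
Lemma cover_state_grow S Y g b e q : cover_state S Y g ->
  (endpt b e, epos b e q) \in S -> (endpt (~~ b) e, epos (~~ b) e q) \notin S ->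
  exists S' Y' g', cover_state S' Y' g' /\ (#|S| < #|S'|)%N.
Proof.
move=> [rS bS sS sY gf gg ge gi] xS nyS.
pose x0 := g (endpt b e) (epos b e q) * estep b e.
pose v' := endpt (~~ b) e.
have fx0 : f x0 = epos (~~ b) e q.
  rewrite /x0 fM gf //; rewrite /epos /estep; case: (b) => //=.
  by rewrite fVg mulgK.
pose S' := S :|: vcoset v' (f x0); pose Y' := Y :|: ecoset e q.
pose g' v p := if (v, p) \in vcoset v' (f x0) then vlift v' x0 p else g v p.
(* As [S] is saturated, the new coset is disjoint from it, and the old lifts are kept. *)
have nS v p : (v, p) \in S -> (v, p) \in vcoset v' (f x0) = false.
  move=> vpS; apply/negP => /vcosetP[ev [h ep]]; case/negP: nyS; subst v.
  have := sS _ _ h^-1 vpS; rewrite ep vm_V fVg mulgK.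
  by rewrite fx0.
have g'S v p : (v, p) \in S -> g' v p = g v p by move=> vpS; rewrite /g' nS.
have g'C h : g' v' (f x0 * f (vm v' h)) = vlift v' x0 (f x0 * f (vm v' h)).
  by rewrite /g' (_ : _ \in _ = true) //; apply/vcosetP; split=> //; exists h.
have inC h : (v', f x0 * f (vm v' h)) \in vcoset v' (f x0).
  by apply/vcosetP; split=> //; exists h.
have inC0 : (v', f x0) \in vcoset v' (f x0).
  by have := inC 1; rewrite vm_1 f1 mulg1.
exists S', Y', g'; split; last first.
  apply: proper_card; apply/properP; split; first exact: finset.subsetUl.
  by exists (v', f x0); [rewrite finset.in_setU inC0 orbT | rewrite fx0].
split.
- by rewrite finset.in_setU rS.
- by rewrite g'S.
- move=> v p h; rewrite !finset.in_setU => /orP[/sS-> //|/vcosetP[ev [k ->]]]; subst v.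
  apply/orP; right; have := inC (k * h).
  by rewrite vertex_mapM fM mulgA.
- move=> e' p h; rewrite !finset.in_setU => /orP[/sY-> //|/ecosetP[ee [k ->]]]; subst e'.
  apply/orP; right; apply/ecosetP; split=> //; exists (k * h).
  by have [_ ->] := boundary_morphism GG false e; rewrite vertex_mapM fM mulgA.
- move=> v p; rewrite finset.in_setU => /orP[vpS|/vcosetP[-> [h ->]]].
    by rewrite g'S // gf.
  by rewrite g'C; have [k -> fk] := vliftP x0 h; rewrite fM fk.
- move=> v p h; rewrite finset.in_setU => /orP[vpS|/vcosetP[ev [k ->]]].
    by rewrite !g'S ?gg ?sS.
  subst v.
  have -> : f x0 * f (vm v' k) * f (vm v' h) = f x0 * f (vm v' (k * h)).
    by rewrite vertex_mapM fM mulgA.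
  rewrite !g'C vlift_pi [RHS]quot_mapM vlift_pi -[RHS]quot_mapM.
  by rewrite vertex_mapM mulgA.
- move=> e' p; rewrite finset.in_setU => /orP[|/ecosetP[ee [h ->]]].
    move=> /ge[h0 h1 h2]; rewrite !g'S //; split=> //; by rewrite finset.in_setU ?h0 ?h1.
  subst e'; rewrite dst_coset.
  (* The new vertex is [d0 e] in the first case and [d1 e] in the second. Both times
     [stable_letter_rel] carries the equation from the chosen sheet to the rest of the edge
     coset. *)
  case: b xS nyS @x0 @v' fx0 @S' @g' nS g'S g'C inC inC0
    => xS nyS x0 v' fx0 S' g' nS g'S g'C inC inC0.
    have {}fx0 : f x0 = q := fx0; have {}xS : (d1 e, dst e q) \in S := xS.
    have E1 := sS _ _ (boundary GG true h) xS.
    have E0 : (d0 e, q * f (vm0 e h)) \in vcoset v' (f x0).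
      by have := inC (boundary GG false h); rewrite {1}fx0.
    have G0 : g' (d0 e) (q * f (vm0 e h)) = vlift v' x0 (f x0 * f (vm0 e h)).
      by have := g'C (boundary GG false h); rewrite {1}fx0.
    split; [by rewrite finset.in_setU E0 orbT | by rewrite finset.in_setU E1 |].
    rewrite g'S // gg // [RHS]quot_mapM G0 vlift_pi -[RHS]quot_mapM -mulgA.
    by rewrite stable_letter_rel /x0 /estep !mulgA mulgVK.
  have {}fx0 : f x0 = dst e q := fx0; have {}xS : (d0 e, q) \in S := xS.
  have E0 := sS _ _ (boundary GG false h) xS.
  have E1 : (d1 e, dst e q * f (vm1 e h)) \in vcoset v' (f x0).
    by have := inC (boundary GG true h); rewrite {1}fx0.
  have G1 : g' (d1 e) (dst e q * f (vm1 e h)) = vlift v' x0 (f x0 * f (vm1 e h)).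
    by have := g'C (boundary GG true h); rewrite {1}fx0.
  split; [by rewrite finset.in_setU E0 | by rewrite finset.in_setU E1 orbT |].
  rewrite [g' (d0 e) _]g'S // G1 vlift_pi /x0 /estep.
  rewrite -mulgA -stable_letter_rel mulgA [LHS]quot_mapM [RHS]quot_mapM.
  by congr (_ * _); exact/esym/gg.
- move=> P P1 PV PE v p; rewrite finset.in_setU => /orP[vpS|/vcosetP[-> [h ->]]].
    rewrite g'S //; apply: (gi P P1 PV _ _ _ vpS) => e' x xY.
    by apply: PE; rewrite finset.in_setU xY.
  rewrite g'C; have [k -> _] := vliftP x0 h; apply: (PV).
  have : P (endpt b e) (g (endpt b e) (epos b e q)).
    apply: (gi P P1 PV _ _ _ xS) => e' x xY.
    by apply: PE; rewrite finset.in_setU xY.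
  have eqY : (e, q) \in Y'.
    rewrite finset.in_setU; apply/orP; right; apply/ecosetP; split=> //; exists 1.
    by have [_ /morphism1->] := boundary_morphism GG false e; rewrite vm_1 f1 mulg1.
  have := PE e; move: xS fx0; rewrite /x0 /v' /epos /estep; case: (b) => /= xS fx0 PEe.
    by move=> Pg; apply: (PEe _ _).2; rewrite ?fx0 ?mulgVK.
  by move=> Pg; apply: (PEe _ _).1; rewrite ?gf.
Qed.

(** Stable letters of [T] are trivial, so the sheets present in [S] are the same over every vertex.
    The elements [x] for which multiplication by [f x] preserves this set of sheets form a closed
    subgroup containing the generators, hence all of [Pi], and [f] is onto. *)
Lemma cover_connected S Y g : cover_state S Y g ->
  (forall e q, ((d0 e, q) \in S) = ((d1 e, dst e q) \in S)) ->
  S = [set: V * Q]%SET.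
Proof.
move=> st1 SE.
have dstT e q : inr e \in T -> dst e q = q.
  by move=> eT; rewrite /dst stable_letter_tree // f1 mulg1.
have SV q u v : (u, q) \in S -> (v, q) \in S.
  apply: (tree_connected (P := fun v => (v, q) \in S) cG mT) => e b eT.
  by have := SE e q; rewrite dstT //; case: b => /= ->.
pose L := [set x : Pi | forall q v, ((v, q) \in S) = ((v, q * f x) \in S)].
have Lall : forall x, L x.
  apply: (Pi1_generated CC C0).
  - split; first by move=> q v; rewrite f1 mulg1.
    + by move=> x y Lx Ly q v; rewrite fM mulgA -Ly.
    + by move=> x Lx q v; rewrite [RHS]Lx fVg mulgVK.
  - have [_ fO] := fh.
    by have [_] := locally_constant_clopen fO [set q' | forall q v, ((v, q) \in S) = ((v, q * q') \in S)].
  - move=> v h q u; apply/idP/idP => /(SV _ _ v).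
      by move=> /(cs_satS st1 h)/SV; exact.
    by move=> /(cs_satS st1 h^-1); rewrite vm_V fVg mulgK => /SV; exact.
  - move=> e q u; apply/idP/idP.
      by move=> /(SV _ _ (d0 e)); rewrite SE => /SV; exact.
    by move=> /(SV _ _ (d1 e)); rewrite -/(dst e q) -SE => /SV; exact.
apply/setP => -[v q]; rewrite finset.in_setT; have [x <-] := fs q.
have rS : (root, f x) \in S.
  by have := Lall x 1 root; rewrite (cs_root st1) mul1g => <-.
exact: SV rS.
Qed.

Lemma cover_full : exists Y g, cover_state [set: V * Q]%SET Y g.
Proof.
suff grow n : exists S Y g, cover_state S Y g /\
    (S = [set: V * Q]%SET \/ n <= #|S|)%N.
  have [S [Y [g [h [<-|h']]]]] := grow #|{: V * Q}|; first by exists Y, g.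
  have <- : S = [set: V * Q]%SET by apply/eqP; rewrite eqEcard finset.subsetT cardsT h'.
  by exists Y, g.
elim: n => [|n [S [Y [g [h h']]]]].
  by exists (vcoset root 1), finset.set0, (fun _ => vlift root 1); split; [exact: cover_state1|right].
have [full|nfull] := pselect (S = [set: V * Q]%SET); first by exists S, Y, g; split; [|left].
have [b [e [q [xS nyS]]]] : exists b e q, (endpt b e, epos b e q) \in S /\
    (endpt (~~ b) e, epos (~~ b) e q) \notin S.
  apply: contrapT => nex; apply/nfull/(cover_connected h) => e q.
  apply/idP/idP => h1; apply: contraT => h2; exfalso; apply: nex.
    by exists false, e, q.
  by exists true, e, q.
have [S' [Y' [g' [st' lt]]]] := cover_state_grow h xS nyS.
exists S', Y', g'; split=> //; right.
by case: h' => [//|h']; exact: leq_ltn_trans h' lt.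
Qed.

(** * The loops outside the spanning tree as a basis *)

Section Basis.
Variables (Y : {set E * Q}) (g : V -> Q -> Pi).
Hypothesis stY : cover_state [set: V * Q]%SET Y g.

Let gf v q : f (g v q) = q. Proof. by apply: (cs_f stY); rewrite finset.in_setT. Qed.
Let gg v q h : pi (g v (q * f (vm v h))) = pi (g v q * vm v h).
Proof. by apply: (cs_g stY); rewrite finset.in_setT. Qed.

(** [pick] sees only the set [ecoset e q], so all sheets of a coset get the same representative. The
    default is never reached, by [ecoset_refl]. *)
Definition crepr e q : Q := odflt q [pick p | (e, p) \in ecoset e q].

Lemma ecoset_sym e q (h : egroup GG e) : ecoset e (q * f (vm0 e h)) = ecoset e q.
Proof.
have [_ bM] := boundary_morphism GG false e.
apply/setP => -[u p]; apply/idP/idP => /ecosetP[-> [k ->]]; apply/ecosetP; split=> //.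
  by exists (h * k); rewrite bM vertex_mapM fM mulgA.
exists (h^-1 * k); rewrite bM (morphismV bM) vertex_mapM vm_V fM fVg mulgA.
by rewrite mulgK.
Qed.

Lemma ecoset_refl e q : (e, q) \in ecoset e q.
Proof.
apply/ecosetP; split=> //; exists 1.
by have [_ /morphism1->] := boundary_morphism GG false e; rewrite vm_1 f1 mulg1.
Qed.

Lemma creprP e q : exists h : egroup GG e, crepr e q = q * f (vm0 e h).
Proof.
rewrite /crepr; case: pickP => [p /ecosetP[_ //]|/(_ q)].
by rewrite ecoset_refl.
Qed.

Lemma crepr_coset e q (h : egroup GG e) : crepr e (q * f (vm0 e h)) = crepr e q.
Proof.
rewrite /crepr ecoset_sym; case: pickP => [//|/(_ q)].
by rewrite ecoset_refl.
Qed.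

Lemma creprK e q : crepr e (crepr e q) = crepr e q.
Proof. by have [h hq] := creprP e q; rewrite {1}hq crepr_coset. Qed.

Lemma crepr_Y e q : ((e, crepr e q) \in Y) = ((e, q) \in Y).
Proof.
have [h ->] := creprP e q; apply/idP/idP; last exact: (cs_satY stY).
move=> /(cs_satY stY h^-1); have [_ bM] := boundary_morphism GG false e.
by rewrite (morphismV bM) vm_V fVg mulgK.
Qed.

Definition cbasis := {x : E * Q | (x \notin Y) && (crepr x.1 x.2 == x.2)}.

(** The fundamental loop of an edge: along the spanning tree to its origin, across it, and back
    along the tree. *)
Definition cloop e q : Pi := g (d0 e) q * st e * (g (d1 e) (dst e q))^-1.

Definition cword (x : cbasis) : Pi := cloop (val x).1 (val x).2.

Lemma cloop_f e q : f (cloop e q) = 1.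
Proof. by rewrite /cloop !fM fVg !gf mulgV. Qed.

(** Edges of the covering graph are labelled by [l], vertex groups by 1. This labelling is a
    homomorphism to the wreath product once it is corrected by potentials, and its coordinate at
    sheet [1] is the required map. *)
Lemma cbasis_exist (K : topologicalGroupType) (l : cbasis -> K) :
  pro_C C K -> C [set: Q]%G ->
  exists h : Pi -> K, [/\ continuous h,
    forall x y, f x = 1 -> h (x * y) = h x * h y,
    forall n, cns_set N n -> h n = 1 & forall x, h (cword x) = l x].
Proof.
move=> pK CQ.
(* The default [1] is the label of the edges of [Y]; through [crepr] the label depends on the edge
   coset only. *)
pose lam e q : K := oapp l 1 (insub (e, crepr e q)).
have lamC e q (h : egroup GG e) : lam e (q * f (vm0 e h)) = lam e q.
  by rewrite /lam crepr_coset.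
have lamY e q : (e, q) \in Y -> lam e q = 1.
  by move=> eqY; rewrite /lam insubF //= crepr_Y eqY.
(* Stable letters of [T] must go to 1, although their lifts may carry nontrivial labels. In each
   sheet [q] a potential along [T] absorbs these labels. *)
have [|a aP] := @choice Q (V -> K) (fun q a => a root = 1 /\
    forall e, inr e \in T -> a (d0 e) = lam e q * a (d1 e)).
  by move=> q; exact: (tree_potential root cG mT (lam^~ q)).
have a1 q : a q root = 1 by have [] := aP q.
have aT q e : inr e \in T -> a q (d0 e) = lam e q * a q (d1 e).
  by have [_] := aP q; exact.
pose phi v (h : vgroup GG v) : wreath K Q :=
  Wreath (fun q => (a q v)^-1 * a (q * f (vm v h)) v) (f (vm v h)).
pose b e : wreath K Q :=
  Wreath (fun q => (a q (d0 e))^-1 * lam e q * a (dst e q) (d1 e)) (f (st e)).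
have fvO v q : open [set h | f (vm v h) = q].
  by move/continuousP: (@vertex_map_continuous _ _ _ T D v) => /(_ _ (fh.2 q)).
have [||||h [[hc hM] hv he]] := @Pi1_exist _ _ _ T D (wreath K Q) phi b.
- exact: wreath_pro_C.
- move=> v; split.
    apply: wreath_continuous => q; last exact: fvO.
    apply: (continuous_locally_constant (f := fun h => f (vm v h))
      (g := fun _ p => (a q v)^-1 * a (q * p) v)) => p; first exact: fvO.
    exact: continuous_cst.
  move=> x y; apply: wreath_eq => [q|]; rewrite /wfun /wtop /= vertex_mapM fM //.
  by rewrite !mulgA mulgK.
- move=> e eT; apply: wreath_eq => [q|]; rewrite /wfun /wtop /=; last first.
    by rewrite stable_letter_tree // f1.
  by rewrite -mulgA /dst stable_letter_tree // f1 mulg1 -aT // mulVg.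
- move=> e x; apply: wreath_eq => [q|]; rewrite /wfun /wtop /=; last first.
    by rewrite -!fM stable_letter_rel.
  rewrite lamC dst_coset -/(dst e q) !mulgA mulgK.
  by rewrite -[RHS]mulgA mulgA mulgK.
have ht x : wtop (h x) = f x.
  apply: (Pi1_generated CC C0 (S := [set x | wtop (h x) = f x])).
  - split=> /=; first by rewrite (morphism1 hM) f1.
      by move=> y z /= hy hz; rewrite hM wtopM hy hz fM.
    by move=> y /= hy; rewrite (morphismV hM) fVg -hy.
  - have o1 q : open (f @^-1` [set q]) by have [_] := fh; exact.
    have o2 q : open (h @^-1` (@wtop K Q @^-1` [set q])).
      by move/continuousP: hc => /(_ _ (wtop_open (q := q))).
    rewrite -openC (_ : ~` _ = \bigcup_(p in [set p : Q * Q | p.1 <> p.2])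
       (h @^-1` (@wtop K Q @^-1` [set p.1]) `&` f @^-1` [set p.2])).
      by apply: bigcup_open => p _; exact: openI.
    apply/seteqP; split=> y /=; first by move=> ny; exists (wtop (h y), f y).
    by move=> [[p q] /= npq [hp fq]] E; apply: npq; rewrite -hp -fq.
  - by move=> v k /=; rewrite hv.
  - by move=> e /=; rewrite he.
pose H x := wfun (h x) 1.
have HM x y : H (x * y) = H x * wfun (h y) (f x).
  by rewrite /H hM wfunM mul1g ht.
have HM1 x y : f x = 1 -> H (x * y) = H x * H y by rewrite HM => ->.
have Hst x e : H (x * st e) =
    H x * ((a (f x) (d0 e))^-1 * lam e (f x) * a (dst e (f x)) (d1 e)).
  by rewrite HM he.
(* The lifts run inside [Y], where all labels are 1, so only the potentials remain; in [cloop] they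
   cancel and leave the label of the edge. *)
have Hg v q : H (g v q) = a q v.
  rewrite -{2}(gf v q); apply: (cs_ind stY (P := fun v x => H x = a (f x) v)).
  - by rewrite f1 a1 /H (morphism1 hM).
  - move=> u x k; rewrite HM hv fM => ->.
    by rewrite /phi /wfun /= mulVKg.
  - move=> e x xY; rewrite Hst lamY // mulg1 fM -/(dst e (f x)).
    split=> [->|E]; first by rewrite mulVKg.
    apply: (mulIg ((a (f x) (d0 e))^-1 * a (dst e (f x)) (d1 e))).
    by rewrite E mulVKg.
  - by rewrite finset.in_setT.
exists H; split=> //.
- exact: comp_continuous hc (wfun_continuous (a := 1)).
- move=> n Nn; have [k _ nk] := Nroot Nn; rewrite /H -nk hv /phi /wfun /=.
  by rewrite nk fN // mulg1 mulVg.
- move=> [[e q] /= eq]; rewrite /cword /=.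
  have : H (cloop e q * g (d1 e) (dst e q)) = H (g (d0 e) q * st e).
    by rewrite /cloop mulgVK.
  rewrite HM1 ?cloop_f // Hst !Hg gf -mulgA mulVKg => /mulIg ->.
  have /andP[_ /eqP /= cq] := eq.
  by rewrite /lam cq insubT.
Qed.

(** Schreier rewriting with the transversals [g v], carried out modulo [N]. First all loops are
    shown to lie in [S], also those of tree edges and of other sheets of an edge coset. *)
Lemma cbasis_generate (S : set Pi) : subgroup_set S -> closed S -> N `<=` S ->
  (forall x, S (cword x)) -> forall x, f x = 1 -> S x.
Proof.
move=> SS cS NS Sw; have [S1 SM SV] := SS.
have Spi x y : pi x = pi y -> S x -> S y.
  by move=> /quot_mapP/NS h Sx; rewrite -(mulVKg x y); exact: SM.
have S1pi x : pi x = 1 -> S x by move=> /quot_map1; exact: NS.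
have Sloop e q : S (cloop e q).
  have [eqY|neY] := boolP ((e, q) \in Y).
    apply: S1pi; have [_ _ E1] := cs_e stY eqY.
    by rewrite /cloop quot_mapM quot_mapV E1 mulgV.
  have [h ch] := creprP e q.
  have nx : ((e, crepr e q) \notin Y) && (crepr e (crepr e q) == crepr e q).
    by rewrite crepr_Y neY creprK eqxx.
  apply: Spi (Sw (Sub (e, crepr e q) nx)).
  rewrite /cword SubK /= /cloop ch dst_coset !quot_mapM !quot_mapV !gg !quot_mapM.
  rewrite invgM !mulgA; congr (_ * _).
  have rel : pi (vm0 e h) * pi (st e) = pi (st e) * pi (vm1 e h).
    by rewrite -!(@quot_mapM Pi N) stable_letter_rel.
  by rewrite -(mulgA _ (pi (vm0 e h))) rel mulgA mulgK.
have Sroot v q : S (g v q * (g root q)^-1).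
  apply: (tree_connected (P := fun v => S (g v q * (g root q)^-1)) cG mT _ (u := root)).
    move=> e b eT; have := Sloop e q.
    rewrite /cloop /dst stable_letter_tree // f1 !mulg1 => Sl Sb.
    case: b Sb => /= Sb; first by have := SM _ _ Sl Sb; rewrite mulgA mulgVK.
    by have := SM _ _ (SV _ Sl) Sb; rewrite invgM invgK mulgA mulgVK.
  by rewrite mulgV.
(* The Schreier cocycle. By [FM] the elements whose values all lie in [S] form a subgroup, so only
   generators need checking. For [f x = 1] the value at [q = 1] is a conjugate of [x] by an element
   of [N]. *)
pose F q x := g root q * x * (g root (q * f x))^-1.
have FM q x y : F q (x * y) = F q x * F (q * f x) y.
  by rewrite /F fM !mulgA mulgVK.
have Fgen u v q x : S (g u q * x * (g v (q * f x))^-1) -> S (F q x).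
  move=> Sx; have := SM _ _ (SM _ _ (SV _ (Sroot u q)) Sx) (Sroot v (q * f x)).
  by rewrite invgM invgK !mulgA !mulgVK.
have Lall x : forall q, S (F q x).
  move: x; apply: (Pi1_generated CC C0 (S := [set x | forall q, S (F q x)])).
  - split=> /=.
    + by move=> q; rewrite /F f1 !mulg1 mulgV.
    + by move=> x y Sx Sy q; rewrite FM; exact: SM.
    + move=> x Sx q; rewrite -(invgK (F q _)); apply: SV.
      have := Sx (q * f x^-1); congr S.
      apply: (mulgI (F q x^-1)); rewrite -FM mulVg mulgV.
      by rewrite /F f1 !mulg1 mulgV.
  - have cF q : continuous (F q).
      apply: (continuous_locally_constant fh.2
        (g := fun x p => g root q * x * (g root (q * p))^-1)) => p.
      apply: continuousMg; last exact: continuous_cst.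
      exact: continuous_mull.
    rewrite (_ : [set x | _] = \bigcap_(q in setT) (F q @^-1` S)).
      by apply: closed_bigI => q _; move/continuous_closedP: (cF q); exact.
    by apply/seteqP; split=> x /= h q; [move=> _|]; exact: h.
  - move=> v h q; apply: (Fgen v v); apply: S1pi.
    by rewrite quot_mapM quot_mapV gg mulgV.
  - by move=> e q; apply: (Fgen (d0 e) (d1 e)); exact: Sloop.
move=> x fx; have := Lall x 1; rewrite /F fx mulg1 => Sx.
have Sb := S1pi _ (cs_base stY).
by have := SM _ _ (SM _ _ (SV _ Sb) Sx) Sb; rewrite !mulgA mulVg mul1g mulgVK.
Qed.

End Basis.

Lemma cover_basis : C [set: Q]%G -> exists (X : finType) (w : X -> Pi),
  [/\ forall x, f (w x) = 1,
    forall (K : topologicalGroupType) (l : X -> K), pro_C C K ->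
      exists h : Pi -> K, [/\ continuous h,
        forall x y, f x = 1 -> h (x * y) = h x * h y,
        forall n, cns_set N n -> h n = 1 & forall x, h (w x) = l x] &
    forall S : set Pi, subgroup_set S -> closed S -> N `<=` S ->
      (forall x, S (w x)) -> forall x, f x = 1 -> S x].
Proof.
move=> CQ; have [Y [g stY]] := cover_full.
exists (cbasis Y : finType), (cword (Y := Y) g); split.
- by move=> x; exact: cloop_f stY _ _.
- by move=> K l pK; exact: cbasis_exist.
- by move=> S SS cS NS Sw x; exact: (cbasis_generate stY).
Qed.

End Cover.

(** * Adjoining roots *)

Section Roots.
Variable C : groupClass.
Hypothesis CC : closed_class C.
Hypothesis C0 : exists (gT : finGroupType) (G : {group gT}), C G.

(** By Cauchy, [Q] has a subgroup of each prime order [p] dividing [#|G|]; [G] is an iterated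
    extension of such groups. *)
Lemma class_abelian (Q : finGroupType) : C [set: Q]%G ->
  forall (gT : finGroupType) (G : {group gT}), abelian G ->
    (forall p, prime p -> p %| #|G| -> p %| #|Q|)%N -> C G.
Proof.
move=> CQ gT G; have [n] := ubnP #|G|; elim: n gT G => // n IH gT G Gn abG pG.
have [G1|ntG] := eqVneq (G : {set gT}) 1%g.
  have -> : G = 1%G by apply: val_inj.
  exact: class_one.
have G1 : (1 < #|G|)%N by rewrite cardG_gt1.
have pp := pdiv_prime G1; have [x xG ox] := Cauchy pp (pdiv_dvd #|G|).
have pQ : (pdiv #|G| %| #|[set: Q]%G|)%N by rewrite cardsT; apply: pG => //; exact: pdiv_dvd.
have [y yQ oy] := Cauchy pp pQ.
have sG : <[x]>%g \subset G by rewrite cycle_subG.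
have nG : (<[x]> <| G)%g by rewrite -sub_abelian_normal.
apply: (class_extension CC nG).
  apply: (class_isog CC (G := <[y]>%G)); last exact: class_subgroup CC _ _ _ (finset.subsetT _) CQ.
  by rewrite isog_cyclic_card ?cycle_cyclic // -!orderE ox oy eqxx.
apply: IH.
- rewrite card_quotient ?normal_norm // -divgS //.
  have : (#|G| %/ #|<[x]>%g| < #|G|)%N.
    by rewrite ltn_Pdiv ?cardG_gt0 // -orderE ox prime_gt1.
  by move=> h; apply: leq_trans h _; rewrite -ltnS.
- exact: quotient_abelian.
- move=> p pr pd; apply: pG => //; apply: dvdn_trans pd _.
  by rewrite card_quotient ?normal_norm // dvdn_indexg.
Qed.

Section Z.
Variables (Z : topologicalGroupType) (X : finType) (rho : X -> Z) (m : nat).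
Hypothesis Zab : forall x y : Z, commute x y.

Local Notation n := m.+1.

Definition coords : finGroupType := {dffun forall x : X, 'I_n : finGroupType}.

Lemma coordsM (a b : coords) x : (a * b) x = a x * b x :> 'I_n.
Proof. by rewrite ffunE. Qed.

Lemma coords1 x : (1 : coords) x = 1 :> 'I_n.
Proof. by rewrite ffunE. Qed.

Lemma coords_commute (a b : coords) : commute a b.
Proof. by apply/ffunP => x; rewrite !coordsM; exact: Zp_mulgC. Qed.

Lemma class_coords (Q : finGroupType) : C [set: Q]%G -> #|Q| = n ->
  C [set: coords]%G.
Proof.
move=> CQ cQ; apply: class_residual => // a na.
have [x nx] : exists x, a x <> 1.
  apply: contrapT => /forallNP h; apply: na; apply/ffunP => x.
  by rewrite coords1; have /contrapT := h x.
exists ('I_n : finGroupType), (fun a : coords => a x); split=> //.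
  by move=> b c; rewrite coordsM.
apply: (class_abelian CQ); first exact: Zp_abelian.
by move=> p _; rewrite cardsT card_ord cQ.
Qed.

Definition unit_coord (x : X) : coords := [ffun y => if y == x then inZp 1 else 1].

Lemma unit_coordX (a : coords) x j :
  (a * unit_coord x ^+ j) x = inZp (a x + j) :> 'I_n.
Proof.
elim: j => [|j IH]; first by rewrite expg0 mulg1 addn0 valZpK.
rewrite expgSr mulgA coordsM IH ffunE eqxx; apply: val_inj => /=.
by rewrite modnDm addn1 addnS.
Qed.

Lemma unit_coordXn (a : coords) x y j : y != x ->
  (a * unit_coord x ^+ j) y = a y :> 'I_n.
Proof.
move=> /negPf nyx; elim: j => [|j IH]; first by rewrite expg0 mulg1.
by rewrite expgSr mulgA coordsM IH ffunE nyx mulg1.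
Qed.

Definition wrap (x : X) (j : nat) (a : coords) : Z :=
  if (n <= a x + j)%N then rho x else 1.

(** The standard root: in the wreath product of [Z] by [Z/n], a shift by the generator with value
    [z] at the one place where it wraps around has [n]-th power [diag z]. Each [x] has its own
    factor [Z/n], so that the roots commute. *)
Definition root_elt (x : X) : wreath Z coords := Wreath (wrap x 1) (unit_coord x).

(** In at most [n] unit shifts a coordinate wraps around at most once, so [wrap x j] never needs a
    higher power of [rho x]. *)
Lemma root_eltX x j : (j <= n)%N ->
  root_elt x ^+ j = Wreath (wrap x j) (unit_coord x ^+ j).
Proof.
elim: j => [_|j IH jn].
  rewrite !expg0; apply: wreath_eq => // a.
  by rewrite /wfun /= /wrap addn0 leqNgt ltn_ord.
rewrite expgSr IH 1?ltnW //; apply: wreath_eq; last by rewrite expgSr.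
move=> a; rewrite wfunM /wfun /wtop /= /wrap unit_coordX /=.
have ax := ltn_ord (a x); have [le|lt] := leqP n (a x + j).
  have lt : (a x + j - n < n)%N.
    by rewrite ltn_subLR // -addnS leq_add // ltnW.
  have -> : ((a x + j) %% n = a x + j - n)%N by rewrite -{1}(subnK le) modnDr modn_small.
  rewrite ifF ?ifT ?mulg1 //; first by rewrite addnS ltnW.
  apply/negbTE; rewrite -leqNgt addn1 ltn_subLR // addSn ltnS.
  by rewrite leq_add // -ltnS.
by rewrite modn_small // mul1g addn1 addnS.
Qed.

Lemma root_elt_pow x : root_elt x ^+ n = Wreath (fun=> rho x) 1.
Proof.
rewrite root_eltX //; apply: wreath_eq => [a|].
  by rewrite /wfun /= /wrap leq_addl.
rewrite /wtop /= -[LHS]mul1g; apply/ffunP => y; rewrite coords1.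
have [->|nyx] := eqVneq y x; last by rewrite unit_coordXn // coords1.
by rewrite unit_coordX coords1; apply: val_inj; rewrite /= add0n modnn.
Qed.

Lemma root_elt_commute x y : commute (root_elt x) (root_elt y).
Proof.
have [-> //|nxy] := eqVneq x y; apply: wreath_eq; last exact: coords_commute.
move=> a; rewrite !wfunM /wfun /wtop /= /wrap.
have nyx : y != x by rewrite eq_sym.
have := unit_coordXn a 1 nyx; have := unit_coordXn a 1 nxy; rewrite !expg1 => -> ->.
exact: Zab.
Qed.

End Z.
End Roots.

(** * The normal complement *)

Lemma mulgACA_commute (G : groupType) (a b c d : G) :
  commute b c -> a * b * (c * d) = a * c * (b * d).
Proof. by move=> bc; rewrite -!mulgA (mulgA b) bc !mulgA. Qed.

(** Reordering of commuting factors in a noncommutative group, for [normJ], where conjugation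
    permutes the factors of the norm. *)
Lemma prod_perm (G : groupType) (I : eqType) (F : I -> G) (s s' : seq I) :
  (forall i j, commute (F i) (F j)) -> perm_eq s s' ->
  \prod_(i <- s) F i = \prod_(i <- s') F i.
Proof.
move=> Fc; elim: s s' => [|i s IH] s'.
  by rewrite perm_sym => /perm_nilP ->.
move=> ss'; have is' : i \in s' by rewrite -(perm_mem ss') mem_head.
case/splitPr: is' ss' => s1 s2.
rewrite perm_sym perm_catC /= perm_cons perm_catC perm_sym => /IH {}IH.
rewrite big_cons IH !big_cat big_cons /= mulgA [in RHS]mulgA; congr (_ * _).
by apply: commute_prod.
Qed.

Lemma continuous_prodg (S : topologicalType) (G : topologicalGroupType) (I : Type)
    (F : I -> S -> G) (l : seq I) :
  (forall i, continuous (F i)) -> continuous (fun x => \prod_(i <- l) F i x).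
Proof.
move=> cF; elim: l => [|i l IH].
  rewrite (_ : (fun x => _) = fun=> 1); first exact: continuous_cst.
  by apply/funext => x; rewrite big_nil.
rewrite (_ : (fun x => _) = fun x => F i x * \prod_(i <- l) F i x).
  exact: continuousMg.
by apply/funext => x; rewrite big_cons.
Qed.

Lemma continuousXg (S : topologicalType) (G : topologicalGroupType) (F : S -> G) n :
  continuous F -> continuous (fun x => F x ^+ n).
Proof.
move=> cF; elim: n => [|n IH]; first by under eq_fun do rewrite expg0; exact: continuous_cst.
by under eq_fun do rewrite expgS; exact: continuousMg.
Qed.

Section Complement.
Variable C : groupClass.
Hypothesis CC : closed_class C.
Hypothesis C0 : exists (gT : finGroupType) (G : {group gT}), C G.
Variables (P : topologicalGroupType) (N : closedNormalSubgroup P).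
Hypothesis pP : pro_C C P.
Variables (Q : finGroupType) (f : P -> Q).
Hypothesis fh : fin_hom f.
Hypothesis fs : forall q, exists x, f x = q.
Hypothesis CQ : C [set: Q]%G.
Hypothesis fN : forall x, cns_set N x -> f x = 1.
Hypothesis inner : forall u, f u = 1 -> exists2 n, cns_set N n &
  forall x, cns_set N x -> x ^ u = x ^ n.
Variables (X : finType) (w : X -> P).
Hypothesis fw : forall x, f (w x) = 1.
Hypothesis w_exist : forall (K : topologicalGroupType) (l : X -> K), pro_C C K ->
  exists h : P -> K, [/\ continuous h,
    forall x y, f x = 1 -> h (x * y) = h x * h y,
    forall n, cns_set N n -> h n = 1 & forall x, h (w x) = l x].
Hypothesis w_generate : forall S : set P, subgroup_set S -> closed S -> N `<=` S ->
  (forall x, S (w x)) -> forall x, f x = 1 -> S x.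

Let fM : {morph f : x y / x * y} := fh.1.
Let f1 : f 1 = 1 := morphism1 fM.
Let fV x : f x^-1 = (f x)^-1. Proof. exact: (morphismV fM). Qed.
Let fJ x g : f x = 1 -> f (x ^ g) = 1.
Proof. by move=> fx; rewrite !fM fV fx mul1g mulVg. Qed.

Let cP : compact [set: P]. Proof. exact: pro_C_compact pP. Qed.
Let hP : hausdorff_space P. Proof. exact: pro_C_hausdorff pP. Qed.

Definition centralizer : closedNormalSubgroup P.
Proof.
exists [set k | f k = 1 /\ forall x, cns_set N x -> k * x = x * k].
- rewrite (_ : [set k | _] = f @^-1` [set 1] `&`
     \bigcap_(x in cns_set N) [set k | k * x = x * k]); last by apply/seteqP; split.
  apply: closedI; first by have [_] := locally_constant_clopen fh.2 [set 1].
  apply: closed_bigI => x _; apply: closed_eqfun hP _ _.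
    exact: continuous_mulr.
  exact: continuous_mull.
- by split=> // x _; rewrite mul1g mulg1.
- move=> x y [fx cx] [fy cy]; split; first by rewrite fM fx fy mulg1.
  by move=> z Nz; rewrite -mulgA cy // mulgA (cx _ Nz) -mulgA.
- move=> x [fx cx]; split; first by rewrite fV fx invg1.
  by move=> z Nz; apply: (mulgI x); rewrite mulVKg !mulgA cx // mulgK.
- move=> g x [fx cx]; split; first exact: fJ.
  move=> z Nz; have := cx _ (cnsJ g^-1 Nz) => /(congr1 (fun y => y ^ g)).
  by rewrite (conjMg x) (conjMg _ x) conjgKV.
Defined.

Local Notation K := (cns_set centralizer).

Lemma Kf k : K k -> f k = 1. Proof. by case. Qed.

Lemma KN k x : K k -> cns_set N x -> commute k x. Proof. by move=> [_]; exact. Qed.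

(** If [u] acts on [N] as [n] does, then [u * n^-1] centralizes [N]. *)
Lemma Kdecomp u : f u = 1 -> exists c n, [/\ K c, cns_set N n & u = c * n].
Proof.
move=> fu; have [n Nn un] := inner fu; exists (u * n^-1), n.
split=> //; last by rewrite mulgVK.
split; first by rewrite fM fV fu fN // invg1 mulg1.
move=> x Nx; have := un _ Nx => /(congr1 (fun y => y ^ n^-1)).
rewrite conjgK -conjgM => E.
by rewrite [RHS]conjgC E.
Qed.

Definition centre : closedNormalSubgroup P.
Proof.
exists (K `&` N).
- by apply: closedI; exact: cns_closed.
- by split; exact: cns1.
- by move=> x y [? ?] [? ?]; split; exact: cnsM.
- by move=> x [? ?]; split; exact: cnsV.
- by move=> g x [? ?]; split; exact: cnsJ.
Defined.

Local Notation Z := (cns_set centre).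

Lemma ZZ x y : Z x -> Z y -> commute x y.
Proof. by move=> [Kx _] [_ Ny]; exact: KN. Qed.

Lemma ZK x k : Z x -> K k -> commute k x.
Proof. by move=> [_ Nx] Kk; exact: KN. Qed.

(** Modulo [N] every basis element may be replaced by its component in [K]. *)
Lemma centralizing_basis : exists w' : X -> P, [/\ forall x, K (w' x),
  forall (L : topologicalGroupType) (l : X -> L), pro_C C L ->
  exists h : P -> L, [/\ continuous h,
    forall x y, f x = 1 -> h (x * y) = h x * h y,
    forall n, cns_set N n -> h n = 1 & forall x, h (w' x) = l x] &
  forall S : set P, subgroup_set S -> closed S -> N `<=` S ->
    (forall x, S (w' x)) -> forall x, f x = 1 -> S x].
Proof.
have [|w' w'P] := @choice X P (fun x k => K k /\ exists2 n, cns_set N n & w x = k * n).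
  by move=> x; have [c [n [Kc Nn E]]] := Kdecomp (fw x); exists c; split=> //; exists n.
exists w'; split.
- by move=> x; have [] := w'P x.
- move=> L l pL; have [h [hc hM hN hw]] := w_exist l pL; exists h; split=> // x.
  have [Kx [n Nn E]] := w'P x.
  by rewrite -hw E hM ?(Kf Kx) // (hN n) // mulg1.
- move=> S SS cS NS Sw; apply: w_generate => // x.
  have [_ [n Nn ->]] := w'P x; have [_ SM _] := SS.
  by apply: SM => //; exact: NS.
Qed.

(** * Retraction of the centralizer onto the centre *)

Section Basis.
Variable b : X -> P.
Hypothesis Kb : forall x, K (b x).
Hypothesis b_exist : forall (L : topologicalGroupType) (l : X -> L), pro_C C L ->
  exists h : P -> L, [/\ continuous h,
    forall x y, f x = 1 -> h (x * y) = h x * h y,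
    forall n, cns_set N n -> h n = 1 & forall x, h (b x) = l x].
Hypothesis b_generate : forall S : set P, subgroup_set S -> closed S -> N `<=` S ->
  (forall x, S (b x)) -> forall x, f x = 1 -> S x.

(** The induction principle for identities between maps that are multiplicative on the kernel of [f]
    only. *)
Lemma b_closure (S : set P) : closed S -> S 1 ->
  (forall x y, f x = 1 -> f y = 1 -> S x -> S y -> S (x * y)) ->
  (forall x, f x = 1 -> S x -> S x^-1) -> N `<=` S -> (forall x, S (b x)) ->
  forall x, f x = 1 -> S x.
Proof.
move=> cS S1 SM SV NS Sb x fx.
suff [] : (f @^-1` [set 1] `&` S) x by [].
apply: b_generate => //.
- split; first by split.
    by move=> y z [/= fy Sy] [/= fz Sz]; split; [rewrite /= fM fy fz mulg1 | exact: SM].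
  by move=> y [/= fy Sy]; split; [rewrite /= fV fy invg1 | exact: SV].
- by apply: closedI => //; have [_] := locally_constant_clopen fh.2 [set 1].
- by move=> n Nn; split; [exact: fN | exact: NS].
- by move=> y; split; [exact: Kf | exact: Sb].
Qed.

(** On the kernel of [f], this is a splitting of the projection modulo [N], with values in [K]:
    freeness allows the basis to be sent to itself in [K]. *)
Lemma section_exist : exists s : P -> P, [/\ continuous s,
  forall x y, f x = 1 -> s (x * y) = s x * s y,
  forall x, cns_set N x -> s x = 1, forall x, s (b x) = b x &
  forall x, K (s x)].
Proof.
have pK := cns_type_pro_C CC C0 centralizer pP.
have [h [hc hM hN hb]] :=
  b_exist (fun x => SigSub (mem_set (Kb x)) : cns_type centralizer) pK.
exists (@cns_val _ _ \o h); split.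
- exact: comp_continuous hc (@cns_val_continuous _ _).
- by move=> x y fx /=; rewrite hM.
- by move=> x Nx /=; rewrite hN.
- by move=> x /=; rewrite hb.
- by move=> x; exact: cns_valP.
Qed.

Section Section.
Variable s : P -> P.
Hypothesis sc : continuous s.
Hypothesis sM : forall x y, f x = 1 -> s (x * y) = s x * s y.
Hypothesis sN : forall x, cns_set N x -> s x = 1.
Hypothesis sb : forall x, s (b x) = b x.
Hypothesis sK : forall x, K (s x).

Lemma sV x : f x = 1 -> s x^-1 = (s x)^-1.
Proof.
by move=> fx; apply: (mulgI (s x)); rewrite -sM // !mulgV sN //; exact: cns1.
Qed.

Lemma s_mod x : f x = 1 -> cns_set N ((s x)^-1 * x).
Proof.
move=> fx; apply/quot_mapP; move: x fx.
apply: b_closure.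
- apply: closed_eqfun; first exact/pro_C_hausdorff/(quot_pro_C CC C0 N pP).
    exact: comp_continuous sc (@quot_map_continuous _ _).
  exact: quot_map_continuous.
- by rewrite sN //; exact: cns1.
- by move=> x y fx fy /= hx hy; rewrite sM // !quot_mapM hx hy.
- by move=> x fx /= hx; rewrite sV // !quot_mapV hx.
- by move=> x Nx; apply/quot_mapP; rewrite sN // invg1 mul1g.
- by move=> x /=; rewrite sb.
Qed.

Definition retr k := k * (s k)^-1.

Lemma retr_continuous : continuous retr.
Proof. by apply: continuousMg; [exact: continuous_id | exact: continuousVg]. Qed.

Lemma retrZ k : K k -> Z (retr k).
Proof.
move=> Kk; split; first by apply: cnsM => //; exact: cnsV.
have := cnsJ (s k)^-1 (s_mod (Kf Kk)).
by rewrite conjgE invgK /retr !mulgA mulgV mul1g.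
Qed.

Lemma retr_id z : cns_set N z -> retr z = z.
Proof. by move=> Nz; rewrite /retr sN // invg1 mulg1. Qed.

Lemma retrM k k' : K k -> K k' -> retr (k * k') = retr k * retr k'.
Proof.
move=> Kk Kk'; transitivity (retr k' * retr k); last first.
  exact: ZZ (retrZ Kk') (retrZ Kk).
have -> : retr (k * k') = k * retr k' * (s k)^-1.
  by rewrite /retr sM ?(Kf Kk) // invgM !mulgA.
by rewrite (ZK (retrZ Kk') Kk) -mulgA.
Qed.

Lemma retr1 : retr 1 = 1. Proof. exact/retr_id/cns1. Qed.

Lemma retrV k : K k -> retr k^-1 = (retr k)^-1.
Proof.
move=> Kk; apply: (mulgI (retr k)).
by rewrite -retrM ?mulgV ?retr1 //; exact: cnsV.
Qed.

Lemma KX k n : K k -> K (k ^+ n).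
Proof.
move=> Kk; elim: n => [|n IH]; first by rewrite expg0; exact: cns1.
by rewrite expgS; exact: cnsM.
Qed.

Lemma retrX k n : K k -> retr (k ^+ n) = retr k ^+ n.
Proof.
move=> Kk; elim: n => [|n IH]; first by rewrite !expg0 retr1.
by rewrite !expgS retrM ?IH //; exact: KX.
Qed.

(** Write [u = c * n] with [c] in [K] and [n] in [N]. Then [n] acts trivially on [K], and
    conjugation by [c] disappears in the abelian group [Z], which [u] centralizes. *)
Lemma retrJ u k : f u = 1 -> K k -> retr (k ^ u) = retr k ^ u.
Proof.
move=> fu Kk; have [c [n [Kc Nn ->]]] := Kdecomp fu.
have conjn y m : K y -> cns_set N m -> y ^ m = y.
  by move=> Ky Nm; rewrite conjgE (KN Ky Nm) mulKg.
have Zr := retrZ Kk.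
have -> : retr k ^ (c * n) = retr k.
  rewrite conjgM [retr k ^ c]conjgE -(ZK Zr Kc) mulKg.
  by apply: conjn => //; have [] := Zr.
rewrite conjgM conjn //; last exact: cnsJ.
have KV := cnsV Kc.
rewrite conjgE !retrM ?retrV //; last exact: cnsM.
by rewrite (ZZ Zr (retrZ Kc)) mulKg.
Qed.

Definition retr_conj g k := retr (k ^ g) ^ g^-1.

(** This allows the conjugates of the retraction to be indexed by [Q]. *)
Lemma retr_conj_eq g g' k : f g = f g' -> K k -> retr_conj g k = retr_conj g' k.
Proof.
move=> E Kk; rewrite /retr_conj -{2}(mulVKg g g') invgM conjgM.
have fu : f (g^-1 * g') = 1 by rewrite fM fV E mulVg.
have -> : k ^ g' = (k ^ g) ^ (g^-1 * g') by rewrite -conjgM mulVKg.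
by rewrite (retrJ fu (cnsJ g Kk)) conjgK.
Qed.

Lemma retr_conjZ g k : K k -> Z (retr_conj g k).
Proof. by move=> Kk; apply/cnsJ/retrZ/cnsJ. Qed.

Lemma retr_conjM g k k' : K k -> K k' ->
  retr_conj g (k * k') = retr_conj g k * retr_conj g k'.
Proof.
move=> Kk Kk'; rewrite /retr_conj (conjMg k) (retrM (cnsJ g Kk) (cnsJ g Kk')).
exact: conjMg.
Qed.

(** * The equivariant norm *)

Definition lift (q : Q) : P := projT1 (cid (fs q)).

Lemma liftK q : f (lift q) = q. Proof. exact: projT2 (cid (fs q)). Qed.

Definition norm k : P := \prod_(q <- enum Q) retr_conj (lift q) k.

Lemma norm_continuous : continuous norm.
Proof.
apply: continuous_prodg => q.
exact: comp_continuous (comp_continuous (continuous_conj (a := lift q)) retr_continuous)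
  (continuous_conj (a := (lift q)^-1)).
Qed.

Lemma norm_seqZ (l : seq Q) k : K k -> Z (\prod_(q <- l) retr_conj (lift q) k).
Proof.
move=> Kk; elim: l => [|q l IH]; first by rewrite big_nil; exact: cns1.
by rewrite big_cons; apply: cnsM => //; exact: retr_conjZ.
Qed.

Lemma normZ k : K k -> Z (norm k). Proof. exact: norm_seqZ. Qed.

Lemma normM k k' : K k -> K k' -> norm (k * k') = norm k * norm k'.
Proof.
move=> Kk Kk'; rewrite /norm; elim: (enum Q) => [|q l IH].
  by rewrite !big_nil mulg1.
rewrite !big_cons IH retr_conjM //; apply: mulgACA_commute.
exact: ZZ (retr_conjZ _ Kk') (norm_seqZ l Kk).
Qed.

Lemma norm1 : norm 1 = 1.
Proof.
rewrite /norm big1 // => q _; rewrite /retr_conj.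
by rewrite !(conj1g, retr1).
Qed.

Lemma norm_id z : Z z -> norm z = z ^+ #|Q|.
Proof.
move=> Zz; rewrite /norm cardE; elim: (enum Q) => [|q l IH]; first by rewrite big_nil.
rewrite big_cons IH expgS; congr (_ * _); rewrite /retr_conj retr_id ?conjgK //.
by apply: cnsJ; have [] := Zz.
Qed.

(** Conjugation by [g] permutes the factors through left multiplication by [f g] on [Q]. *)
Lemma normJ g k : K k -> norm (k ^ g) = norm k ^ g.
Proof.
move=> Kk; have E q : retr_conj (lift q) (k ^ g) = retr_conj (lift (f g * q)) k ^ g.
  have -> : retr_conj (lift (f g * q)) k = retr_conj (g * lift q) k.
    by apply: retr_conj_eq; rewrite // fM !liftK.
  by rewrite /retr_conj (conjgM k g) invgM (conjgM _ (lift q)^-1) conjgKV.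
rewrite /norm (eq_bigr _ (fun q _ => E q)) -conjg_prod; congr (_ ^ g).
rewrite -(big_map (fun q => f g * q) xpredT (fun q => retr_conj (lift q) k)).
apply: prod_perm; first by move=> q q'; apply: ZZ; exact: retr_conjZ.
have gI : injective (fun q => f g * q) by move=> q q' /mulgI.
apply: uniq_perm; first by rewrite map_inj_uniq ?enum_uniq.
  exact: enum_uniq.
move=> q; rewrite [RHS]mem_enum; apply/mapP; exists ((f g)^-1 * q); first exact: mem_enum.
by rewrite mulVKg.
Qed.

Local Notation Zt := (cns_type centre).

(** The norm read on [U/N] through the section [s]; it is this map that is to be divided by [n]. *)
Definition normt (x : P) : Zt := SigSub (mem_set (normZ (sK x))).

Lemma normtE x : cns_val (normt x) = norm (s x). Proof. by []. Qed.

Lemma normt_continuous : continuous normt.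
Proof. by apply: cns_continuous; exact: comp_continuous sc norm_continuous. Qed.

Lemma ZtC (x y : Zt) : commute x y.
Proof. by apply: cns_val_inj; apply: ZZ; exact: cns_valP. Qed.

Let m := #|Q|.-1.
Let mE : m.+1 = #|Q|.
Proof. by rewrite prednK //; apply/card_gt0P; exists 1. Qed.

Local Notation W := (wreath Zt (coords X m)).

Let pW : pro_C C W.
Proof.
apply: wreath_pro_C => //; first exact: cns_type_pro_C.
exact: (class_coords CC C0 X CQ).
Qed.

Lemma tau_exist : exists tau : P -> W, [/\ continuous tau,
  forall x y, f x = 1 -> tau (x * y) = tau x * tau y,
  forall x, cns_set N x -> tau x = 1 &
  forall x, tau (b x) = root_elt (fun x => normt (b x)) m x].
Proof. exact: b_exist. Qed.

(** * Division of the norm *)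

Section Tau.
Variable tau : P -> W.
Hypothesis tc : continuous tau.
Hypothesis tM : forall x y, f x = 1 -> tau (x * y) = tau x * tau y.
Hypothesis tN : forall x, cns_set N x -> tau x = 1.
Hypothesis tb : forall x, tau (b x) = root_elt (fun x => normt (b x)) m x.

Lemma tV x : f x = 1 -> tau x^-1 = (tau x)^-1.
Proof.
by move=> fx; apply: (mulgI (tau x)); rewrite -tM // !mulgV tN //; exact: cns1.
Qed.

Lemma tX x n : f x = 1 -> tau (x ^+ n) = tau x ^+ n.
Proof.
move=> fx; elim: n => [|n IH]; first by rewrite !expg0 tN //; exact: cns1.
by rewrite !expgS tM // IH.
Qed.

Let hW : hausdorff_space W. Proof. exact: pro_C_hausdorff pW. Qed.

Lemma tau_commute_closure (c : W) : (forall x, commute (tau (b x)) c) ->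
  forall x, f x = 1 -> commute (tau x) c.
Proof.
move=> bc; apply: b_closure.
- apply: closed_eqfun => //.
    exact: comp_continuous tc (continuous_mulr (a := c)).
  exact: comp_continuous tc (continuous_mull (a := c)).
- by rewrite tN; [exact/commute_sym/commute1 | exact: cns1].
- move=> x y fx fy hx hy; rewrite tM //.
  by apply/commute_sym/commuteM; apply/commute_sym.
- by move=> x fx hx; rewrite tV //; apply/commute_sym/commuteV/commute_sym.
- by move=> x Nx; rewrite tN //; exact/commute_sym/commute1.
- exact: bc.
Qed.

(** The closure argument is applied in each variable in turn, starting from the commuting roots. *)
Lemma tau_commute x y : f x = 1 -> f y = 1 -> commute (tau x) (tau y).
Proof.
move=> fx fy; apply: tau_commute_closure => // z.
apply/commute_sym; apply: tau_commute_closure => // z'.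
rewrite !tb; apply: root_elt_commute; exact: ZtC.
Qed.

Definition diag (z : Zt) : W := Wreath (fun=> z) 1.

Lemma diag_continuous : continuous diag.
Proof.
apply: wreath_continuous => [a|q]; first exact: continuous_id.
have [->|nq] := eqVneq q 1.
  by rewrite (_ : [set z | _] = setT); [exact: openT | apply/seteqP; split].
rewrite (_ : [set z | _] = set0); first exact: open0.
by apply/seteqP; split=> // z /= E; rewrite -E eqxx in nq.
Qed.

Lemma diagM x y : diag (x * y) = diag x * diag y.
Proof. by apply: wreath_eq => // ; rewrite /wtop /= mulg1. Qed.

Lemma normtM x y : f x = 1 -> normt (x * y) = normt x * normt y.
Proof.
by move=> fx; apply: cns_val_inj; rewrite cns_valM !normtE sM // normM.
Qed.

(** By [tau_commute] the left side is multiplicative on the kernel of [f], so it is enough to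
    compare the two sides on the basis. *)
Lemma tau_pow x : f x = 1 -> tau x ^+ #|Q| = diag (normt x).
Proof.
move: x; have diag1 : diag 1 = 1 by apply: (mulgI (diag 1)); rewrite -diagM !mulg1.
have normtN x : cns_set N x -> normt x = 1.
  by move=> Nx; apply: cns_val_inj; rewrite normtE sN // norm1.
apply: b_closure.
- apply: closed_eqfun => //; first exact: continuousXg.
  exact: comp_continuous normt_continuous diag_continuous.
- by rewrite normtN ?tN ?expg1n ?diag1 //; exact: cns1.
- move=> x y fx fy /= hx hy; rewrite tM // expgMn ?hx ?hy; last exact: tau_commute.
  by rewrite normtM // diagM.
- move=> x fx /= hx; rewrite tV // expVgn hx; apply: (mulgI (diag (normt x))).
  by rewrite mulgV -diagM -normtM // mulgV normtN //; exact: cns1.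
- by move=> x Nx; rewrite /= tN // normtN // expg1n diag1.
- by move=> x; rewrite /= tb -mE root_elt_pow.
Qed.

(** [twisted z k] says that [diag (retr k) * tau k = diag z]. *)
Definition twist a k : P := retr k * cns_val (wfun (tau k) a).
Definition twisted (z k : P) := wtop (tau k) = 1 /\ forall a, twist a k = z.

Lemma twist_continuous a : continuous (twist a).
Proof.
apply: continuousMg; first exact: retr_continuous.
exact: comp_continuous (comp_continuous tc (wfun_continuous (a := a)))
  (@cns_val_continuous _ _).
Qed.

Lemma twistedM z z' k k' : K k -> K k' -> twisted z k -> twisted z' k' ->
  twisted (z * z') (k * k').
Proof.
move=> Kk Kk' [tk ek] [tk' ek']; rewrite /twisted /twist tM ?(Kf Kk) //.
split=> [|a]; first by rewrite wtopM tk tk' mulg1.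
rewrite wfunM tk mulg1 retrM // -(ek a) -(ek' a) cns_valM.
apply: mulgACA_commute; apply: ZZ; [exact: retrZ | exact: cns_valP].
Qed.

Lemma twistedZ z : Z z -> twisted z z.
Proof.
by move=> [_ Nz]; split=> [|a]; rewrite /twist tN // retr_id // mulg1.
Qed.

Lemma twistedV z k : K k -> Z z -> twisted z k -> twisted z^-1 k^-1.
Proof.
move=> Kk Zz [tk ek]; rewrite /twisted /twist tV ?(Kf Kk) // retrV //.
have tki : wtop (tau k)^-1 = 1 by rewrite /wtop /= -/(wtop (tau k)) tk invg1.
split=> // a; rewrite -(ek a) /twist (invgM (retr k)).
rewrite {1}/wfun /= -/(wfun (tau k)) -/(wtop (tau k)) tk invg1 mulg1 cns_valV.
have Zc := cns_valP (wfun (tau k) a).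
exact: (commuteV (commute_sym (commuteV (ZZ Zc (retrZ Kk))))).
Qed.

(** The two parts are [retr y ^+ n], which is the norm of [retr y], and the norm of [s y]; their
    product is the norm of [y = retr y * s y]. *)
Lemma twisted_pow y : K y -> twisted (norm y) (y ^+ #|Q|).
Proof.
move=> Ky; rewrite /twisted /twist tX ?(Kf Ky) // tau_pow ?(Kf Ky) //.
split=> // a; rewrite /diag /wfun /= normtE retrX //.
have -> : norm y = norm (retr y) * norm (s y).
  by rewrite -normM ?mulgVK //; have [] := retrZ Ky.
by rewrite (norm_id (retrZ Ky)).
Qed.

Lemma twisted_comm y y' : K y -> K y' -> twisted 1 [~ y, y'].
Proof.
move=> Ky Ky'; have KV := cnsV Ky; have KV' := cnsV Ky'.
rewrite commgEl conjgE /twisted /twist.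
rewrite !tM ?(Kf KV) ?(Kf KV') ?(Kf Ky) // !tV ?(Kf Ky) ?(Kf Ky') //.
rewrite !retrM ?retrV //; try by do ?apply: cnsM.
rewrite (ZZ (retrZ Ky) (retrZ Ky')) mulKg mulVg.
by rewrite (tau_commute (Kf Ky) (Kf Ky')) mulKg mulVg; split=> // a; rewrite mulg1.
Qed.

(** The core in [P] of the kernel of the divided map: [tau] depends on the basis, so the kernel
    itself need not be normal. *)
Definition complement : closedNormalSubgroup P.
Proof.
exists [set k | K k /\ forall g, twisted 1 (k ^ g)].
- rewrite (_ : [set k | _] = K `&` \bigcap_(g in [set: P])
     ([set k | wtop (tau (k ^ g)) = 1] `&` \bigcap_(a in [set: coords X m]) [set k | twist a (k ^ g) = 1])).
    apply: closedI; first exact: cns_closed.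
    apply: closed_bigI => g _.
    have cg := continuous_conj (a := g).
    apply: closedI.
      have o1 q : open [set k | wtop (tau (k ^ g)) = q].
        have /continuousP := comp_continuous cg tc.
        by move=> /(_ _ (wtop_open (q := q))).
      by have [_] := locally_constant_clopen o1 [set 1].
    apply: closed_bigI => a _.
    apply: (closed_eqfun hP _ (@continuous_cst _ _ 1)).
    exact: comp_continuous cg (twist_continuous (a := a)).
  apply/seteqP; split=> k /= [Kk h]; split=> // g.
    by move=> _; have [h1 h2] := h g; split=> // a _; exact: h2.
  by have [h1 h2] := h g I; split=> // a; exact: h2.
- split; first exact: cns1.
  by move=> g; rewrite conj1g; apply/twistedZ/cns1.
- move=> x y [Kx hx] [Ky hy]; split; first exact: cnsM.
  move=> g; rewrite conjMg -[1]mulg1; apply: twistedM => //; exact: cnsJ.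
- move=> x [Kx hx]; split; first exact: cnsV.
  move=> g; rewrite conjVg -[1]invg1; apply: twistedV => //; first exact: cnsJ.
  exact: cns1.
- move=> g x [Kx hx]; split; first exact: cnsJ.
  by move=> h; rewrite -conjgM.
Defined.

Local Notation M := (cns_set complement).

Lemma complementK k : M k -> K k. Proof. by case. Qed.

Lemma complement_disjoint x : M x -> cns_set N x -> x = 1.
Proof.
move=> [Kx h] Nx; have [_ /(_ 1)] := h 1.
by rewrite conjg1 /twist retr_id // tN // mulg1.
Qed.

(** * Finite index of the product with the complement *)

Definition prodNM : set P := [set x * y | x in N & y in M].

Lemma prodNM_closed : closed prodNM.
Proof. by apply: closed_mulset => //; exact: cns_closed. Qed.

Lemma prodNM_subgroup : subgroup_set prodNM.
Proof.
split.
- by exists 1; [exact: cns1 | exists 1; [exact: cns1 | rewrite mulg1]].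
- move=> _ _ [n Nn [k Mk <-]] [n' Nn' [k' Mk' <-]].
  exists (n * n'); first exact: cnsM.
  exists (k * k'); first exact: cnsM.
  rewrite -!mulgA; congr (_ * _); rewrite !mulgA; congr (_ * _).
  exact/commute_sym/(KN (complementK Mk) Nn').
- move=> _ [n Nn [k Mk <-]]; exists n^-1; first exact: cnsV.
  exists k^-1; first exact: cnsV.
  rewrite -invgM; congr (_^-1); exact: KN (complementK Mk) Nn.
Qed.

Lemma prodNMJ g x : prodNM x -> prodNM (x ^ g).
Proof.
move=> [n Nn [k Mk <-]]; exists (n ^ g); first exact: cnsJ.
by exists (k ^ g); [exact: cnsJ | rewrite conjMg].
Qed.

(** Under this hypothesis [z^-1 * k] and all its conjugates are in the kernel of the divided map. *)
Lemma prodNM_twisted z k : Z z -> K k -> (forall g, twisted (z ^ g) (k ^ g)) -> prodNM k.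
Proof.
move=> Zz Kk h; have ZV := cnsV Zz.
exists z; first by have [] := Zz.
exists (z^-1 * k); last by rewrite mulVKg.
split; first by apply: cnsM => //; have [] := ZV.
move=> g; rewrite conjMg (_ : 1 = z^-1 ^ g * z ^ g); last by rewrite -conjMg mulVg conj1g.
apply: twistedM => //; [by have [] := cnsJ g ZV | exact: cnsJ | exact/twistedZ/cnsJ].
Qed.

Lemma prodNM_pow y : K y -> prodNM (y ^+ #|Q|).
Proof.
move=> Ky; apply: (prodNM_twisted (normZ Ky)); first exact: KX.
by move=> g; rewrite conjXg -normJ //; apply/twisted_pow/cnsJ.
Qed.

Lemma prodNM_comm y y' : K y -> K y' -> prodNM [~ y, y'].
Proof.
move=> Ky Ky'; apply: (prodNM_twisted (z := 1)); first exact: cns1.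
  by rewrite commgEl; apply: cnsM; [exact: cnsV | exact: cnsJ].
by move=> g; rewrite conj1g conjRg; apply: twisted_comm; exact: cnsJ.
Qed.

Lemma prodNM_f x : prodNM x -> f x = 1.
Proof. by move=> [n Nn [k Mk <-]]; rewrite fM fN // (Kf (complementK Mk)) mulg1. Qed.

(** Since [u] acts on [K] through its component in [K], the commutator of [y] and [u] is one of two
    elements of [K]. *)
Lemma prodNM_swap y u : K y -> f u = 1 -> exists2 l, prodNM l & y * u = u * (l * y).
Proof.
move=> Ky fu; have [c [n [Kc Nn E]]] := Kdecomp fu.
have yu : y ^ u = y * [~ y, c].
  rewrite E conjgM [(y ^ c) ^ n]conjgE (KN (cnsJ c Ky) Nn) mulKg.
  by rewrite commgEl mulVKg.
exists ([~ y, c] ^ y^-1); first exact/prodNMJ/prodNM_comm.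
by rewrite conjgC yu conjgE invgK !mulgA mulgVK.
Qed.

(** Nonnegative exponents are enough, because [y ^+ #|Q|] will lie in [S]. *)
Definition adjoin (S : set P) (y : P) : set P := [set u | exists s i, S s /\ u = s * y ^+ i].

Section Adjoin.
Variables (S : set P) (y : P).
Hypothesis SS : subgroup_set S.
Hypothesis BS : prodNM `<=` S.
Hypothesis Sf : forall x, S x -> f x = 1.
Hypothesis Ky : K y.

Let Sn i : S ((y ^+ #|Q|) ^+ i).
Proof.
have [S1 SM _] := SS; elim: i => [|i IH]; first by rewrite expg0.
by rewrite expgS; apply: SM => //; apply/BS/prodNM_pow.
Qed.

Lemma adjoin_swap i u : S u -> exists2 u', S u' & y ^+ i * u = u' * y ^+ i.
Proof.
have [S1 SM _] := SS; move=> Su; elim: i => [|i [u' Su' IH]].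
  by exists u => //; rewrite expg0 mul1g mulg1.
have [l Bl E] := prodNM_swap Ky (Sf Su').
exists (u' * l); first by apply: SM => //; exact: BS.
by rewrite expgS -mulgA IH mulgA E !mulgA.
Qed.

Lemma adjoin_subgroup : subgroup_set (adjoin S y).
Proof.
have [S1 SM SV] := SS.
have eM x x' : adjoin S y x -> adjoin S y x' -> adjoin S y (x * x').
  move=> [u [i [Su ->]]] [u' [j [Su' ->]]].
  have [u'' Su'' E] := adjoin_swap i Su'.
  exists (u * u''), (i + j)%N; split; first exact: SM.
  by rewrite expgnDr -!mulgA; congr (_ * _); rewrite !mulgA E.
split=> //; first by exists 1, 0%N; rewrite expg0 mulg1.
move=> x [u [i [Su ->]]]; rewrite invgM; apply: eM; last first.
  by exists u^-1, 0%N; rewrite expg0 mulg1; split=> //; exact: SV.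
(* With [n = m.+1], the inverse of [y ^+ i] is the inverse of [y ^+ (n * i)] times
   [y ^+ (m * i)]. *)
exists ((y ^+ #|Q|) ^+ i)^-1, (m * i)%N; split; first exact/SV/Sn.
apply: (mulgI ((y ^+ #|Q|) ^+ i)); rewrite mulVKg -mE -expgnA mulSn addnC.
by rewrite expgnDr mulgK.
Qed.

Lemma adjoinE : adjoin S y = [set g | exists2 a, a \in [seq y ^+ i | i <- iota 0 #|Q|] &
  exists2 s, S s & g = s * a].
Proof.
have [S1 SM SV] := SS.
apply/seteqP; split=> x; last first.
  by move=> [_ /mapP[i _ ->] [u Su ->]]; exists u, i.
move=> [u [i [Su ->]]]; exists (y ^+ (i %% #|Q|)).
  by apply: map_f; rewrite mem_iota add0n ltn_mod -mE.
exists (u * (y ^+ #|Q|) ^+ (i %/ #|Q|)); first exact: SM.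
by rewrite -mulgA -expgnA -expgnDr mulnC -divn_eq.
Qed.

End Adjoin.

(** The basis elements are adjoined one at a time. Each step adds at most [#|Q|] cosets and keeps
    the subgroup closed, so the last subgroup contains the whole kernel of [f] by [b_generate]. *)
Lemma prodNM_finite_index : exists l : seq P, forall u, f u = 1 ->
  exists2 a, a \in l & exists2 s, prodNM s & u = s * a.
Proof.
have grow (xs : seq X) : exists S, [/\ [/\ subgroup_set S, closed S, prodNM `<=` S &
      forall x, S x -> f x = 1], forall x, x \in xs -> S (b x) &
    exists l : seq P, forall u, S u -> exists2 a, a \in l & exists2 s, prodNM s & u = s * a].
  elim: xs => [|x xs [S [[SS cS BS Sf] Sxs [l Sl]]]].
    exists prodNM; split=> //.
      by split; [exact: prodNM_subgroup | exact: prodNM_closed | | exact: prodNM_f].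
    by exists [:: 1] => u Bu; exists 1; [rewrite mem_head | exists u; rewrite ?mulg1].
  have [S1 SM SV] := SS.
  have Kx := Kb x; have Se u : S u -> adjoin S (b x) u.
    by move=> Su; exists u, 0%N; rewrite expg0 mulg1.
  exists (adjoin S (b x)); split.
  - split.
    + exact: adjoin_subgroup.
    + by rewrite adjoinE //; exact: closed_finite_cosets.
    + by move=> u /BS/Se.
    + by move=> _ [u [i [Su ->]]]; rewrite fM Sf // (Kf (KX i Kx)) mulg1.
  - move=> z; rewrite inE => /predU1P[->|/Sxs/Se //].
    by exists 1, 1%N; rewrite expg1 mul1g.
  - exists [seq a * c | a <- l, c <- [seq b x ^+ i | i <- iota 0 #|Q|]] => u.
    rewrite adjoinE // => -[c cl [v /Sl[a al [t Bt ->]] ->]].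
    by exists (a * c); [exact: allpairs_f | exists t; rewrite ?mulgA].
have [S [[SS cS BS Sf] Sx [l Sl]]] := grow (enum X).
exists l => u fu; apply: Sl; apply: b_generate fu => //.
- move=> n Nn; apply: BS; exists n => //; exists 1; [exact: cns1 | exact: mulg1].
- by move=> x; apply: Sx; rewrite mem_enum.
Qed.

Lemma prodNM_open : open prodNM.
Proof.
have [l lP] := prodNM_finite_index.
apply: (finite_index_open (W := f @^-1` [set 1]) (l := l) prodNM_closed).
- exact: fh.2.
- exact: prodNM_subgroup.
- by move=> x /prodNM_f.
- exact: lP.
Qed.

End Tau.
End Section.
End Basis.

Lemma complement_exist : exists M : closedNormalSubgroup P,
  [/\ forall x, cns_set M x -> cns_set N x -> x = 1,
      forall x, cns_set M x -> f x = 1 &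
      open [set x * y | x in cns_set N & y in cns_set M]].
Proof.
have [b [Kb be bg]] := centralizing_basis.
have [s [sc sM sN sb sK]] := section_exist Kb be.
have [tau [tc tM tN tb]] := tau_exist Kb be bg sc sM sN sb sK.
exists (complement Kb bg sc sM sN sb sK tc tM tN); split.
- move=> x; exact: complement_disjoint.
- by move=> x /complementK/Kf.
- exact: prodNM_open.
Qed.

End Complement.

(** * Virtual splitting *)

Lemma open_setX_prod (S T : topologicalType) (A : set S) (B : set T) :
  open A -> open B -> open (A `*` B).
Proof.
move=> oA oB; rewrite (_ : A `*` B = fst @^-1` A `&` snd @^-1` B); last by [].
apply: openI.
  by move/continuousP: (@fst_continuous S T) => /(_ _ oA).
by move/continuousP: (@snd_continuous S T) => /(_ _ oB).
Qed.

Section Join.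
Variable C : groupClass.
Variable P : topologicalGroupType.
Hypothesis pP : pro_C C P.
Variables N M : closedNormalSubgroup P.

Definition cns_join : closedNormalSubgroup P.
Proof.
exists [set x * y | x in cns_set N & y in cns_set M].
- apply: closed_mulset; [exact: pro_C_compact pP | exact: pro_C_hausdorff pP | |];
  exact: cns_closed.
- by exists 1; [exact: cns1 | exists 1; [exact: cns1 | rewrite mulg1]].
- move=> _ _ [n Nn [k Mk <-]] [n' Nn' [k' Mk' <-]].
  exists (n * n'); first exact: cnsM.
  exists (k ^ n' * k'); first by apply: cnsM => //; exact: cnsJ.
  by rewrite conjgE -!mulgA mulKVg.
- move=> _ [n Nn [k Mk <-]]; exists n^-1; first exact: cnsV.
  exists (k^-1 ^ n^-1); first exact/cnsJ/cnsV.
  by rewrite conjgE invgK invgM !mulgA mulVg mul1g.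
- move=> g _ [n Nn [k Mk <-]]; exists (n ^ g); first exact: cnsJ.
  by exists (k ^ g); [exact: cnsJ | rewrite conjMg].
Defined.

Lemma cns_joinl x : cns_set N x -> cns_set cns_join x.
Proof. by move=> Nx; exists x => //; exists 1; [exact: cns1 | rewrite mulg1]. Qed.

Lemma cns_joinr x : cns_set M x -> cns_set cns_join x.
Proof. by move=> Mx; exists 1; [exact: cns1 | exists x => //; rewrite mul1g]. Qed.

Lemma embed_quotients : open (cns_set cns_join) ->
  (forall x, cns_set M x -> cns_set N x -> x = 1) ->
  embeds_as_open P (quot M * quot N)%type.
Proof.
move=> oJ MN1; pose e x := (quot_map M x, quot_map N x).
have eM : {morph e : x y / x * y} by move=> x y; rewrite /e !quot_mapM.
exists e; split.
- split=> //; apply: pair_continuous; exact: quot_map_continuous.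
- move=> x y [/quot_mapP Mxy /quot_mapP Nxy].
  by rewrite -[y](mulVKg x) (MN1 _ Mxy Nxy) mulg1.
apply: (open_subgroup (U := (quot_map M @` cns_join) `*` (quot_map N @` cns_join))).
- split.
  + by exists 1 => //; exact: morphism1.
  + by move=> _ _ [x _ <-] [y _ <-]; exists (x * y).
  + by move=> _ [x _ <-]; exists x^-1 => //; exact: morphismV.
- by apply: open_setX_prod; exact: quot_map_open.
- by exists (e 1); split; exists 1 => //; exact: cns1.
- move=> [p q] /= [[_ [n Nn [m Mm <-]] <-] [_ [n' Nn' [m' Mm' <-]] <-]].
  (* Modulo [M] only the component in [N] counts, and modulo [N] only the one in [M], so the two can
     be prescribed independently. *)
  exists (n * m') => //; rewrite /e !quot_mapM.
  by rewrite (quot_map1 M m').2 // (quot_map1 M m).2 // (quot_map1 N n).2 //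
    (quot_map1 N n').2.
Qed.

End Join.

Lemma open_subgroup_reps (C : groupClass) (G : topologicalGroupType) (S : set G) :
  closed_class C -> (exists (gT : finGroupType) (H : {group gT}), C gT H) ->
  pro_C C G -> subgroup_set S -> open S ->
  exists l : seq G, forall g, exists2 a, a \in l & S (g * a^-1).
Proof.
move=> CC C0 pG [S1 _ _] oS.
have [V [A [f [CA [fM _] fs fV]]] VS] :=
  fin_kernel_basis CC C0 (pro_C_compact pG) (pro_C_residual pG) oS S1.
exists [seq projT1 (cid (fs a)) | a <- enum A] => g.
exists (projT1 (cid (fs (f g)))); first by apply: map_f; rewrite mem_enum.
apply/VS/fV; rewrite fM (morphismV fM).
by rewrite (projT2 (cid (fs (f g)))) mulgV.
Qed.

Lemma cns_valJ (G : topologicalGroupType) (N : closedNormalSubgroup G)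
  (x y : cns_type N) : cns_val (x ^ y) = cns_val x ^ cns_val y.
Proof. by rewrite !conjgE !cns_valM cns_valV. Qed.

(** * Elements acting by inner automorphisms *)

Section Inner.
Variable C : groupClass.
Hypothesis CC : closed_class C.
Variable P : topologicalGroupType.
Hypothesis pP : pro_C C P.
Variable N : closedNormalSubgroup P.

Definition inner_set : set P :=
  [set g | exists2 n, cns_set N n & forall x, cns_set N x -> x ^ g = x ^ n].

Let centralizing : set P := [set k | forall x, cns_set N x -> k * x = x * k].

(** In this form the set is visibly closed, being a product of two closed sets in a compact
    group. *)
Lemma inner_setE : inner_set = [set c * n | c in centralizing & n in cns_set N].
Proof.
apply/seteqP; split=> g.
  move=> [n Nn gn]; exists (g * n^-1); last by exists n; rewrite ?mulgVK.
  move=> x Nx; rewrite [RHS]conjgC; congr (_ * _).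
  by rewrite conjgM gn // -conjgM mulgV conjg1.
move=> [c cc [n Nn <-]]; exists n => // x Nx; rewrite conjgM; congr (_ ^ _).
by rewrite conjgE -cc // mulKg.
Qed.

Lemma inner_set_closed : closed inner_set.
Proof.
have hP := pro_C_hausdorff pP.
rewrite inner_setE; apply: closed_mulset => //.
- exact: pro_C_compact pP.
- rewrite (_ : centralizing = \bigcap_(x in cns_set N) [set k | k * x = x * k]) //.
  apply: closed_bigI => x _; apply: closed_eqfun hP _ _.
    exact: continuous_mulr.
  exact: continuous_mull.
- exact: cns_closed.
Qed.

Lemma inner_set_subgroup : subgroup_set inner_set.
Proof.
split.
- by exists 1 => //; exact: cns1.
- move=> g g' [n Nn gn] [n' Nn' gn']; exists (n * n'); first exact: cnsM.
  by move=> x Nx; rewrite !conjgM gn // gn' //; exact: cnsJ.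
- move=> g [n Nn gn]; exists n^-1; first exact: cnsV.
  move=> x Nx; apply: (@conjg_inj _ g); rewrite conjgKV gn; last exact: cnsJ.
  by rewrite conjgKV.
Qed.

Lemma inner_set_open : finite_set (image_in_Out N) -> open inner_set.
Proof.
move=> /finite_seqP[l0 lE].
pose rep c := xget 1 [set g | outer_class (Defs.conj_aut (N := N) g) = c].
apply: (finite_index_open (W := setT) (l := [seq rep c | c <- l0])).
- exact: inner_set_closed.
- exact: openT.
- exact: inner_set_subgroup.
- by [].
move=> h _; pose c := outer_class (Defs.conj_aut (N := N) h).
have cl : c \in l0.
  have : image_in_Out N c by exists h.
  by rewrite lE.
exists (rep c); first exact: map_f.
exists (h * (rep c)^-1); last by rewrite mulgVK.
have rc : outer_class (Defs.conj_aut (N := N) (rep c)) = c.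
  by apply: (@xgetPex _ 1 [set g | outer_class (Defs.conj_aut (N := N) g) = c]); exists h.
(* The actions of [h] and [rep c] differ by an inner automorphism [k] of [N]. Evaluation at [y ^ h]
   shows that [h * (rep c)^-1] acts as [k]. *)
have : outer_class (Defs.conj_aut (N := N) h) (Defs.conj_aut (rep c)).
  suff h0 : outer_class (Defs.conj_aut (N := N) (rep c)) (Defs.conj_aut (rep c)).
    by rewrite rc in h0.
  by exists 1 => //; apply/funext => x; rewrite conjg1.
move=> [k _ kE]; exists (cns_val k); first exact: cns_valP.
move=> y Ny; pose x : cns_type N := SigSub (mem_set (cnsJ h Ny)).
have := congr1 (fun F => cns_val (F x)) kE => /=.
rewrite cns_valJ !Defs.conj_autE; have -> : cns_val x = y ^ h by [].
by rewrite conjgK -conjgM.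
Qed.

End Inner.

(** * Tame graphs of groups *)

Section Tame.
Variables (C : groupClass) (Gamma : graph) (GG : graphOfGroups C Gamma).
Variables (T : {set graph_elt Gamma}) (D : freeData GG).
Hypothesis CC : closed_class C.
Hypothesis C0 : exists (gT : finGroupType) (G : {group gT}), C G.
Hypothesis cG : connected_graph Gamma.
Hypothesis mT : maximal_subtree T.
Variable root : vertex Gamma.

Local Notation Pi := (Pi1 D T).
Local Notation vm v := (@vertex_map C Gamma GG D T v).

Variable N : closedNormalSubgroup Pi.
Hypothesis Nv : forall v, N `<=` range (vm v).
Hypothesis oN : forall v, open (vm v @^-1` N).

Let pP : pro_C C Pi. Proof. exact: Pi1_pro_C. Qed.

Lemma vertex_map1 v : vm v 1 = 1.
Proof. exact: morphism1 (@vertex_mapM _ _ _ T D v). Qed.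

(** For each [v] the complement is the image of the vertex group deprived of [N], which is compact
    because [N] is open in the vertex group. *)
Lemma vertex_group_open : open [set x : Pi | forall v, ~ range (vm v) x \/ cns_set N x].
Proof.
apply: (open_forall (P := fun v => [set x | ~ range (vm v) x \/ cns_set N x])) => v.
rewrite (_ : [set x | _] = ~` (vm v @` (~` (vm v @^-1` N)))).
  apply: closed_openC; apply: compact_closed; first exact: pro_C_hausdorff pP.
  apply: continuous_compact.
    by apply: continuous_subspaceT; exact: vertex_map_continuous.
  apply: closed_compact; last exact/open_closedC/oN.
  exact: pro_C_compact (vgroup_pro_C GG v).
apply/seteqP; split=> x.
  by move=> [nr|Nx] [h nh hx]; [apply: nr; exists h | apply: nh; rewrite /= hx].
move=> nx; have [Nx|nNx] := pselect (cns_set N x); first by right.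
by left=> -[h _ hx]; apply: nx; exists h => //=; rewrite hx.
Qed.

(** An element of the kernel is [n * u] with [u] in the set of [vertex_group_open]. If it lies in a
    vertex group then so does [u], as the vertex group contains [N]; hence [u] is in [N]. *)
Lemma kernel_meets_vertices (U : set Pi) : open U -> U 1 ->
  exists (Q : finGroupType) (f : Pi -> Q), [/\ C [set: Q]%G,
    [/\ fin_hom f, (forall q, exists x, f x = q) & forall x, cns_set N x -> f x = 1],
    (forall v h, f (vm v h) = 1 -> cns_set N (vm v h)) &
    forall x, f x = 1 -> exists n u, [/\ cns_set N n, U u & x = n * u]].
Proof.
move=> oU U1.
have [|V [[Q [f [CQ fh fs fV]]] NV Vd]] := fin_kernel_above CC C0
    (pro_C_compact pP) (pro_C_residual pP) N (openI oU vertex_group_open).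
  by split=> // v; right; exact: cns1.
exists Q, f; split=> //.
- by split=> // x /NV/fV.
- move=> v h /fV/Vd[n [u [Nn [_ Wu] E]]]; rewrite E; apply: cnsM => //.
  have [nr|//] := Wu v; case: nr.
  have [k _ kn] := Nv v Nn; exists (k^-1 * h) => //.
  by rewrite vertex_mapM (morphismV (@vertex_mapM _ _ _ T D v)) kn E mulKg.
- by move=> x /fV/Vd[n [u [Nn [Uu _] E]]]; exists n, u.
Qed.

(** [cover_basis] is applied to a finite quotient whose kernel is exactly [NM]. The basis elements
    are changed modulo [N] into elements of [M], and [M] maps isomorphically onto [NM/N]. *)
Lemma complement_free (M : closedNormalSubgroup Pi) :
  (forall x, cns_set M x -> cns_set N x -> x = 1) ->
  (forall v h, cns_set (cns_join pP N M) (vm v h) -> cns_set N (vm v h)) ->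
  open (cns_set (cns_join pP N M)) ->
  free_pro_C_of_finite_rank C (cns_type M).
Proof.
move=> MN1 Jv oJ; pose J := cns_join pP N M.
have [V [[Q [f [CQ fh fs fV]]] NV Vd]] := fin_kernel_above CC C0
    (pro_C_compact pP) (pro_C_residual pP) J oJ (cns1 J).
have fJ x : f x = 1 <-> cns_set J x.
  split=> [/fV/Vd[n [u [Jn Ju ->]]]|/NV/fV //]; exact: cnsM.
have fN x : cns_set N x -> f x = 1 by move=> Nx; apply/fJ/cns_joinl.
have fM x : cns_set M x -> f x = 1 by move=> Mx; apply/fJ/cns_joinr.
have fv v h : f (vm v h) = 1 -> cns_set N (vm v h) by move=> /fJ/Jv.
have [X [w [fw wex wgen]]] :=
  cover_basis CC C0 cG mT fh fs fN fv (Nv root) CQ.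
have [|b bP] := @choice X Pi (fun x m => cns_set M m /\ exists2 n, cns_set N n & w x = n * m).
  move=> x; have /fJ[n Nn [m Mm E]] := fw x.
  by exists m; split=> //; exists n.
have bM x : cns_set M (b x) by have [] := bP x.
pose t x : cns_type M := SigSub (mem_set (bM x)).
exists #|X|, (fun i => t (enum_val i)); split; first exact: cns_type_pro_C.
move=> L pL l.
have [h [hc hM hN hw]] := wex L (fun x => l (enum_rank x)) pL.
have hb x : h (b x) = l (enum_rank x).
  have [Mb [n Nn E]] := bP x.
  by rewrite -hw E (hM _ _ (fN _ Nn)) (hN _ Nn) mul1g.
exists (h \o @cns_val _ _); split.
  split; last by move=> i /=; rewrite -[LHS]/(h (b (enum_val i))) hb enum_valK.
  split; first exact: comp_continuous (@cns_val_continuous _ _) hc.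
  by move=> x y /=; rewrite cns_valM hM //; apply/fM/cns_valP.
move=> h' [[h'c h'M] h'l].
(* For uniqueness, the locus in [M] where the two maps agree is multiplied by [N], so that
   generation of [NM] modulo [N] applies to it. *)
pose S := [set x | exists2 m : cns_type M, h (cns_val m) = h' m &
  exists2 n, cns_set N n & x = cns_val m * n].
have hL := pro_C_hausdorff pL.
have h1 : h 1 = 1 by apply: hN; exact: cns1.
have hMM (x y : cns_type M) : h (cns_val (x * y)) = h (cns_val x) * h (cns_val y).
  by rewrite cns_valM hM //; apply/fM/cns_valP.
have hV (x : cns_type M) : h (cns_val x^-1) = (h (cns_val x))^-1.
  by apply: (mulgI (h (cns_val x))); rewrite -hMM !mulgV.
have SS : subgroup_set S.
  split.
  - exists 1; first by rewrite (morphism1 h'M).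
    by exists 1; [exact: cns1 | rewrite mulg1].
  - move=> _ _ [m hm [n Nn ->]] [m' hm' [n' Nn' ->]].
    exists (m * m'); first by rewrite hMM h'M hm hm'.
    exists (n ^ cns_val m' * n'); first by apply: cnsM => //; exact: cnsJ.
    by rewrite cns_valM conjgE -!mulgA mulKVg.
  - move=> _ [m hm [n Nn ->]]; exists m^-1; first by rewrite hV (morphismV h'M) hm.
    exists (n^-1 ^ (cns_val m)^-1); first exact/cnsJ/cnsV.
    by rewrite conjgE invgK invgM cns_valV !mulgA mulVg mul1g.
have cS : closed S.
  rewrite (_ : S = [set x * y | x in @cns_val _ M @` [set m | h (cns_val m) = h' m] & y in cns_set N]).
    apply: closed_mulset; [exact: pro_C_compact pP | exact: pro_C_hausdorff pP | | exact: cns_closed].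
    apply: compact_closed; first exact: pro_C_hausdorff pP.
    apply: continuous_compact; first by apply: continuous_subspaceT; exact: cns_val_continuous.
    apply: closed_compact; first exact/cns_type_compact/(pro_C_compact pP).
    apply: closed_eqfun hL _ h'c.
    exact: comp_continuous (@cns_val_continuous _ _) hc.
  apply/seteqP; split=> x.
    by move=> [m hm [n Nn ->]]; exists (cns_val m); [exists m | exists n].
  by move=> [_ [m hm <-] [n Nn <-]]; exists m => //; exists n.
apply/funext => m /=.
have [||m' hm' [n Nn E]] := wgen S SS cS _ _ (cns_val m) (fM _ (cns_valP m)).
- by move=> n Nn; exists 1; [rewrite (morphism1 h'M) | exists n; rewrite ?mul1g].
- move=> x; have [_ [n Nn ->]] := bP x; have [_ SM _] := SS; apply: SM.
    by exists 1; [rewrite (morphism1 h'M) | exists n; rewrite ?mul1g].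
  exists (t x); last by exists 1; [exact: cns1 | rewrite mulg1].
  by rewrite -[LHS]/(h (b x)) hb -h'l enum_rankK.
suff -> : m = m' by [].
apply: cns_val_inj; rewrite E (MN1 n) ?mulg1 //.
rewrite (_ : n = (cns_val m')^-1 * cns_val m); last by rewrite E mulKg.
by apply: cnsM; [apply: cnsV|]; exact: cns_valP.
Qed.

Lemma free_complement_exist : finite_set (image_in_Out N) ->
  exists M : closedNormalSubgroup Pi, free_complement M.
Proof.
move=> finOut.
have oI := inner_set_open pP finOut.
have [I1 IM IV] := inner_set_subgroup N.
have [Q [f [CQ [fh fs fN] fv fI]]] := kernel_meets_vertices oI I1.
have [X [w [fw wex wgen]]] := cover_basis CC C0 cG mT fh fs fN fv (Nv root) CQ.
have inner u : f u = 1 -> inner_set N u.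
  move=> /fI[n [i [Nn Ii ->]]]; apply: IM => //.
  by exists n.
have [M [MN1 Mf oJ]] := complement_exist CC C0 pP fh fs CQ fN inner fw wex wgen.
have fMm := fh.1.
have Jf x : cns_set (cns_join pP N M) x -> f x = 1.
  by move=> [n Nn [m Mm <-]]; rewrite fMm fN // Mf // mulg1.
exists M; split.
  by apply: complement_free => // v h /Jf/fv.
move=> v; split.
  apply/seteqP; split=> x /=.
    move=> [[h _ <-] Mh]; apply: MN1 => //; apply: fv; exact: Mf.
  by move=> ->; split; [exists 1 => //; exact: vertex_map1 | exact: cns1].
(* As the vertex group contains [N], its product with [M] is a union of translates of the open set
   [NM]. *)
rewrite (_ : [set _ | _ in _ & _ in _] =
    \bigcup_(g in range (vm v)) [set g * x | x in cns_set (cns_join pP N M)]).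
  by apply: bigcup_open => g _; exact: open_mull.
apply/seteqP; split=> x.
  move=> [g rg [y My <-]]; exists g => //; exists y => //; exact: cns_joinr.
move=> [_ [h _ <-] [_ [n Nn [y My <-]] <-]]; have [k _ <-] := Nv v Nn.
exists (vm v (h * k)); first by exists (h * k).
by exists y => //; rewrite vertex_mapM mulgA.
Qed.

(** [N] is open, hence of finite index, in the root vertex group. Therefore [NM] has finite index in
    the open product of that group with [M], and is open itself. *)
Lemma free_complement_embeds (M : closedNormalSubgroup Pi) : free_complement M ->
  embeds_as_open Pi (quot M * quot N)%type.
Proof.
move=> [_ /(_ root)[disj oGM]].
apply: (@embed_quotients C Pi pP N M); last first.
  move=> x Mx Nx; have : (range (vm root) `&` M) x by split=> //; exact: (Nv root).
  by rewrite disj.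
have SN : subgroup_set (vm root @^-1` N).
  have vM := @vertex_mapM _ _ _ T D root.
  split=> /=; first by rewrite vertex_map1; exact: cns1.
    by move=> x y /= hx hy; rewrite vM; exact: cnsM.
  by move=> x /= hx; rewrite (morphismV vM); exact: cnsV.
have [l lP] := open_subgroup_reps CC C0 (vgroup_pro_C GG root) SN (oN root).
apply: (finite_index_open (W := [set x * y | x in range (vm root) & y in cns_set M])
  (l := [seq vm root a | a <- l])) => //.
- exact: cns_closed.
- exact: subgroup_cns.
- by move=> _ [n Nn [m Mm <-]]; exists n; [exact: (Nv root) | exists m].
move=> _ [_ [h _ <-] [y My <-]]; have [a al /= Na] := lP h.
exists (vm root a); first exact: map_f.
exists (vm root (h * a^-1) * y ^ (vm root a)^-1).
  by exists (vm root (h * a^-1)) => //; exists (y ^ (vm root a)^-1) => //; exact: cnsJ.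
have vM := @vertex_mapM _ _ _ T D root.
by rewrite vM (morphismV vM) conjgE invgK !mulgA !mulgVK.
Qed.

End Tame.

Theorem theorem6p5 (C : groupClass) (Gamma : graph) (GG : graphOfGroups C Gamma)
    (T : {set graph_elt Gamma}) (D : freeData GG) (N : closedNormalSubgroup (Pi1 D T)) :
  closed_class C ->
  maximal_subtree T ->
  commensurating GG ->
  injective_graph D T ->
  tame N ->
  (exists M : closedNormalSubgroup (Pi1 D T), free_complement M) /\
  (forall M : closedNormalSubgroup (Pi1 D T), free_complement M ->
     embeds_as_open (Pi1 D T) (quot M * quot N)%type).
Proof.
move=> CC mT [cG _] _ [tV _ finOut].
have [_ [root _] _] := cG.
(* The class is not empty, because the inverse system of a vertex group has a nonempty index set. *)
have C0 : exists (gT : finGroupType) (G : {group gT}), C gT G.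
  have [S CS _] := vgroup_pro_C GG root; have [i] := sys_inhabited S.
  by exists (sys_obj S i), [set: sys_obj S i]%G.
have Nv v := (tV v).1; have oN v := (tV v).2.
split; first exact: (free_complement_exist CC C0 cG mT root Nv oN).
by move=> M; exact: (free_complement_embeds CC C0 root Nv oN).
Qed.
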